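(* Fix an integer $q\ge 2$. For every $c\in\mathbb{R}$, the function $f_c(x)=\log\left|\frac{\sin \pi q(x+c)}{\sin\pi(x+c)}\right|$ on $\mathbb{T}$ has a unique maximizing measure $\nu_c$ (a $T$-invariant Borel probability measure with $\int f_c\,d\nu_c=\beta(c)$), and $\nu_c$ is a $q$-Sturmian measure. Moreover, there exists a constant $C>0$, independent of $c$, such that $$\sum_{i=0}^{n-1}f_c(q^i x)-n\beta(c)\le C$$ for every $x\in\mathbb{R}$ and every $n\ge 1$.
   Context: $\mathbb{T}=\mathbb{R}/\mathbb{Z}$, $T(x)=qx\bmod 1$, $\mathcal{M}_T$ is the set of $T$-invariant Borel probability measures, and $\beta(c)=\sup_{\mu\in\mathcal{M}_T}\int f_c\,d\mu$. A $q$-Sturmian measure is a $T$-invariant Borel probability measure supported in a closed arc of $\mathbb{T}$ of length $1/q$. *)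

(* Defs.v *)
From HB Require Import structures.
From mathcomp Require Import all_boot all_order all_algebra.
From mathcomp Require Import all_classical all_reals all_analysis.
Set Implicit Arguments. Unset Strict Implicit. Unset Printing Implicit Defensive.
Import Order.TTheory GRing.Theory Num.Theory.
Local Open Scope classical_set_scope.
Local Open Scope ring_scope.

(* The circle T = R/Z is represented by the fundamental domain [0,1) inside R. *)
Definition frac (R : realType) (x : R) : R := x - (Num.floor x)%:~R.

Definition Tmap (R : realType) (q : nat) (x : R) : R := frac (q%:R * x).

Definition Tinvariant (R : realType) (q : nat) (mu : probability R R) : Prop :=
  mu [set` `[0%R, 1%R[] = 1%E /\
  forall A : set R, measurable A -> mu (Tmap q @^-1` A) = mu A.

(* f_c(x) = log |sin(pi q (x+c)) / sin(pi (x+c))|, extended by continuity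
   (value log q) where sin(pi (x+c)) = 0, and -oo at the zeros of the
   numerator. *)
Definition fc (R : realType) (q : nat) (c x : R) : \bar R :=
  let s1 := sin (pi * (x + c)) in
  let s2 := sin (pi * q%:R * (x + c)) in
  if s1 == 0 then (ln q%:R)%:E
  else if s2 == 0 then -oo%E
  else (ln `|s2 / s1|)%:E.

Definition beta (R : realType) (q : nat) (c : R) : \bar R :=
  ereal_sup [set r | exists mu : probability R R,
                       Tinvariant q mu /\ (\int[mu]_x fc q c x)%E = r].

Definition maximizing (R : realType) (q : nat) (c : R) (nu : probability R R)
  : Prop :=
  Tinvariant q nu /\ (\int[nu]_x fc q c x)%E = beta q c.

Definition arc (R : realType) (q : nat) (a : R) : set R :=
  [set x | frac (x - a) <= q%:R^-1].

Definition sturmian (R : realType) (q : nat) (nu : probability R R) : Prop :=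
  Tinvariant q nu /\ exists a : R, nu (~` arc q a) = 0%E.

(* Main.v *)
(* In the coordinate u = x + c, f_c becomes f u = ln |sin (pi q u) / sin (pi u)| and T becomes
   u |-> q u + K mod 1. For an arc [-r, s] with r + s = 1/q, iterating the inverse branch of T
   with values in the arc yields a Lipschitz Psi with Psi (q u + K) = f u + Psi u - const on the
   arc, and an intermediate value argument in r makes Psi periodic. Concavity of f on its main
   lobe bounds the slopes of Psi; these bounds show that on each fibre {u + k/q} the function
   Psi - ln |sin (pi .)| is largest exactly at the points of the arc. As |sin (pi q .)| is constant
   on the fibre, f + Psi - Psi o T is maximal exactly on the arc, so the Birkhoff sums are bounded
   by the oscillation of Psi and the maximizing measures are the invariant measures carried by
   the arc. One exists: code a rotation by base q digits, with the rotation number chosen so that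
   the coded points fall in the arc. It is unique: the digit sums of every orbit in the arc
   squeeze the distribution function of such a measure. *)
Require Import Defs.
From HB Require Import structures.
From mathcomp Require Import all_boot all_order all_algebra.
From mathcomp Require Import all_classical all_reals all_analysis measurable_realfun.
From mathcomp Require Import ring lra zify.
Set Implicit Arguments. Unset Strict Implicit. Unset Printing Implicit Defensive.
Import Order.TTheory GRing.Theory Num.Theory.
Import numFieldNormedType.Exports.
Import Defs.
Local Open Scope classical_set_scope.
Local Open Scope ring_scope.

(** * The function f and its slope *)

(** The delicate point is the strict comparison along a fibre. At the ends of the arc two
    neighbouring points of the fibre tie, so no uniform margin exists: neighbours are compared
    through derivatives, starting from the tie. Points further apart do have a margin, but a thin
    one for small q, whence the explicit rational bounds for π and exp and the separate treatment of
    q = 3, q = 4 and q ≥ 5. For q = 2 all points of a fibre are neighbours, but the plain Lipschitz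
    bound for u ↦ Psi (u + 1/2) - Psi u is never below the required 2π; the antiperiodicity of this
    function improves it. The reflection u ↦ -u exchanges the ends of the arc and allows r ≤ s. The
    constant of the theorem does not depend on c because K only moves the jump of the inverse
    branch: the sign change that makes Psi periodic occurs for r between [r_min] and 1/q - [r_min]
    whatever K is, and the slope of f on that range bounds the slope of Psi. *)

Section calculus.
Context {R : realType}.
Implicit Types (f df : R -> R) (a b m x u : R).

Lemma increment_ge f df a b m : a <= b ->
  (forall x, a <= x <= b -> is_derive x 1 f (df x)) ->
  (forall x, a < x < b -> m <= df x) -> m * (b - a) <= f b - f a.
Proof.
move=> ab fd le_m; have [<-|ltab] := eqVneq a b; first by rewrite !subrr mulr0.
have {}ab : a < b by rewrite lt_neqAle ltab.
have [||c cab ->] := @MVT _ f df a b ab.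
- by move=> x; rewrite in_itv/= => /andP[? ?]; apply: fd; rewrite !ltW.
- apply: derivable_within_continuous => x; rewrite in_itv/= => /fd h.
  exact: ex_derive.
- by rewrite ler_wpM2r ?subr_ge0 ?(ltW ab)//; apply: le_m; rewrite in_itv in cab.
Qed.

Lemma increment_le f df a b m : a <= b ->
  (forall x, a <= x <= b -> is_derive x 1 f (df x)) ->
  (forall x, a < x < b -> df x <= m) -> f b - f a <= m * (b - a).
Proof.
move=> ab fd le_m.
have : - m * (b - a) <= (fun x => - f x) b - (fun x => - f x) a.
  apply: (@increment_ge (fun x => - f x) (fun x => - df x)) => // x hx; last by rewrite lerN2 le_m.
  by have h := fd x hx; exact: is_deriveN.
by rewrite /=; lra.
Qed.

Lemma is_derive_comp_cst f (k x l : R) :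
  is_derive (k * x) 1 f l -> is_derive x 1 (fun y => f (k * y)) (k * l).
Proof.
move=> h; have hk : is_derive x 1 (fun y : R => k * y) k.
  by apply: is_derive_eq; rewrite /GRing.scale/= mulr1.
have := @is_derive1_comp _ f (fun y => k * y) x _ _ h hk.
by rewrite [l * k]mulrC.
Qed.

Lemma is_derive_comp_shift f (k x l : R) :
  is_derive (x + k) 1 f l -> is_derive x 1 (fun y => f (y + k)) l.
Proof.
move=> h; have hk : is_derive x 1 (fun y : R => y + k) 1.
  by apply: is_derive_eq; rewrite addr0.
have := @is_derive1_comp _ f (fun y => y + k) x _ _ h hk.
by rewrite mulr1.
Qed.

Definition cot x : R := cos x / sin x.

Lemma is_derive_ln_sin x : 0 < sin x -> is_derive x 1 (fun y => ln (sin y)) (cot x).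
Proof.
move=> sx; have h := is_derive1_ln sx.
have := @is_derive1_comp _ (@ln R) (@sin R) x _ _ h (is_derive_sin x).
by rewrite mulrC.
Qed.

Lemma sin_gt0_cycle x : 0 < x < 1 -> 0 < sin (pi * x).
Proof.
move=> /andP[x0 x1]; apply: sin_gt0_pi; have p := @pi_gt0 R.
by apply/andP; split; nra.
Qed.

Lemma is_derive_ln_sinpi x : 0 < x < 1 ->
  is_derive x 1 (fun y => ln (sin (pi * y))) (pi * cot (pi * x)).
Proof.
move=> hx; apply: (@is_derive_comp_cst (fun y => ln (sin y))).
exact: is_derive_ln_sin (sin_gt0_cycle _).
Qed.

Lemma cotB x y : sin x != 0 -> sin y != 0 ->
  cot x - cot y = sin (y - x) / (sin x * sin y).
Proof. by move=> sx sy; rewrite /cot sinB; field; rewrite sx sy. Qed.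

Lemma cotD x y : sin x != 0 -> sin y != 0 ->
  cot x + cot y = sin (x + y) / (sin x * sin y).
Proof. by move=> sx sy; rewrite /cot sinD; field; rewrite sx sy. Qed.

Lemma sin_lt_id x : 0 < x -> sin x < x.
Proof.
move=> x0; have [x1|x1] := ltP 1 x; first exact: le_lt_trans (sin_le1 _) x1.
have [c /andP[c0 cx] e] : exists2 c, 0 < c < x & sin x - sin 0 = cos c * (x - 0).
  have [|c] := @MVT _ (@sin R) cos 0 x x0.
  - by apply: derivable_within_continuous => y _; exact: derivable_sin.
  - by rewrite in_itv/= => ? ?; exists c.
move: e; rewrite sin0 !subr0 => ->; rewrite gtr_pMl//.
rewrite -cos0 ltr_cos ?in_itv/= ?lexx ?pi_ge0//.
have := @pi_ge2 R; lra.
Qed.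

Lemma cos_ge_quadratic x : 1 - x ^+ 2 / 2 <= cos x.
Proof.
wlog x0 : x / 0 <= x => [H|].
  by have [/H//|/ltW h] := leP 0 x; have := H (- x); rewrite cosN sqrrN oppr_ge0; exact.
pose g y : R := cos y + y ^+ 2 / 2.
have : 0 * (x - 0) <= g x - g 0.
  apply: (@increment_ge g (fun y => - sin y + y)) => // y /andP[y0 yx].
    by rewrite /g; apply: is_derive_eq; rewrite /GRing.scale/= !mulr1; lra.
  by have := sin_lt_id y0; lra.
by rewrite /g cos0; lra.
Qed.

Lemma sin_ge_cubic x : 0 <= x -> x - x ^+ 3 / 6 <= sin x.
Proof.
move=> x0; pose g y : R := sin y - (y - y ^+ 3 / 6).
have : 0 * (x - 0) <= g x - g 0.
  apply: (@increment_ge g (fun y => cos y - (1 - y ^+ 2 / 2))) => // y /andP[y0 yx].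
    by rewrite /g; apply: is_derive_eq; rewrite /GRing.scale/= ?mulr1; lra.
  by have := cos_ge_quadratic y; lra.
by rewrite /g sin0; lra.
Qed.

Lemma x_cos_le_sin x : 0 <= x <= pi -> x * cos x <= sin x.
Proof.
move=> /andP[x0 xp]; pose g y : R := sin y - y * cos y.
have : 0 * (x - 0) <= g x - g 0.
  apply: (@increment_ge g (fun y => y * sin y)) => // y /andP[y0 yx].
    by rewrite /g; apply: is_derive_eq; rewrite /GRing.scale/= ?mulr1; lra.
  by rewrite mulr_ge0 ?ltW// sin_gt0_pi// y0 (lt_le_trans yx).
by rewrite /g sin0 cos0; lra.
Qed.

Lemma cot_le_inv x : 0 < x < pi -> cot x <= x^-1.
Proof.
move=> /andP[x0 xp]; have sx : 0 < sin x by rewrite sin_gt0_pi// x0.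
by rewrite /cot ler_pdivrMr// mulrC ler_pdivlMr// mulrC x_cos_le_sin// ltW//= ltW.
Qed.

End calculus.

(** * The quotients sin (n x) / sin x *)

Section dirichlet.
Context {R : realType}.
Implicit Types (x u : R) (n q : nat).

(* sin (n x) / sin x as a trigonometric polynomial: no division at the zeros of sin. *)
Fixpoint dir n x : R :=
  if n is m.+1 then dir m x * cos x + cos (m%:R * x) else 0.

Fixpoint ddir n x : R :=
  if n is m.+1 then ddir m x * cos x - dir m x * sin x - m%:R * sin (m%:R * x)
  else 0.

Lemma dir_sin n x : dir n x * sin x = sin (n%:R * x).
Proof.
elim: n => [|n IH] /=; first by rewrite !mul0r sin0.
rewrite -natr1 [(_ + 1) * x]mulrDl mul1r sinD -IH; ring.
Qed.

(** This is the derivative of [dir_sin], proved by the same induction. *)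
Lemma ddir_sin n x : ddir n x * sin x + dir n x * cos x = n%:R * cos (n%:R * x).
Proof.
elim: n => [|n IH] /=; first by rewrite !mul0r addr0.
rewrite -natr1 [(n%:R + 1) * x]mulrDl mul1r cosD -dir_sin.
have -> : (n%:R + 1) * (cos (n%:R * x) * cos x - dir n x * sin x * sin x) =
  (n%:R * cos (n%:R * x)) * cos x - n%:R * (dir n x * sin x) * sin x
  + cos (n%:R * x) * cos x - dir n x * (sin x ^+ 2) by ring.
by rewrite -IH; ring.
Qed.

Lemma is_derive_dir n x : is_derive x 1 (dir n) (ddir n x).
Proof.
elim: n => [|n IH]; first exact: is_derive_cst.
have h : is_derive x 1 (fun y : R => cos (n%:R * y)) (n%:R * - sin (n%:R * x)).
  exact: is_derive_comp_cst.
rewrite (_ : dir n.+1 = (fun y => dir n y * cos y + cos (n%:R * y)))//.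
by apply: is_derive_eq; rewrite /GRing.scale/=; ring.
Qed.

Lemma dir_le n x : `|dir n x| <= n%:R.
Proof.
elim: n => [|n IH] /=; first by rewrite normr0.
rewrite (le_trans (ler_normD _ _))// -natr1 lerD ?cos_max// normrM.
by rewrite (le_trans _ IH)// ler_piMr// cos_max.
Qed.

Lemma dir0 n : dir n 0 = n%:R.
Proof. by elim: n => //= n ->; rewrite mulr0 cos0 mulr1 natr1. Qed.

Lemma ddir0 n : ddir n 0 = 0.
Proof. by elim: n => //= n ->; rewrite mulr0 sin0 mul0r !mulr0 !subr0. Qed.

Lemma dirN n x : dir n (- x) = dir n x.
Proof. by elim: n => //= n ->; rewrite mulrN !cosN. Qed.

Lemma dir_gt0 n x : (0 < n)%N -> n%:R * `|x| < pi -> 0 < dir n x.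
Proof.
move=> n0; wlog x0 : x / 0 <= x => [H|].
  have [/H//|/ltW h] := leP 0 x.
  by have := H (- x); rewrite dirN normrN oppr_ge0; exact.
rewrite ger0_norm// => nx.
have [->|xn0] := eqVneq x 0; first by rewrite dir0 ltr0n.
have {}x0 : 0 < x by rewrite lt_neqAle eq_sym xn0.
have n1 : 1 <= n%:R :> R by rewrite ler1n.
have sx : 0 < sin x by rewrite sin_gt0_pi// x0/= (le_lt_trans _ nx)// ler_peMl// ltW.
by rewrite -(pmulr_lgt0 _ sx) dir_sin sin_gt0_pi// nx mulr_gt0 ?ltr0n.
Qed.

(** At a zero of sin, [ddir_sin] reads dir n x · cos x = n cos (n x), and both cosines are 1 or
    -1. *)
Lemma norm_dir_sin0 n x : sin x = 0 -> `|dir n x| = n%:R.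
Proof.
move=> sx; have := ddir_sin n x; rewrite sx mulr0 add0r => h.
have c1 : `|cos x| = 1 by apply: sin0cos1.
have c2 : `|cos (n%:R * x)| = 1 by apply: sin0cos1; rewrite -dir_sin sx mulr0.
by have := congr1 Num.norm h; rewrite !normrM c1 c2 !mulr1 normr_nat.
Qed.

End dirichlet.

(** * Concavity of the logarithm of the quotient on its main lobe *)

Section log_dirichlet.
Context {R : realType} (q : nat).
Hypothesis hq : (2 <= q)%N.
Implicit Types (r s u x y d : R).

Let Q : R := q%:R.

Let Q2 : 2 <= Q. Proof. by rewrite ler_nat. Qed.

(** At a zero of [dir] the convention ln 0 = 0 gives 0 instead of -oo. [fcE] singles these points
    out, and none lies in the main lobe |u| < 1/q. *)
Definition flog u : R := ln `|dir q (pi * u)|.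

(* slope = -f' for f = flog. *)
Definition slope u : R := - (pi * (ddir q (pi * u) / dir q (pi * u))).

Lemma flog_le u : flog u <= ln q%:R.
Proof.
rewrite /flog; have [->|d0] := eqVneq (dir q (pi * u)) 0.
  by rewrite normr0 ln0// ln_ge0// ler1n; lia.
by rewrite ler_ln ?posrE ?normr_gt0// ?dir_le// ltr0n; lia.
Qed.

Lemma flogN u : flog (- u) = flog u.
Proof. by rewrite /flog mulrN dirN. Qed.

Lemma flogE u : 0 < u < Q^-1 -> flog u = ln (sin (pi * (Q * u))) - ln (sin (pi * u)).
Proof.
move=> /andP[u0 uq]; have u1 : Q * u < 1 by rewrite mulrC -ltr_pdivlMr ?div1r//; have := Q2; lra.
have q2 := Q2.
have s1 : 0 < sin (pi * u) by apply: sin_gt0_cycle; nra.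
have s2 : 0 < sin (pi * (Q * u)) by apply: sin_gt0_cycle; nra.
have e : dir q (pi * u) = sin (pi * (Q * u)) / sin (pi * u).
  by rewrite [pi * (Q * u)]mulrCA -(dir_sin q) mulfK// gt_eqF.
by rewrite /flog e ger0_norm ?divr_ge0 ?ltW// ln_div.
Qed.

Lemma dir_lobe_gt0 u : `|u| < Q^-1 -> 0 < dir q (pi * u).
Proof.
move=> uq; apply: dir_gt0; first lia.
have p := @pi_gt0 R; rewrite normrM (ger0_norm (ltW p)) mulrCA gtr_pMr//.
by rewrite mulrC -ltr_pdivlMr ?div1r//; have := Q2; lra.
Qed.

Lemma is_derive_flog u : `|u| < Q^-1 -> is_derive u 1 flog (- slope u).
Proof.
move=> uq; rewrite /slope opprK.
have d0 := dir_lobe_gt0 uq.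
have h1 : is_derive u 1 (fun v => dir q (pi * v)) (pi * ddir q (pi * u)).
  exact: (is_derive_comp_cst (is_derive_dir q _)).
have h2 := @is_derive1_comp _ (@ln R) (fun v => dir q (pi * v)) u _ _ (is_derive1_ln d0) h1.
have -> : pi * (ddir q (pi * u) / dir q (pi * u)) = (dir q (pi * u))^-1 * (pi * ddir q (pi * u)).
  by ring.
apply: (near_eq_is_derive _ h2); near=> v.
rewrite /flog /= ger0_norm// ltW// dir_lobe_gt0//.
near: v.
exact: (@cvgr_norm_lt _ _ _ _ _ id u _ _ uq).
Unshelve. all: by end_near. Qed.

Lemma slope0 : slope 0 = 0.
Proof. by rewrite /slope mulr0 ddir0 mul0r mulr0 oppr0. Qed.

Lemma slopeE u : 0 < u < Q^-1 ->
  slope u = pi * cot (pi * u) - Q * (pi * cot (Q * (pi * u))).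
Proof.
move=> /andP[u0 uq]; have q2 := Q2.
have u1 : Q * u < 1 by rewrite mulrC -ltr_pdivlMr ?div1r//; lra.
have s1 : 0 < sin (pi * u) by apply: sin_gt0_cycle; nra.
have s2 : 0 < sin (pi * (Q * u)) by apply: sin_gt0_cycle; nra.
have d0 : 0 < dir q (pi * u) by rewrite dir_lobe_gt0// ger0_norm// ltW.
have h := ddir_sin q (pi * u); have h2 := dir_sin q (pi * u).
rewrite /slope /cot; rewrite mulrCA in s2; rewrite -/Q in h h2; rewrite -h2.
have -> : Q * (pi * (cos (Q * (pi * u)) / (dir q (pi * u) * sin (pi * u)))) =
  pi * (Q * cos (Q * (pi * u))) / (dir q (pi * u) * sin (pi * u)) by ring.
by rewrite -h; field; rewrite !gt_eqF.
Qed.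

Lemma slopeN u : `|u| < Q^-1 -> slope (- u) = - slope u.
Proof.
have pos v : 0 < v < Q^-1 -> slope (- v) = - slope v.
  move=> /andP[v0 vq]; have q2 := Q2.
  have v1 : Q * v < 1 by rewrite mulrC -ltr_pdivlMr ?div1r//; lra.
  have s1 : 0 < sin (pi * v) by apply: sin_gt0_cycle; nra.
  have h := ddir_sin q (pi * v); have := ddir_sin q (- (pi * v)).
  rewrite !mulrN !dirN !cosN sinN -h => /eqP; rewrite mulrN -subr_eq0 => /eqP h3.
  have h4 : (ddir q (- (pi * v)) + ddir q (pi * v)) * sin (pi * v) = 0.
    by apply/eqP; rewrite -oppr_eq0 -h3; apply/eqP; ring.
  move/eqP: h4; rewrite mulf_eq0 (gt_eqF s1) orbF addr_eq0 => /eqP e.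
  by rewrite /slope mulrN dirN e; ring.
have [u0|u0|->] := ltgtP u 0; last by rewrite oppr0 slope0 oppr0.
- by rewrite ltr0_norm// => uq; rewrite -[in RHS](opprK u) (pos (- u)) ?opprK// oppr_gt0 u0.
- by rewrite gtr0_norm// => uq; rewrite pos// u0.
Qed.

Lemma is_derive_cot x : sin x != 0 -> is_derive x 1 (@cot R) (- (sin x ^+ 2)^-1).
Proof.
move=> s0; have := is_deriveV s0 (is_derive_sin x).
rewrite /cot => h; apply: is_derive_eq; rewrite /GRing.scale/=.
have := cos2Dsin2 x; move: s0; move: (sin x) (cos x) => S C s0 e.
apply: (@eq_trans _ _ (- (C ^+ 2 + S ^+ 2) / S ^+ 2)); first by field.
by rewrite e mulN1r.
Qed.

Lemma slope_ge0 u : 0 <= u < Q^-1 -> 0 <= slope u.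
Proof.
move=> /andP[u0 uq]; have q2 := Q2.
have [->|un0] := eqVneq u 0; first by rewrite slope0.
have {un0 u0}u0 : 0 < u by rewrite lt_neqAle eq_sym un0.
have u1 : Q * u < 1 by rewrite mulrC -ltr_pdivlMr ?div1r//; lra.
have s1 : 0 < sin (pi * u) by apply: sin_gt0_cycle; nra.
have s2 : 0 < sin (Q * (pi * u)) by rewrite mulrCA; apply: sin_gt0_cycle; nra.
rewrite slopeE ?u0// /cot.
(* phi is the numerator of the difference of cotangents; it vanishes at 0 and has derivative (Q^2 -
   1) sin (Q y) sin y, nonnegative on the lobe. *)
pose phi y : R := sin (Q * y) * cos y - Q * (cos (Q * y) * sin y).
have p := @pi_gt0 R.
have : 0 * (pi * u - 0) <= phi (pi * u) - phi 0.
  apply: (@increment_ge _ _ (fun y => (Q ^+ 2 - 1) * (sin (Q * y) * sin y))) => [|y _|y /andP[y0 yu]].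
  - by rewrite mulr_ge0// ltW.
  - have d1 : is_derive y 1 (fun y => sin (Q * y)) (Q * cos (Q * y)).
      exact: is_derive_comp_cst.
    have d2 : is_derive y 1 (fun y => cos (Q * y)) (Q * - sin (Q * y)).
      exact: is_derive_comp_cst.
    by rewrite /phi; apply: is_derive_eq; rewrite /GRing.scale/=; ring.
  - rewrite mulr_ge0//; first nra.
    have ? : pi * u < pi by nra.
    have ? : Q * y < Q * (pi * u) by rewrite ltr_pM2l//; lra.
    have ? : Q * (pi * u) < pi by rewrite mulrCA; nra.
    by rewrite mulr_ge0// ltW// sin_gt0_pi//; apply/andP; split; nra.
rewrite /phi !mulr0 sin0 cos0 !mul0r !mulr0 !subr0 => h.
have -> : pi * (cos (pi * u) / sin (pi * u)) -
  Q * (pi * (cos (Q * (pi * u)) / sin (Q * (pi * u)))) =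
  pi * ((sin (Q * (pi * u)) * cos (pi * u) - Q * (cos (Q * (pi * u)) * sin (pi * u)))
   / (sin (pi * u) * sin (Q * (pi * u)))) by field; rewrite !gt_eqF.
by rewrite mulr_ge0 ?divr_ge0 ?(ltW p)// mulr_ge0// ltW.
Qed.

(** Concavity of f on the main lobe: with D the value of [dir], the derivative of [slope] is π^2
    (Q^2 - D^2) / (D sin)^2, and D ≤ Q by [dir_le]. Oddness covers negative arguments. *)
Lemma slope_le u x : - Q^-1 < u -> u <= x -> x < Q^-1 -> slope u <= slope x.
Proof.
have pos v y : 0 < v -> v <= y -> y < Q^-1 -> slope v <= slope y.
  move=> v0 vy yq; have q2 := Q2.
  rewrite !slopeE; [|lra|lra].
  pose g (u : R) : R := pi * cot (pi * u) - Q * (pi * cot (Q * (pi * u))).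
  suff : 0 * (y - v) <= g y - g v by rewrite /g mul0r subr_ge0.
  apply: (@increment_ge _ g (fun t => pi * (pi * - (sin (pi * t) ^+ 2)^-1) -
    Q * (pi * (pi * (Q * - (sin (Q * (pi * t)) ^+ 2)^-1))))) => [//|t /andP[t1 t2]|t /andP[t1 t2]].
    have u1 : Q * t < 1 by rewrite mulrC -ltr_pdivlMr ?div1r//; lra.
    have s1 : 0 < sin (pi * t) by apply: sin_gt0_cycle; nra.
    have s2 : 0 < sin (Q * (pi * t)) by rewrite mulrCA; apply: sin_gt0_cycle; nra.
    have d1 : is_derive t 1 (fun t => cot (pi * t)) (pi * - (sin (pi * t) ^+ 2)^-1).
      by apply: is_derive_comp_cst; apply: is_derive_cot; rewrite gt_eqF.
    have d2 : is_derive t 1 (fun t => cot (Q * (pi * t)))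
        (pi * (Q * - (sin (Q * (pi * t)) ^+ 2)^-1)).
      apply: (@is_derive_comp_cst _ (fun y => cot (Q * y))).
      by apply: is_derive_comp_cst; apply: is_derive_cot; rewrite gt_eqF.
    by rewrite /g; apply: is_derive_eq; rewrite /GRing.scale/=; ring.
  have u1 : Q * t < 1 by rewrite mulrC -ltr_pdivlMr ?div1r//; lra.
  have s1 : 0 < sin (pi * t) by apply: sin_gt0_cycle; nra.
  have s2 : 0 < sin (Q * (pi * t)) by rewrite mulrCA; apply: sin_gt0_cycle; nra.
  have d0 : 0 < dir q (pi * t) by rewrite dir_lobe_gt0// gtr0_norm; lra.
  have := dir_le q (pi * t); rewrite gtr0_norm// -/Q => dq.
  rewrite -(dir_sin q) -/Q.
  move: (dir _ _) (sin _) d0 s1 dq => D S d0 s1 dq.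
  have -> : pi * (pi * - (S ^+ 2)^-1) - Q * (pi * (pi * (Q * - ((D * S) ^+ 2)^-1))) =
    pi ^+ 2 * ((Q ^+ 2 - D ^+ 2) / (D * S) ^+ 2) by field; rewrite !gt_eqF.
  rewrite mulr_ge0 ?sqr_ge0// divr_ge0 ?sqr_ge0// subr_ge0.
  by rewrite ler_sqr ?nnegrE// ltW// (lt_le_trans d0).
move=> uq ux xq; have [u0|u0] := ltP 0 u; first exact: pos.
have [x0|x0] := leP 0 x.
  apply: (@le_trans _ _ 0); last by rewrite slope_ge0// x0.
  have uq' : `|- u| < Q^-1 by rewrite normrN ler0_norm; lra.
  by have := slopeN uq'; have := @slope_ge0 (- u); rewrite opprK => ? ->; lra.
have uq' : `|- u| < Q^-1 by rewrite normrN ler0_norm; lra.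
have xq' : `|- x| < Q^-1 by rewrite normrN ltr0_norm; lra.
have := slopeN uq'; have := slopeN xq'; rewrite (opprK u) (opprK x) => -> ->.
by rewrite lerN2; apply: pos; lra.
Qed.

Lemma flog_incr_le x y : - Q^-1 < x -> x <= y -> y < Q^-1 ->
  flog y - flog x <= - slope x * (y - x).
Proof.
move=> xq xy yq; apply: (@increment_le _ _ (fun t => - slope t)) => // t /andP[t1 t2].
  by apply: is_derive_flog; rewrite ltr_norml; lra.
by rewrite lerN2; apply: slope_le; lra.
Qed.

Lemma flog_incr_ge x y : - Q^-1 < x -> x <= y -> y < Q^-1 ->
  - slope y * (y - x) <= flog y - flog x.
Proof.
move=> xq xy yq; apply: (@increment_ge _ _ (fun t => - slope t)) => // t /andP[t1 t2].
  by apply: is_derive_flog; rewrite ltr_norml; lra.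
by rewrite lerN2; apply: slope_le; lra.
Qed.

Lemma flog_concave_shift x y d : - Q^-1 < x -> x <= y -> 0 <= d -> y + d < Q^-1 ->
  flog (y + d) - flog y <= flog (x + d) - flog x.
Proof.
move=> xq xy d0 yq; pose g t : R := flog (t + d) - flog t.
suff : g y - g x <= 0 * (y - x) by rewrite /g mul0r subr_le0.
apply: (@increment_le _ _ (fun t => - slope (t + d) - - slope t)) => // t /andP[t1 t2].
  have d1 : is_derive t 1 (fun t => flog (t + d)) (- slope (t + d)).
    by apply: is_derive_comp_shift; apply: is_derive_flog; rewrite ltr_norml; lra.
  have d2 : is_derive t 1 flog (- slope t).
    by apply: is_derive_flog; rewrite ltr_norml; lra.
  exact: is_deriveB.
by have := @slope_le t (t + d); lra.
Qed.

End log_dirichlet.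

(** * Quasi-periodic fixed points of an inverse branch *)

Section geometric_limit.
Context {R : realType} (Q : R).
Hypothesis Q2 : 2 <= Q.

Lemma natr_le_expr n : n%:R <= Q ^+ n.
Proof.
elim: n => [|n IH]; first by rewrite expr0.
have h : 1 <= Q ^+ n by rewrite exprn_ege1//; have := Q2; lra.
have := Q2.
by rewrite -natr1 exprS; nra.
Qed.

Lemma geometric_small (C e : R) : 0 < e -> exists n, C / Q ^+ n < e.
Proof.
move=> e0; have [n hn] : exists n : nat, C / e < n%:R.
  exists (Num.bound `|C / e|); apply: le_lt_trans (ler_norm _) _.
  exact: archi_boundP (normr_ge0 _).
exists n; have Qn : 0 < Q ^+ n by rewrite exprn_gt0//; have := Q2; lra.
rewrite ltr_pdivrMr// mulrC -ltr_pdivrMr//.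
exact: lt_le_trans hn (natr_le_expr n).
Qed.

Lemma le_geometric_limit (A B C : R) : (forall n, A <= B + C / Q ^+ n) -> A <= B.
Proof.
move=> h; rewrite leNgt; apply/negP => BA.
have [n] := @geometric_small C (A - B) (ltac:(by rewrite subr_gt0)).
by have := h n; lra.
Qed.

(** Widening u n by 2 C / Q^n gives nested intervals because Q ≥ 2. The explicit rate later serves
    to define the limits themselves. *)
Lemma geometric_limit (u : nat -> R) (C : R) :
  (forall n, `|u n.+1 - u n| <= C / Q ^+ n) ->
  exists l, forall n, `|u n - l| <= 2 * C / Q ^+ n.
Proof.
move=> hu.
have Qn n : 0 < Q ^+ n by rewrite exprn_gt0//; have := Q2; lra.
have C0 : 0 <= C.
  by have := hu 0%N; rewrite expr0 divr1; apply: le_trans; exact: normr_ge0.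
have half n : C / Q ^+ n.+1 <= C / Q ^+ n / 2.
  have qi : Q^-1 <= 2^-1 by rewrite lef_pV2 ?posrE//; have := Q2; lra.
  have X0 : 0 <= C / Q ^+ n by rewrite divr_ge0// ltW.
  by rewrite exprS invfM mulrCA; nra.
pose v n := u n - 2 * C / Q ^+ n; pose w n := u n + 2 * C / Q ^+ n.
have hv n : v n <= v n.+1.
  by rewrite /v -!mulrA; have := half n; have := hu n; rewrite ler_norml; lra.
have hw n : w n.+1 <= w n.
  by rewrite /w -!mulrA; have := half n; have := hu n; rewrite ler_norml; lra.
have vm := @nondecreasing_seqP _ _ v; have {vm} := (iffLR vm hv) => vm.
have wm := @nonincreasing_seqP _ _ w; have {wm} := (iffLR wm hw) => wm.
have vw n m : v n <= w m.
  have [nm|/ltnW mn] := leqP n m.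
  - rewrite (le_trans (vm _ _ nm))// /v /w lerD2l.
    by rewrite (@le_trans _ _ 0)// ?oppr_le0 divr_ge0 ?(ltW (Qn _))// mulr_ge0.
  - rewrite (le_trans _ (wm _ _ mn))// /v /w lerD2l.
    by rewrite (@le_trans _ _ 0)// ?oppr_le0 divr_ge0 ?(ltW (Qn _))// mulr_ge0.
exists (sup (range v)) => n.
have hs : has_sup (range v).
  by split; [exists (v 0%N); exists 0%N|exists (w 0%N) => _ [m _ <-]].
have h1 : v n <= sup (range v) by apply: sup_upper_bound => //; exists n.
have h2 : sup (range v) <= w n.
  by apply: sup_le_ub; [exists (v 0%N); exists 0%N|move=> _ [m _ <-]].
by rewrite ler_norml; move: h1 h2; rewrite /v /w; lra.
Qed.

End geometric_limit.

(** * Integer and fractional parts *)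

Section floor_frac.
Context {R : realType}.
Implicit Types (x : R) (m : int).

Lemma frac_itv x : 0 <= frac x < 1.
Proof. by have := floor_itv x; rewrite /frac; lra. Qed.

Lemma floor_frac x : x = (Num.floor x)%:~R + frac x.
Proof. by rewrite /frac; lra. Qed.

Lemma fracP x m y : 0 <= y < 1 -> x = m%:~R + y -> Num.floor x = m /\ frac x = y.
Proof.
move=> hy e; have fm : Num.floor x = m.
  by apply: floor_def; rewrite intrD; lra.
by split=> //; rewrite /frac fm e; lra.
Qed.

Lemma frac_id x : 0 <= x < 1 -> frac x = x.
Proof. by move=> hx; have [] := @fracP x 0 x hx (ltac:(lra)). Qed.

Lemma fracDz x m : frac (x + m%:~R) = frac x.
Proof.
have [] // := @fracP (x + m%:~R) (Num.floor x + m) (frac x) (frac_itv x).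
by rewrite intrD [in LHS](floor_frac x); lra.
Qed.

End floor_frac.

Definition bounded_slope {R : realType} (lo hi a b : R) (g : R -> R) :=
  forall x y, a <= x -> x <= y -> y <= b ->
    lo * (y - x) <= g y - g x <= hi * (y - x).

Section quasi_periodic_extension.
Context {R : realType}.
Implicit Types (g : R -> R) (x y t lo hi : R).

(** The increments of g over [0, 1] are repeated with period 1, so slope bounds survive across the
    integers even when g 1 differs from g 0; a periodic extension would jump there. *)
Definition qext g t : R := (Num.floor t)%:~R * g 1 + g (frac t).

Lemma qextE g t : g 0 = 0 -> 0 <= t <= 1 -> qext g t = g t.
Proof.
move=> g0 /andP[t0]; rewrite le_eqVlt => /predU1P[->|t1].
- have [f1 f2] := @fracP R 1 1 0 (ltac:(lra)) (ltac:(lra)).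
  by rewrite /qext f1 f2 g0 mul1r addr0.
- have [f1 f2] := @fracP R t 0 t (ltac:(lra)) (ltac:(lra)).
  by rewrite /qext f1 f2 mul0r add0r.
Qed.

Lemma qextD1 g t : qext g (t + 1) = qext g t + g 1.
Proof.
have [f1 f2] := @fracP R (t + 1) (Num.floor t + 1) (frac t) (frac_itv t)
  (ltac:(rewrite intrD [in LHS](floor_frac t); lra)).
by rewrite /qext f1 f2 intrD; ring.
Qed.

Lemma qextB g g' t : qext g t - qext g' t = qext (fun x => g x - g' x) t.
Proof. by rewrite /qext; ring. Qed.

Lemma bounded_slope_qext g lo hi : g 0 = 0 -> bounded_slope lo hi 0 1 g ->
  forall x y, x <= y -> lo * (y - x) <= qext g y - qext g x <= hi * (y - x).
Proof.
move=> g0 hg x y xy; rewrite /qext.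
have := frac_itv x; have := frac_itv y.
have ex := floor_frac x; have ey := floor_frac y.
have mn : Num.floor x <= Num.floor y by exact: le_floor.
move: ex ey mn.
move: (Num.floor x) (Num.floor y) (frac x) (frac y) => m n fx fy ex ey mn hy hx.
have {mn}[mn|mn] : m = n \/ m + 1 <= n by lia.
  subst n; have fxy : fx <= fy by lra.
  have -> : y - x = fy - fx by lra.
  by have := hg fx fy (ltac:(lra)) fxy (ltac:(lra)); lra.
have mn' : m%:~R + 1 <= n%:~R :> R by rewrite -[1]/(1%:~R) -intrD ler_int.
have h1 := hg fx 1 (ltac:(lra)) (ltac:(lra)) (ltac:(lra)).
have h2 := hg 0 fy (ltac:(lra)) (ltac:(lra)) (ltac:(lra)).
have h3 := hg 0 1 (ltac:(lra)) (ltac:(lra)) (ltac:(lra)).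
move: h1 h2 h3; rewrite g0; move: (g 1) (g fx) (g fy) => g1 gx gy.
move: mn' ex ey; move: (m%:~R : R) (n%:~R : R) => M N MN -> -> h1 h2 h3.
have e : 0 <= N - M - 1 by lra.
by apply/andP; split; nra.
Qed.

End quasi_periodic_extension.

(* Psi is built as the limit of the iterates of the inverse-branch operator attached
   to the arc [a, a + 1/Q], whose inverse branch jumps at Q a + K.  It satisfies
   Psi = (f + Psi) o branch up to a constant, and it is periodic for the value
   of a at which its increment over a period vanishes. *)
Section inverse_branch.
Context {R : realType} (Q K : R) (f : R -> R).
Hypothesis Q2 : 2 <= Q.
Implicit Types (a x y t : R) (g : R -> R).

Definition branch_incr a g t : R := f (a + t / Q) + g (a + t / Q) - (f a + g a).

Definition branch_step a g x : R := qext (branch_incr a g) (x - (Q * a + K)).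

Definition branch_iter a n : R -> R := iter n (branch_step a) (fun=> 0).

Let Qi0 : 0 < Q^-1. Proof. by rewrite invr_gt0; have := Q2; lra. Qed.

Lemma branch_incr0 a g : branch_incr a g 0 = 0.
Proof. by rewrite /branch_incr mul0r addr0 subrr. Qed.

Lemma bounded_slope_branch_incr a g lo hi lo' hi' :
  bounded_slope lo hi a (a + Q^-1) f ->
  bounded_slope lo' hi' a (a + Q^-1) g ->
  bounded_slope ((lo + lo') / Q) ((hi + hi') / Q) 0 1 (branch_incr a g).
Proof.
move=> hf hg x y x0 xy y1; have := Qi0; set k := Q^-1 => k0.
have xk : 0 <= x * k by rewrite mulr_ge0// ltW.
have xyk : x * k <= y * k by rewrite ler_wpM2r// ltW.
have yk : y * k <= k by rewrite ler_piMl// ltW.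
have h1 := hf (a + x * k) (a + y * k) (ltac:(lra)) (ltac:(lra)) (ltac:(rewrite -/k; lra)).
have h2 := hg (a + x * k) (a + y * k) (ltac:(lra)) (ltac:(lra)) (ltac:(rewrite -/k; lra)).
rewrite /branch_incr -/k; lra.
Qed.

Lemma branch_step_jump a g : branch_step a g (Q * a + K) = 0.
Proof. by rewrite /branch_step subrr qextE ?lexx ?ler01 ?branch_incr0. Qed.

(** One step turns a slope bound l into (lo + l) / Q, whose fixed point is lo / (Q - 1). *)
Lemma bounded_slope_branch_iter a lo hi n :
  0 <= lo -> 0 <= hi -> bounded_slope (- lo) hi a (a + Q^-1) f ->
  forall x y, x <= y -> - (lo / (Q - 1)) * (y - x) <=
    branch_iter a n y - branch_iter a n x <= hi / (Q - 1) * (y - x).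
Proof.
move=> lo0 hi0 hf; have q2 := Q2; have Q1 : 0 < Q - 1 by lra.
elim: n => [|n IH] x y xy.
  have h1 : 0 <= lo / (Q - 1) by rewrite divr_ge0// ltW.
  have h2 : 0 <= hi / (Q - 1) by rewrite divr_ge0// ltW.
  by rewrite /branch_iter/= subrr; apply/andP; split; nra.
have := @bounded_slope_branch_incr a (branch_iter a n) _ _
   (- (lo / (Q - 1))) (hi / (Q - 1)) hf (fun x y _ xy _ => IH x y xy).
have -> : (- lo + - (lo / (Q - 1))) / Q = - (lo / (Q - 1)) by field; lra.
have -> : (hi + hi / (Q - 1)) / Q = hi / (Q - 1) by field; lra.
move=> h; have := bounded_slope_qext (branch_incr0 _ _) h.
move=> /(_ (x - (Q * a + K)) (y - (Q * a + K)) (ltac:(lra))).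
rewrite /branch_iter iterS /branch_step -/(branch_iter a n).
by have -> : y - (Q * a + K) - (x - (Q * a + K)) = y - x by lra.
Qed.

Section limit.
Variable L : R.
Hypothesis L0 : 0 <= L.

Definition lip a := bounded_slope (- L) L a (a + Q^-1) f.

Let M := L / (Q - 1).

Let M0 : 0 <= M.
Proof. by rewrite divr_ge0//; have := Q2; lra. Qed.

(** Slopes are compared rather than values: a step divides the slope of a difference by Q, and since
    every iterate vanishes at the jump, slopes then control values. *)
Lemma branch_iter_diff a n x y : lip a -> x <= y ->
  `|(branch_iter a n.+1 y - branch_iter a n y) - (branch_iter a n.+1 x - branch_iter a n x)|
     <= M / Q ^+ n * (y - x).
Proof.
move=> hf xy; have Qn m : 0 < Q ^+ m by rewrite exprn_gt0//; have := Q2; lra.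
elim: n x y xy => [|n IH] x y xy.
  have := @bounded_slope_branch_iter a L L 1 L0 L0 hf x y xy.
  by rewrite expr0 divr1 -/M ler_norml /branch_iter/=; lra.
pose d x := branch_iter a n.+1 x - branch_iter a n x.
have hd : bounded_slope (- (M / Q ^+ n.+1)) (M / Q ^+ n.+1) 0 1
   (fun t => branch_incr a (branch_iter a n.+1) t - branch_incr a (branch_iter a n) t).
  move=> s t s0 st t1.
  have stQ : a + s / Q <= a + t / Q by rewrite lerD2l ler_wpM2r// ltW// Qi0.
  have := IH _ _ stQ; rewrite -/(d _) -/(d _) ler_norml.
  have -> : M / Q ^+ n * (a + t / Q - (a + s / Q)) = M / Q ^+ n.+1 * (t - s).
    by rewrite exprS; field; rewrite (gt_eqF (Qn _)); have := Q2; lra.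
  by rewrite /branch_incr /d; lra.
have e u : branch_iter a n.+2 u - branch_iter a n.+1 u =
    qext (fun t => branch_incr a (branch_iter a n.+1) t - branch_incr a (branch_iter a n) t)
      (u - (Q * a + K)) by rewrite -qextB.
rewrite !e ler_norml -mulNr.
have -> : y - x = y - (Q * a + K) - (x - (Q * a + K)) by lra.
by apply: (bounded_slope_qext _ hd); [rewrite !branch_incr0 subrr | lra].
Qed.

Lemma branch_iter_jump a n : branch_iter a n (Q * a + K) = 0.
Proof. by case: n => [//|n]; rewrite /branch_iter iterS branch_step_jump. Qed.

Lemma branch_iter_cauchy a n x : lip a ->
  `|branch_iter a n.+1 x - branch_iter a n x| <= M * `|x - (Q * a + K)| / Q ^+ n.
Proof.
move=> hf; have h := @branch_iter_diff a n; have [jx|xj] := leP (Q * a + K) x.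
  have := h _ _ hf jx; rewrite !branch_iter_jump subrr subr0.
  by rewrite [`|x - _|]ger0_norm ?subr_ge0// [in X in _ -> X]mulrAC.
have := h _ _ hf (ltW xj); rewrite !branch_iter_jump subrr sub0r normrN.
by rewrite [`|x - _|]ltr0_norm ?subr_lt0// opprB [in X in _ -> X]mulrAC.
Qed.

(** The limit is specified by its rate, so that [le_geometric_limit] carries inequalities over from
    the iterates. The error bound grows with the distance to the jump. *)
Definition branch_limit a x : R :=
  xget 0 [set l | forall n, `|branch_iter a n x - l| <=
                    2 * (M * `|x - (Q * a + K)|) / Q ^+ n].

Lemma branch_limitP a n x : lip a ->
  `|branch_iter a n x - branch_limit a x| <= 2 * (M * `|x - (Q * a + K)|) / Q ^+ n.
Proof.
move=> hf; rewrite /branch_limit; case: xgetP => [l _ /(_ n)//|] no.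
have [l hl] := geometric_limit Q2 (fun n => branch_iter_cauchy n x hf).
by have := no l.
Qed.

Let limD a x y z w e : lip a ->
  (forall n, e <= branch_iter a n x + branch_iter a n y
     - (branch_iter a n z + branch_iter a n w)) ->
  e <= branch_limit a x + branch_limit a y - (branch_limit a z + branch_limit a w).
Proof.
move=> hf h; pose C x := 2 * (M * `|x - (Q * a + K)|).
apply: (@le_geometric_limit _ _ Q2 _ _ (C x + C y + C z + C w)) => n.
have hl u : `|branch_iter a n u - branch_limit a u| <= C u / Q ^+ n by exact: branch_limitP.
have h1 := hl x; have h2 := hl y; have h3 := hl z; have h4 := hl w.
move: h1 h2 h3 h4 (h n); rewrite !ler_norml => *.
rewrite 3!mulrDl; lra.
Qed.

Lemma branch_limit_jump a : lip a -> branch_limit a (Q * a + K) = 0.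
Proof.
by move=> hf; have := branch_limitP 0 (Q * a + K) hf;
   rewrite branch_iter_jump subrr normr0 !mulr0 mul0r sub0r normrN normr_le0 => /eqP.
Qed.

Lemma branch_limitD1 a x : lip a ->
  branch_limit a (x + 1) = branch_limit a x + branch_limit a (Q * a + K + 1).
Proof.
move=> hf; have it n : branch_iter a n (x + 1) =
    branch_iter a n x + branch_iter a n (Q * a + K + 1).
  case: n => [|n]; rewrite /branch_iter/= ?addr0// /branch_step.
  have -> : x + 1 - (Q * a + K) = x - (Q * a + K) + 1 by ring.
  have -> : Q * a + K + 1 - (Q * a + K) = 1 by ring.
  by rewrite qextD1 (@qextE _ _ 1) ?branch_incr0 ?lexx ?ler01.
have h1 := @limD a (x + 1) (Q * a + K) x (Q * a + K + 1) 0 hf.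
have h2 := @limD a x (Q * a + K + 1) (x + 1) (Q * a + K) 0 hf.
rewrite branch_limit_jump// in h1 h2.
have {}h1 := h1 (fun n => ltac:(rewrite it branch_iter_jump; lra)).
have {}h2 := h2 (fun n => ltac:(rewrite it branch_iter_jump; lra)).
lra.
Qed.

Lemma branch_limitE a t : lip a -> 0 <= t <= 1 ->
  branch_limit a (Q * a + K + t) = branch_incr a (branch_limit a) t.
Proof.
move=> hf t01; pose C x := 2 * (M * `|x - (Q * a + K)|).
pose D := C (Q * a + K + t) + C (a + t / Q) + C a.
have Qn n : 0 < Q ^+ n by rewrite exprn_gt0//; have := Q2; lra.
have it n : branch_iter a n.+1 (Q * a + K + t) = branch_incr a (branch_iter a n) t.
  rewrite /branch_iter iterS /branch_step addrAC subrr add0r.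
  by rewrite qextE// branch_incr0.
have key n : `|branch_limit a (Q * a + K + t) - branch_incr a (branch_limit a) t|
    <= 0 + D / Q ^+ n.
  have hl m u : `|branch_iter a m u - branch_limit a u| <= C u / Q ^+ m by exact: branch_limitP.
  have h1 := hl n.+1 (Q * a + K + t); have h2 := hl n (a + t / Q); have h3 := hl n a.
  have h4 : C (Q * a + K + t) / Q ^+ n.+1 <= C (Q * a + K + t) / Q ^+ n.
    have C0 : 0 <= C (Q * a + K + t) by rewrite /C mulr_ge0// mulr_ge0.
    rewrite ler_wpM2l//.
    by rewrite lef_pV2 ?posrE// exprS; have := Qn n; have := Q2; nra.
  rewrite it in h1; move: h1 h2 h3; rewrite add0r /D 2!mulrDl /branch_incr !ler_norml; lra.
have := le_geometric_limit Q2 key.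
by rewrite normr_le0 subr_eq0 => /eqP.
Qed.

Lemma bounded_slope_branch_limit a lo hi : lip a ->
  0 <= lo -> 0 <= hi -> bounded_slope (- lo) hi a (a + Q^-1) f ->
  forall x y, x <= y -> - (lo / (Q - 1)) * (y - x) <=
    branch_limit a y - branch_limit a x <= hi / (Q - 1) * (y - x).
Proof.
move=> hf lo0 hi0 hs x y xy.
have hi' n := @bounded_slope_branch_iter a lo hi n lo0 hi0 hs x y xy.
have h1 := @limD a y (Q * a + K) x (Q * a + K) (- (lo / (Q - 1)) * (y - x)) hf.
have h2 := @limD a x (Q * a + K) y (Q * a + K) (- (hi / (Q - 1) * (y - x))) hf.
have {}h1 := h1 (fun n => ltac:(have := hi' n; lra)).
have {}h2 := h2 (fun n => ltac:(have := hi' n; lra)).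
lra.
Qed.

(** The limit vanishes at the jump, so this is its increment over a period, and by [branch_limitD1]
    its vanishing means periodicity. *)
Definition period_incr a := branch_limit a (Q * a + K + 1).

Lemma period_incrE a : lip a ->
  period_incr a = f (a + Q^-1) + branch_limit a (a + Q^-1) - (f a + branch_limit a a).
Proof. by move=> hf; rewrite /period_incr branch_limitE ?lexx ?ler01// /branch_incr div1r. Qed.

Section continuity.
Variables a0 a1 : R.
Hypothesis a0N1 : -1 <= a0.
Hypothesis a1le : a1 + Q^-1 <= 1.
Hypothesis lipf : bounded_slope (- L) L a0 (a1 + Q^-1) f.

Let lipa a : a0 <= a -> a <= a1 -> lip a.
Proof. by move=> h1 h2 x y ax xy ya; apply: lipf => //; lra. Qed.

(** C depends on n, so continuity of the limit in a is obtained by fixing n first. Moving a shifts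
    the jump, which costs M Q by the slope bound, and alters the branch increment, which costs D on
    each of at most B periods. *)
Lemma branch_iter_lipschitz n : exists2 C, 0 <= C &
  forall a b x, a0 <= a -> a <= b -> b <= a1 -> `|x| <= 1 ->
    `|branch_iter a n x - branch_iter b n x| <= C * (b - a).
Proof.
have q2 := Q2; have qi := Qi0; have ha0 := a0N1; have ha1 := a1le.
elim: n => [|n [C C0 IH]].
  by exists 0 => // a b x _ _ _ _; rewrite /branch_iter/= subrr normr0 mul0r.
(* B bounds |floor t| + 1, since |t| ≤ 1 + Q + |K| when x and b have modulus at most 1. *)
pose B := Q + `|K| + 3; have B0 : 0 <= B by rewrite /B; have := normr_ge0 K; lra.
pose D := 2 * (L + M + C).
have D0 : 0 <= D by rewrite /D; have := L0; have := M0; lra.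
exists (M * Q + B * D) => [|a b x aa ab bb x1].
  by rewrite addr_ge0// mulr_ge0//; lra.
have la : lip a by apply: lipa => //; lra.
have lb : lip b by apply: lipa => //; lra.
have itS c y m : branch_iter c m.+1 y = qext (branch_incr c (branch_iter c m)) (y - (Q * c + K)).
  by [].
pose t := x - (Q * b + K).
have h1 : `|branch_iter a n.+1 x - branch_iter a n.+1 (x - Q * (b - a))| <= M * Q * (b - a).
  have xx : x - Q * (b - a) <= x by nra.
  have := @bounded_slope_branch_iter a L L n.+1 L0 L0 la _ _ xx.
  by rewrite -/M ler_norml; nra.
have e1 : branch_iter a n.+1 (x - Q * (b - a)) = qext (branch_incr a (branch_iter a n)) t.
  by rewrite itS; congr qext; rewrite /t; ring.
have e2 : branch_iter b n.+1 x = qext (branch_incr b (branch_iter b n)) t by rewrite itS.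
have h2 s : 0 <= s <= 1 ->
    `|branch_incr a (branch_iter a n) s - branch_incr b (branch_iter b n) s| <= D * (b - a).
  move=> /andP[s0 s1].
  have k0 : 0 <= s / Q by rewrite mulr_ge0// ltW.
  have k1 : s / Q <= Q^-1 by rewrite ler_piMl// ltW.
  have f1 := @lipf (a + s / Q) (b + s / Q) (ltac:(lra)) (ltac:(lra)) (ltac:(lra)).
  have f2 := @lipf a b (ltac:(lra)) (ltac:(lra)) (ltac:(lra)).
  have abQ : a + s / Q <= b + s / Q by lra.
  have p1 := @bounded_slope_branch_iter a L L n L0 L0 la _ _ abQ.
  have p2 := @bounded_slope_branch_iter a L L n L0 L0 la _ _ ab.
  have i1 := IH a b (b + s / Q) aa ab bb (ltac:(rewrite ler_norml; lra)).
  have i2 := IH a b b aa ab bb (ltac:(rewrite ler_norml; lra)).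
  rewrite -/M in p1 p2.
  have ee : b + s / Q - (a + s / Q) = b - a by ring.
  rewrite ee in f1 p1.
  move: i1 i2; rewrite /branch_incr /D !ler_norml; lra.
have h3 : `|qext (branch_incr a (branch_iter a n)) t - qext (branch_incr b (branch_iter b n)) t|
    <= B * D * (b - a).
  rewrite qextB /qext (le_trans (ler_normD _ _))// normrM.
  have g1 := h2 1 (ltac:(lra)).
  have g2 := h2 (frac t) (ltac:(have := frac_itv t; lra)).
  have ft : `|(Num.floor t)%:~R| + 1 <= B :> R.
    have := floor_frac t; have := frac_itv t; have := ler_norm K; have := ler_norm (- K).
    rewrite normrN; move: x1; rewrite ler_norml /B /t => *.
    have ? : - Q <= Q * b <= Q by nra.
    by rewrite -lerBrDr ler_norml; lra.
  have X0 : 0 <= D * (b - a) by rewrite mulr_ge0//; lra.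
  move: ft g1 g2 (normr_ge0 ((Num.floor t)%:~R : R)); rewrite -mulrA.
  move: (D * _) X0 => X X0 ft g1 g2 f0; nra.
rewrite -e1 -e2 in h3.
have := le_trans (ler_distD _ _ _) (lerD h1 h3).
by rewrite -mulrDl.
Qed.

Lemma period_incr_uniform_continuity e : 0 < e -> exists2 d, 0 < d &
  forall a b, a0 <= a -> a <= b -> b <= a1 -> b - a < d ->
  `|period_incr a - period_incr b| < e.
Proof.
move=> e0; have q2 := Q2; have qi := Qi0; have ha0 := a0N1; have ha1 := a1le.
pose W := 1 + Q + `|K|; have W0 : 0 <= W by rewrite /W; have := normr_ge0 K; lra.
(* Four evaluations of the limit each err by at most 2 M W / Q^n, hence the factor 8; W bounds the
   distance of these points from the jump. *)
have [n hn] := @geometric_small _ _ Q2 (8 * (M * W)) (e / 2) (ltac:(lra)).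
have [C C0 hC] := branch_iter_lipschitz n.
pose D := 2 * (L + M + C).
have D0 : 0 <= D by rewrite /D; have := L0; have := M0; lra.
exists (e / (2 * (D + 1))) => [|a b aa ab bb].
  by rewrite divr_gt0//; lra.
rewrite ltr_pdivlMr => [dab|]; last lra.
have la : lip a by apply: lipa => //; lra.
have lb : lip b by apply: lipa => //; lra.
have near c y : a0 <= c -> c <= a1 -> `|y| <= 1 -> lip c ->
    `|branch_iter c n y - branch_limit c y| <= 2 * (M * W) / Q ^+ n.
  move=> h1 h2 y1 lc; apply: le_trans (branch_limitP n y lc) _.
  rewrite ler_wpM2r ?invr_ge0 ?exprn_ge0//; first lra.
  rewrite ler_wpM2l// ler_wpM2l ?M0//.
  have := ler_norm K; have := ler_norm (- K); rewrite normrN => k1 k2.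
  have ? : - Q <= Q * c <= Q by nra.
  by move: y1; rewrite !ler_norml /W; lra.
have n1 := near a a aa (ltac:(lra)) (ltac:(rewrite ler_norml; lra)) la.
have n2 := near a (a + Q^-1) aa (ltac:(lra)) (ltac:(rewrite ler_norml; lra)) la.
have n3 := near b b (ltac:(lra)) bb (ltac:(rewrite ler_norml; lra)) lb.
have n4 := near b (b + Q^-1) (ltac:(lra)) bb (ltac:(rewrite ler_norml; lra)) lb.
have f1 := @lipf (a + Q^-1) (b + Q^-1) (ltac:(lra)) (ltac:(lra)) (ltac:(lra)).
have f2 := @lipf a b (ltac:(lra)) (ltac:(lra)) (ltac:(lra)).
have abQ : a + Q^-1 <= b + Q^-1 by lra.
have p1 := @bounded_slope_branch_iter a L L n L0 L0 la _ _ abQ.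
have p2 := @bounded_slope_branch_iter a L L n L0 L0 la _ _ ab.
have i1 := hC a b (b + Q^-1) aa ab bb (ltac:(rewrite ler_norml; lra)).
have i2 := hC a b b aa ab bb (ltac:(rewrite ler_norml; lra)).
rewrite -/M in p1 p2.
have ee : b + Q^-1 - (a + Q^-1) = b - a by ring.
rewrite ee in f1 p1.
have dab2 : D * (b - a) < e / 2 by nra.
rewrite !period_incrE//.
have eW : 8 * (M * W) / Q ^+ n = 4 * (2 * (M * W) / Q ^+ n) by ring.
rewrite eW in hn.
move: n1 n2 n3 n4 i1 i2 dab2; rewrite /D !ler_norml ltr_norml; lra.
Qed.

Lemma exists_period_incr0 : a0 <= a1 ->
  0 < period_incr a0 -> period_incr a1 < 0 ->
  exists2 a, a0 <= a <= a1 & period_incr a = 0.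
Proof.
move=> a01 v0 v1.
have [||a] := @IVT R period_incr a0 a1 0 a01.
- apply/subspace_continuousP => x /=; rewrite in_itv/= => /andP[x0 x1].
  apply/cvgrPdist_lt => e e0.
  have [d d0 hd] := period_incr_uniform_continuity e0.
  rewrite near_withinE; near=> y => /=; rewrite in_itv/= => /andP[y0 y1].
  have xy : `|x - y| < d by near: y; exact: (@cvgr_dist_lt _ _ _ _ _ id x cvg_id).
  have [xley|ltyx] := leP x y.
    by apply: hd => //; move: xy; rewrite ltr_norml; lra.
  by rewrite distrC; apply: hd => //; move: xy; rewrite ?ltr_norml; lra.
- by rewrite ge_min le_max (ltW v0) (ltW v1) orbT.
- by rewrite in_itv/= => a01' e; exists a.
Unshelve. all: by end_near. Qed.


End continuity.

End limit.

End inverse_branch.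

(** * Sub-actions carried by an arc *)

Definition lnsin {R : realType} (x : R) : R := ln (sin (pi * x)).

(* [lra] compares atoms up to conversion: keeping transcendental terms out of its
   context avoids unfolding them. *)
Ltac lin :=
  repeat match goal with
  | H : context [@sin _ _] |- _ => clear H
  | H : context [@cos _ _] |- _ => clear H
  | H : context [@cot _ _] |- _ => clear H
  | H : context [@expR _ _] |- _ => clear H
  | H : context [@flog _ _ _] |- _ => clear H
  | H : context [@slope _ _ _] |- _ => clear H
  | H : context [@lnsin _ _] |- _ => clear H
  | H : context [@pi _] |- _ => clear H
  end; lra.

(** * Rational bounds for π and exp *)

Section numeric_bounds.
Context {R : realType}.
Implicit Types x : R.

Lemma cos_le_quartic x : 0 <= x -> cos x <= 1 - x ^+ 2 / 2 + x ^+ 4 / 24.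
Proof.
move=> x0; pose g y : R := 1 - y ^+ 2 / 2 + y ^+ 4 / 24 - cos y.
have : 0 * (x - 0) <= g x - g 0.
  apply: (@increment_ge _ g (fun y => sin y - (y - y ^+ 3 / 6))) => [|y _|y /andP[y0 yx]].
  - exact: x0.
  - by rewrite /g; apply: is_derive_eq; rewrite /GRing.scale/= ?mulr1; lra.
  - by have := sin_ge_cubic (ltW y0); lra.
by rewrite /g cos0; lra.
Qed.

Lemma pi_le : pi <= 637 / 200 :> R.
Proof.
have /andP[p0 p2] := @pihalf_02 R.
have := cos_le_quartic (ltW p0); rewrite cos_pihalf.
suff : forall p : R, 0 < p < 2 -> 0 <= 1 - p ^+ 2 / 2 + p ^+ 4 / 24 ->
    2 * p <= 637 / 200.
  by move=> h /(h _ (@pihalf_02 R)); lra.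
move=> {p0 p2} p /andP[p0 p2] h.
have z4 : p ^+ 2 < 4 by nra.
(* With z = p^2 the hypothesis is z^2 - 12 z + 24 ≥ 0; z < 4 puts z below the smaller root 6 - √12,
   which is less than 317/125. *)
have zz : p ^+ 2 <= 317 / 125.
  have e : p ^+ 4 = p ^+ 2 * p ^+ 2 by ring.
  rewrite e in h; move: (p ^+ 2) z4 h => z z4 h; nra.
nra.
Qed.

Lemma expR_le_pade x : 0 <= x < 2 -> expR x <= (2 + x) / (2 - x).
Proof.
move=> /andP[x0 x2]; rewrite ler_pdivlMr; last lra.
pose g y : R := 2 + y - expR y * (2 - y).
have : 0 * (x - 0) <= g x - g 0.
  apply: (@increment_ge _ g (fun y => 1 - expR y * (1 - y))) => [|y _|y /andP[y0 yx]]; first exact: x0.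
    by rewrite /g; apply: is_derive_eq; rewrite /GRing.scale/= ?mulr1; lra.
  have := expR_ge1Dx (- y); have := expR_gt0 y; have := expRxMexpNx_1 y; nra.
by rewrite /g expR0; lra.
Qed.

Lemma expR_le x k : 0 <= x < 2 -> 2 + x <= k * (2 - x) -> expR x <= k.
Proof.
move=> hx h; apply: le_trans (expR_le_pade hx) _.
by rewrite ler_pdivrMr//; lra.
Qed.

Lemma sin_pi6 : sin (pi / 6) = 2^-1 :> R.
Proof.
have e : sin (pi / 2) = 3 * sin (pi / 6) - 4 * sin (pi / 6) ^+ 3 :> R.
  rewrite (_ : pi / 2 = pi / 6 + pi / 6 + pi / 6); last by field.
  have := cos2Dsin2 (pi / 6 : R).
  rewrite !(sinD, cosD); move: (sin _) (cos _) => S C h.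
  have -> : 4 * S ^+ 3 = S ^+ 3 + 3 * S * (S ^+ 2) by ring.
  have -> : S ^+ 2 = 1 - C ^+ 2 by lra.
  ring.
have s0 : 0 < sin (pi / 6 : R).
  by apply: sin_gt0_pi; have := @pi_gt0 R; lra.
(* The triple angle formula leaves only the roots -1 and 1/2. *)
have : (sin (pi / 6) + 1) * (2 * sin (pi / 6) - 1) ^+ 2 = 0 :> R.
  rewrite sin_pihalf in e; move: (sin _) e => S e.
  have -> : (S + 1) * (2 * S - 1) ^+ 2 = 1 - (3 * S - 4 * S ^+ 3) by ring.
  by rewrite -e subrr.
move/eqP; rewrite mulf_eq0 sqrf_eq0 => /orP[/eqP|/eqP]; lra.
Qed.

Lemma pi_ge : 31 / 10 <= pi :> R.
Proof.
have h := cos_ge_quadratic (pi / 6 : R); have := cos2Dsin2 (pi / 6 : R).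
have p0 := @pi_gt0 R; rewrite sin_pi6; move: (cos _) h => C h e.
(* 97/112 is slightly above cos (π/6) = √3/2. *)
have C1 : C <= 97 / 112 by nra.
nra.
Qed.

Lemma cos_pi3 : cos (pi / 3) = 2^-1 :> R.
Proof.
by rewrite -sin_pi6 -cosBpihalf -cosN; congr cos; field.
Qed.

End numeric_bounds.

(** * Comparison of the points of a fibre when r ≤ s *)

Section subaction.
Context {R : realType} (q : nat).
Hypothesis hq : (2 <= q)%N.
Implicit Types (r s x y d K : R) (Psi : R -> R).

Local Notation Q := (q%:R : R).
Local Notation f := (@flog R q).
Local Notation G := (@slope R q).

Let Q2 : 2 <= Q. Proof. by rewrite ler_nat. Qed.

(** At the midpoint 1/(2q) the second cotangent of [slopeE] vanishes, and cot x ≤ 1/x gives 2q. *)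
Lemma slope_half_le x : 0 < x -> x <= Q^-1 / 2 -> G x <= 2 * Q.
Proof.
move=> x0 x2; have q2 := Q2; have qi : 0 < Q^-1 <= 2^-1.
  by rewrite invr_gt0 lef_pV2 ?posrE//; lra.
apply: (@le_trans _ _ (G (Q^-1 / 2))).
  by apply: slope_le => //; lra.
rewrite (slopeE hq); last lra.
have -> : Q * (pi * (Q^-1 / 2)) = pi / 2 by field; lra.
rewrite {2}/cot cos_pihalf mul0r !mulr0 subr0.
have p0 := @pi_gt0 R.
have := @cot_le_inv R (pi * (Q^-1 / 2)).
have -> : (pi * (Q^-1 / 2))^-1 = 2 * Q / pi by field; rewrite gt_eqF//; lra.
rewrite ler_pdivlMr// [cot _ * _]mulrC; apply.
by apply/andP; split; nra.
Qed.

(* In the coordinate u = x + c the map T is u |-> q u + K mod 1; the arc is [-r, s], both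
   ends of which are sent to q (-r) + K mod 1. *)
Record subaction K r s Psi : Prop := Subaction {
  sub_r0 : 0 < r;
  sub_s0 : 0 < s;
  sub_rs : r + s = Q^-1;
  sub_per : forall x, Psi (x + 1) = Psi x;
  sub_eq : forall t, 0 <= t <= 1 ->
    Psi (Q * - r + K + t) = f (- r + t / Q) + Psi (- r + t / Q) - (f (- r) + Psi (- r));
  sub_tie : f s + Psi s = f (- r) + Psi (- r);
  sub_slope : forall x y, x <= y ->
    - (G s / (Q - 1)) * (y - x) <= Psi y - Psi x <= G r / (Q - 1) * (y - x) }.

(** The reflection u ↦ -u exchanges the ends of the arc; it reduces the fibre comparison to r ≤
    s. *)
Lemma subaction_opp K r s Psi :
  subaction K r s Psi -> subaction (- K) s r (fun x => Psi (- x)).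
Proof.
case=> r0 s0 rs per eq tie sl; have q2 := Q2; split=> //.
- by rewrite addrC.
- by move=> x; rewrite opprD -[LHS]per subrK.
- move=> t t01; have qs : Q * s = 1 - Q * r by rewrite -[s](addKr r) rs mulrDr mulfV ?gt_eqF//; lra.
  have := eq (1 - t) (ltac:(lra)).
  have -> : Q * - r + K + (1 - t) = - (Q * - s + - K + t) by lra.
  have -> : - r + (1 - t) / Q = - (- s + t / Q) by rewrite -[s](addKr r) rs; ring.
  by move=> ->; rewrite opprK !flogN tie flogN.
- by rewrite opprK [f (- s)]flogN tie flogN.
- by move=> x y xy; have := sl (- y) (- x) (ltac:(lra)); lra.
Qed.

Section one_subaction.
Variables (K r s : R) (Psi : R -> R).
Hypothesis sub : subaction K r s Psi.

Let r0 : 0 < r. Proof. by case: sub. Qed.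
Let s0 : 0 < s. Proof. by case: sub. Qed.
Let rs : r + s = Q^-1. Proof. by case: sub. Qed.
Let om := G r / (Q - 1).
Let al := G s / (Q - 1).
Let g x := f x + Psi x.

Lemma sub_perz x (m : int) : Psi (x + m%:~R) = Psi x.
Proof.
have pn n y : Psi (y + n%:R) = Psi y.
  elim: n y => [|n IH] y; first by rewrite addr0.
  by rewrite -natr1 addrA (sub_per sub).
case: m => n; first exact: pn.
by have := pn n.+1 (x - n.+1%:R); rewrite subrK NegzE mulrNz => ->.
Qed.

Let jump t : 0 <= t < 1 -> forall d, 0 <= d <= 1 ->
  if t + d <= 1 then Psi (Q * - r + K + t + d) - Psi (Q * - r + K + t) = g (- r + (t + d) / Q) - g (- r + t / Q)
  else Psi (Q * - r + K + t + d) - Psi (Q * - r + K + t) = g (- r + (t + d - 1) / Q) - g (- r + t / Q).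
Proof.
move=> /andP[t0 t1] d /andP[d0 d1]; case: ifPn => [td|]; last rewrite -ltNge => td.
- rewrite -addrA !(sub_eq sub); [|lra|lra].
  by rewrite /g; ring.
- have -> : Q * - r + K + t + d = Q * - r + K + (t + d - 1) + 1 by ring.
  rewrite (sub_per sub) !(sub_eq sub); [|lra|lra].
  by rewrite /g; ring.
Qed.

(* Over a stretch of length d, Psi repeats the increment of f + Psi over a stretch of
   the arc of length d/Q, the two ends of the arc being identified. *)
Lemma sub_increment x d : 0 <= d <= 1 -> exists2 p, - r <= p <= s &
  (p + d / Q <= s /\ Psi (x + d) - Psi x = g (p + d / Q) - g p) \/
  (- r <= p - (1 - d) / Q /\ Psi (x + d) - Psi x = g (p - (1 - d) / Q) - g p).
Proof.
move=> hd; have q2 := Q2; have rs' := rs; have r0' := r0; have s0' := s0.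
pose t := frac (x - (Q * - r + K)).
have t01 : 0 <= t < 1 by exact: frac_itv.
have e y : Psi (x + y) = Psi (Q * - r + K + t + y).
  rewrite -[LHS](sub_perz _ (- Num.floor (x - (Q * - r + K)))) /t /frac mulrNz.
  by congr Psi; ring.
have qi : 0 < Q^-1 by rewrite invr_gt0; lra.
exists (- r + t / Q).
  by apply/andP; split; nra.
have := jump t01 hd; rewrite -(e d) -[in Psi (_ + t)](addr0 (_ + t)) -(e 0) addr0.
case: ifPn => [td -> |]; [left|rewrite -ltNge => td ->; right]; split.
- nra.
- by congr (g _ - _); ring.
- nra.
- by congr (g _ - _); ring.
Qed.

(** By concavity an increment of f over a stretch of the arc is largest at the left end -r. When the
    stretch wraps, the tie splits it into [p, s] and [-r, p']; sliding the first piece to start at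
    p' joins them into one stretch from -r. *)
Lemma sub_increment_le x d : 0 <= d <= 1 ->
  Psi (x + d) - Psi x <= f (- r + d / Q) - f (- r) + om * (d / Q).
Proof.
move=> hd; have q2 := Q2; have rs' := rs; have r0' := r0; have s0' := s0.
have qi : 0 < Q^-1 by rewrite invr_gt0; lra.
have dQ : 0 <= d / Q by apply: mulr_ge0; lra.
have dQ' : d / Q <= Q^-1 by rewrite ler_piMl//; lra.
have [p hp [[h1 ->]|[h1 ->]]] := sub_increment x hd; rewrite /g.
- have := @flog_concave_shift _ _ hq (- r) p (d / Q) (ltac:(lin)) (ltac:(lin)) (ltac:(lin)) (ltac:(lin)).
  by have := sub_slope sub (_ : p <= p + d / Q); rewrite lerDl => /(_ dQ); rewrite -/om; lra.
- have e : (1 - d) / Q = Q^-1 - d / Q by ring.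
  rewrite e in h1 *; set p' := p - (Q^-1 - d / Q) in h1 *.
  have := @flog_concave_shift _ _ hq p' p (s - p) (ltac:(lin)) (ltac:(rewrite /p'; lra)) (ltac:(lin)) (ltac:(lin)).
  have -> : p + (s - p) = s by ring.
  have -> : p' + (s - p) = - r + d / Q by rewrite /p'; lra.
  have := sub_slope sub (_ : - r <= p') => /(_ h1).
  have := sub_slope sub (_ : p <= s) => /(_ (ltac:(lin))).
  have es : (s - p) + (p' - - r) = d / Q by rewrite /p'; lra.
  by rewrite -/om -es mulrDr; have := sub_tie sub; lra.
Qed.

Let rQ : 0 < r < Q^-1. Proof. by have := r0; have := s0; have := rs; lra. Qed.
Let sQ : 0 < s < Q^-1. Proof. by have := r0; have := s0; have := rs; lra. Qed.

Let Qi2 : 0 < Q^-1 <= 2^-1.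
Proof. by rewrite invr_gt0 lef_pV2 ?posrE//; have := Q2; lra. Qed.

Lemma sin_lobe x : 0 < x -> x <= Q^-1 -> 0 < sin (pi * x).
Proof. by move=> x0 x1; apply: sin_gt0_cycle; have := Qi2; lra. Qed.

(** As r + s = 1/q, the numerators sin (πqr) and sin (πqs) agree, and only the denominators remain
    in f s - f (-r). *)
Lemma sub_tie_ln : Psi s - Psi (- r) = lnsin s - lnsin r.
Proof.
have := sub_tie sub; rewrite flogN// !flogE//.
have -> : pi * (Q * s) = - (pi * (Q * r)) + pi.
  rewrite -[s](addKr r) rs mulrDr mulfV; first by ring.
  by have := Q2; lra.
by rewrite sinDpi sinN opprK /lnsin; lra.
Qed.

(** The terms with factor Q cancel because Q s = 1 - Q r. *)
Lemma slope_sum : G r + G s = pi * (sin (pi / Q) / (sin (pi * r) * sin (pi * s))).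
Proof.
have q2 := Q2; have hr := rQ; have hs := sQ; have qi := Qi2.
have sr : 0 < sin (pi * r) by apply: sin_lobe; lin.
have ss : 0 < sin (pi * s) by apply: sin_lobe; lin.
rewrite !slopeE//.
have -> : Q * (pi * s) = - (Q * (pi * r)) + pi.
  rewrite -[s](addKr r) rs; field; lra.
have -> : cot (- (Q * (pi * r)) + pi) = - cot (Q * (pi * r)).
  by rewrite /cot sinDpi cosDpi sinN cosN opprK mulNr.
have -> : pi / Q = pi * r + pi * s by rewrite -mulrDr rs.
by rewrite -cotD ?gt_eqF//; ring.
Qed.

Let om0 : 0 <= om.
Proof. by rewrite divr_ge0 ?slope_ge0//; have := rQ; have := Q2; lra. Qed.

Lemma om_le : r <= s -> om <= 2 * Q / (Q - 1).
Proof.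
move=> rles; have q2 := Q2; have hr := rQ.
rewrite /om ler_wpM2r ?invr_ge0//; first lra.
by apply: slope_half_le; have := rs; lra.
Qed.

Lemma sub_slope_le x y : x <= y -> - al * (y - x) <= Psi y - Psi x <= om * (y - x).
Proof. by move=> xy; have := sub_slope sub xy. Qed.

(** The tie bounds ln (sin πs / sin πr) by om / q, which is at most 2 / (q - 1) ≤ 1, and e ≤ 3. *)
Lemma sin_le_3sin : r <= s -> (3 <= q)%N -> sin (pi * s) <= 3 * sin (pi * r).
Proof.
move=> rles q3; have q2 := Q2; have hr := rQ; have hs := sQ; have qi := Qi2.
have Q3 : 3 <= Q by rewrite ler_nat.
have sr : 0 < sin (pi * r) by apply: sin_lobe; lin.
have ss : 0 < sin (pi * s) by apply: sin_lobe; lin.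
rewrite -ler_pdivrMr// -ler_ln ?posrE ?divr_gt0// ln_div//.
have h1 : om * Q^-1 <= 1.
  have := om_le rles; rewrite ler_pdivlMr; last lra.
  by rewrite ler_pdivrMr; nra.
have := sub_slope_le (_ : - r <= s) => /(_ (ltac:(lin))).
have -> : s - - r = Q^-1 by rewrite -rs; ring.
rewrite sub_tie_ln /lnsin => h2.
have : ln (expR 1) <= ln (3 : R).
  rewrite ler_ln ?posrE ?expR_gt0//.
  by apply: expR_le; lra.
rewrite expRK; lra.
Qed.

Definition shift_incr x := Psi (x + Q^-1) - Psi x.

(** At x = r and at y = s the two sides are equal, by the tie. Moving inwards, the log-sine ratio
    changes at rate at least m, the increment of Psi over 1/q at rate at most M. *)
Lemma neighbours m M :
  (forall t, 0 < t < Q^-1 -> m <= pi * cot (pi * (Q^-1 - t)) + pi * cot (pi * t)) ->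
  (forall x y, x <= y -> `|shift_incr y - shift_incr x| <= M * (y - x)) -> M < m ->
  (forall x, 0 < x < r ->
     Psi (Q^-1 - x) - lnsin (Q^-1 - x) < Psi (- x) - lnsin x) /\
  (forall y, 0 < y < s -> Psi (y - Q^-1) - lnsin (Q^-1 - y) < Psi y - lnsin y).
Proof.
move=> hm hM Mm; have hr := rQ; have hs := sQ; have qi := Qi2; have rs' := rs.
pose ell x := lnsin x - lnsin (- x + Q^-1).
have hell x y : 0 < x -> x <= y -> y < Q^-1 -> ell y - ell x >= m * (y - x).
  move=> x0 xy yq; apply: (@increment_ge _ ell (fun t => pi * cot (pi * t) - (- 1 * (pi * cot (pi * (- 1 * t + Q^-1)))))) => [//|t /andP[t1 t2]|t /andP[t1 t2]].
    have d1 := @is_derive_ln_sinpi R t (ltac:(lin)).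
    have d2 : is_derive t 1 (fun t => lnsin (- 1 * t + Q^-1)) (-1 * (pi * cot (pi * (-1 * t + Q^-1)))).
      apply: (@is_derive_comp_cst _ (fun u => lnsin (u + Q^-1))).
      apply: (@is_derive_comp_shift _ lnsin); apply: is_derive_ln_sinpi; lin.
    have -> : ell = (fun t => lnsin t - lnsin (- 1 * t + Q^-1)).
      by apply/funext => u; rewrite /ell mulN1r.
    exact: is_deriveB.
  have -> : - 1 * t + Q^-1 = Q^-1 - t by lra.
  by have := hm t (ltac:(lin)); lra.
have tie := sub_tie_ln.
have er : - r + Q^-1 = s by rewrite -rs; ring.
have es : - s + Q^-1 = r by rewrite -rs; ring.
have eEr : shift_incr (- r) = lnsin s - lnsin r by rewrite /shift_incr er.
split=> [x /andP[x0 xr]|y /andP[y0 ys]].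
- have := hell x r x0 (ltW xr) (ltac:(lin)).
  have := hM (- r) (- x) (ltac:(lin)).
  rewrite eEr /ell er /shift_incr [- x + _]addrC ler_norml; nra.
- have := hell y s y0 (ltW ys) (ltac:(lin)).
  have := hM (y - Q^-1) (- r) (ltac:(lin)).
  rewrite eEr /ell es /shift_incr subrK [- y + _]addrC ler_norml; nra.
Qed.

Lemma shift_incr_lipschitz x y : x <= y ->
  `|shift_incr y - shift_incr x| <= (om + al) * (y - x).
Proof.
move=> xy; have := sub_slope_le xy; have := sub_slope_le (_ : x + Q^-1 <= y + Q^-1).
rewrite lerD2r => /(_ xy); have -> : y + Q^-1 - (x + Q^-1) = y - x by ring.
by rewrite /shift_incr ler_norml; lra.
Qed.

Lemma sin_pi_sum : sin (pi / Q) ^+ 2 = sin (pi * r) ^+ 2 + sin (pi * s) ^+ 2 +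
  2 * (sin (pi * r) * sin (pi * s)) * cos (pi / Q).
Proof.
have -> : pi / Q = pi * r + pi * s by rewrite -mulrDr rs.
rewrite sinD cosD; have := cos2Dsin2 (pi * r); have := cos2Dsin2 (pi * s).
move: (sin (pi * r)) (sin (pi * s)) (cos (pi * r)) (cos (pi * s)) => a b c d h1 h2.
have -> : (a * d + c * b) ^+ 2 = a ^+ 2 * d ^+ 2 + c ^+ 2 * b ^+ 2 + 2 * a * b * c * d by ring.
have -> : c ^+ 2 = 1 - a ^+ 2 by lra.
have -> : d ^+ 2 = 1 - b ^+ 2 by lra.
ring.
Qed.

Lemma sin_pi_le x y : - 2^-1 <= x -> x <= y -> y <= 2^-1 -> sin (pi * x) <= sin (pi * y).
Proof.
move=> x0 xy y1; have p0 := @pi_gt0 R.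
rewrite leNgt ltr_sin ?in_itv/= -?leNgt; [|apply/andP; split; nra..].
by rewrite ler_pM2l.
Qed.

Lemma neighbours_ge3 : r <= s -> (3 <= q)%N ->
  (forall x, 0 < x < r ->
     Psi (Q^-1 - x) - lnsin (Q^-1 - x) < Psi (- x) - lnsin x) /\
  (forall y, 0 < y < s -> Psi (y - Q^-1) - lnsin (Q^-1 - y) < Psi y - lnsin y).
Proof.
move=> rles q3; have q2 := Q2; have hr := rQ; have hs := sQ; have qi := Qi2.
have Q3 : 3 <= Q by rewrite ler_nat.
have p0 := @pi_gt0 R.
have sr : 0 < sin (pi * r) by apply: sin_lobe; lin.
have ss : 0 < sin (pi * s) by apply: sin_lobe; lin.
have s1 : 0 < sin (pi * (Q^-1 / 2)) by apply: sin_lobe; lin.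
have sq : 0 < sin (pi / Q) by apply: sin_lobe; lin.
pose sg := sin (pi * (Q^-1 / 2)) ^+ 2.
have sg0 : 0 < sg by rewrite exprn_gt0.
have cq : cos (pi / Q) = 1 - 2 * sg.
  have -> : pi / Q = pi * (Q^-1 / 2) + pi * (Q^-1 / 2) by field; lra.
  by rewrite cosD /sg; have := cos2Dsin2 (pi * (Q^-1 / 2)); lra.
(* Two sines whose arguments add up to π/q have product at most sg, the value at the midpoint. What
   remains is sg < (q - 1) sin πr sin πs. *)
apply: (@neighbours (pi * (sin (pi / Q) / sg)) (om + al)) => [t ht|x y xy|].
- have st : 0 < sin (pi * t) by apply: sin_lobe; lin.
  have st' : 0 < sin (pi * (Q^-1 - t)) by apply: sin_lobe; lin.
  rewrite -mulrDr ler_wpM2l ?(ltW p0)// cotD ?gt_eqF//.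
  have -> : pi * (Q^-1 - t) + pi * t = pi / Q by ring.
  rewrite ler_wpM2l ?(ltW sq)// lef_pV2 ?posrE ?mulr_gt0//.
  have e1 : cos (pi / Q) = cos (pi * (Q^-1 - t)) * cos (pi * t)
      - sin (pi * (Q^-1 - t)) * sin (pi * t).
    by rewrite -cosD -mulrDr subrK.
  have e2 : cos (pi * (Q^-1 - t) - pi * t) = cos (pi * (Q^-1 - t)) * cos (pi * t)
      + sin (pi * (Q^-1 - t)) * sin (pi * t) by rewrite cosB.
  by have := cos_le1 (pi * (Q^-1 - t) - pi * t); lra.
- exact: shift_incr_lipschitz.
- rewrite /om /al -mulrDl slope_sum.
  have sg4 : sg <= 4^-1.
    have : sin (pi * (Q^-1 / 2)) <= sin (pi * 6^-1).
      apply: sin_pi_le; [lra| |lra].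
      have : Q^-1 <= 3^-1 by rewrite lef_pV2 ?posrE//; lra.
      lra.
    by rewrite sin_pi6 /sg; nra.
  have := @sin_pi_le r s (ltac:(lin)) rles (ltac:(lin)).
  have := sin_pi_sum; have := sin_le_3sin rles q3; rewrite cq.
  have -> : sin (pi / Q) ^+ 2 = 4 * sg * (1 - sg).
    by rewrite sin2cos2 cq; ring.
  move: (sin (pi * r)) (sin (pi * s)) sr ss => a b a0 b0 b3 e ab.
  have h : sg < (Q - 1) * (a * b).
    (* This is (b - 3 a) (3 b - a) ≤ 0. *)
    have hh : 3 * (a ^+ 2 + b ^+ 2) <= 10 * (a * b) by nra.
    have : 3 * (4 * sg * (1 - sg)) <= 10 * (a * b) + 6 * (a * b) * (1 - 2 * sg) by lra.
    have : sg < 2 * (a * b).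
      rewrite ltNge; apply/negP => h1.
      have : 16 * (a * b) - 12 * (a * b) * sg <= 8 * sg - 6 * sg ^+ 2 by nra.
      nra.
    have : 0 < a * b by rewrite mulr_gt0.
    nra.
  rewrite -mulrA ltr_pM2l// -mulrA ltr_pM2l// -invfM ltf_pV2 ?posrE ?mulr_gt0//; lra.
Qed.

Lemma lnsin_opp x : lnsin (1 - x) = lnsin x.
Proof.
rewrite /lnsin (_ : pi * (1 - x) = - (pi * x) + pi); last by ring.
by rewrite sinDpi sinN opprK.
Qed.

(** The ratio sin π(y + d) / sin πy is nonincreasing in y, so y = s is the worst case. There s + d
    lies between s + 1/q and 1 - (r + 1/q), where the sine is at least sin π(r + 1/q). *)
Lemma far_right W : r <= s -> (3 <= q)%N ->
  (forall x d, Q^-1 <= d -> d <= 1 - 2 * Q^-1 -> Psi (x + d) - Psi x <= W) ->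
  W < lnsin (r + Q^-1) - lnsin s ->
  forall y d, 0 < y -> y <= s -> Q^-1 <= d -> d <= 1 - 2 * Q^-1 ->
  Psi (y + d) - lnsin (y + d) < Psi y - lnsin y.
Proof.
move=> rles q3 hW WJ y d y0 ys d1 d2; have q2 := Q2; have hr := rQ; have hs := sQ.
have qi := Qi2; have rs' := rs; have p0 := @pi_gt0 R.
have q3' : Q^-1 <= 3^-1 by rewrite lef_pV2 ?posrE ?ler_nat//; lra.
have pos (x : R) : 0 < x -> x < 1 -> 0 < sin (pi * x) by move=> *; apply: sin_gt0_cycle; lin.
have := hW y d d1 d2.
suff : lnsin (r + Q^-1) - lnsin s <= lnsin (y + d) - lnsin y by lra.
have sy := pos y y0 (ltac:(lin)); have ss := pos s (ltac:(lin)) (ltac:(lin)).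
have sr := pos (r + Q^-1) (ltac:(lin)) (ltac:(lin)).
have syd := pos (y + d) (ltac:(lin)) (ltac:(lin)).
have ssd := pos (s + d) (ltac:(lin)) (ltac:(lin)).
rewrite /lnsin -!ln_div ?posrE// ler_ln ?posrE ?divr_gt0//.
have h1 : sin (pi * (r + Q^-1)) <= sin (pi * (s + d)).
  have [h|h] := leP (s + d) 2^-1; first by apply: sin_pi_le; lin.
  have -> : sin (pi * (s + d)) = sin (pi * (1 - (s + d))).
    rewrite (_ : pi * (1 - (s + d)) = - (pi * (s + d)) + pi); last by ring.
    by rewrite sinDpi sinN opprK.
  by apply: sin_pi_le; lin.
have h2 : sin (pi * (y + d)) * sin (pi * s) - sin (pi * (s + d)) * sin (pi * y) =
    sin (pi * d) * sin (pi * (s - y)).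
  rewrite !mulrDr mulrN !sinD sinN cosN; ring.
have h3 : 0 <= sin (pi * d) * sin (pi * (s - y)).
  by rewrite mulr_ge0// sin_ge0_pi//; apply/andP; split; nra.
rewrite ler_pdivrMr// mulrAC ler_pdivlMr//.
by apply: (@le_trans _ _ (sin (pi * (s + d)) * sin (pi * y))); [rewrite ler_pM2r|lra].
Qed.

(** At x = r the tie and periodicity turn the claim into that of [far_right] at y = s. From there
    towards 0 the log-sine difference changes at rate at least om + al, which covers the variation
    of Psi at both points. *)
Lemma far_left : r <= s -> (3 <= q)%N ->
  (forall y d, 0 < y -> y <= s -> Q^-1 <= d -> d <= 1 - 2 * Q^-1 ->
  Psi (y + d) - lnsin (y + d) < Psi y - lnsin y) ->
  forall x d, 0 < x -> x <= r -> Q^-1 <= d -> d <= 1 - 2 * Q^-1 ->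
  Psi (- x - d) - lnsin (x + d) < Psi (- x) - lnsin x.
Proof.
move=> rles q3 hR x d x0 xr d1 d2; have q2 := Q2; have hr := rQ; have hs := sQ.
have Q3 : 3 <= Q by rewrite ler_nat.
have qi := Qi2; have rs' := rs; have p0 := @pi_gt0 R.
have q3' : Q^-1 <= 3^-1 by rewrite lef_pV2 ?posrE ?ler_nat//; lra.
have pos (u : R) : 0 < u -> u < 1 -> 0 < sin (pi * u) by move=> *; apply: sin_gt0_cycle; lin.
have base : Psi (- r - d) - lnsin (r + d) < Psi (- r) - lnsin r.
  have := hR s (1 - Q^-1 - d) (ltac:(lin)) (ltac:(lin)) (ltac:(lin)) (ltac:(lin)).
  have -> : s + (1 - Q^-1 - d) = 1 - (r + d) by lra.
  rewrite lnsin_opp; have -> : 1 - (r + d) = - r - d + 1 by ring.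
  by rewrite (sub_per sub); have := sub_tie_ln; lra.
have key : (om + al) * (r - x) <= (lnsin r - lnsin (r + d)) - (lnsin x - lnsin (x + d)).
  pose k t : R := lnsin t - lnsin (t + d).
  apply: (@increment_ge _ k (fun t => pi * cot (pi * t) - pi * cot (pi * (t + d)))) => [//|t /andP[t1 t2]|t /andP[t1 t2]].
    have e1 := @is_derive_ln_sinpi R t (ltac:(lin)).
    have e2 : is_derive t 1 (fun t => lnsin (t + d)) (pi * cot (pi * (t + d))).
      by apply: (@is_derive_comp_shift _ lnsin); apply: is_derive_ln_sinpi; lin.
    exact: is_deriveB.
  have st := pos t (ltac:(lin)) (ltac:(lin)).
  have std := pos (t + d) (ltac:(lin)) (ltac:(lin)).
  have stq := pos (t + Q^-1) (ltac:(lin)) (ltac:(lin)).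
  have sr := pos r (ltac:(lin)) (ltac:(lin)).
  have srq := pos (r + Q^-1) (ltac:(lin)) (ltac:(lin)).
  have ss := pos s (ltac:(lin)) (ltac:(lin)).
  have sq := pos (Q^-1) (ltac:(lin)) (ltac:(lin)).
  apply: (@le_trans _ _ (pi * cot (pi * t) - pi * cot (pi * (t + Q^-1)))); last first.
    rewrite lerD2l lerN2 ler_pM2l// -subr_ge0 cotB ?gt_eqF//.
    rewrite divr_ge0 ?mulr_ge0 ?(ltW std) ?(ltW stq)// sin_ge0_pi//.
    by rewrite -mulrBr; apply/andP; split; nra.
  rewrite -mulrBr cotB ?gt_eqF// -mulrBr addrAC subrr add0r.
  rewrite /om /al -mulrDl slope_sum -mulrA ler_pM2l// -mulrA ler_pM2l// -invfM.
  rewrite lef_pV2 ?posrE ?mulr_gt0//; last lra.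
  apply: (@le_trans _ _ (sin (pi * r) * sin (pi * (r + Q^-1)))).
    have i1 := @sin_pi_le t r (ltac:(lin)) (ltac:(lin)) (ltac:(lin)).
    have i2 := @sin_pi_le (t + Q^-1) (r + Q^-1) (ltac:(lin)) (ltac:(lin)) (ltac:(lin)).
    by rewrite ler_pM ?(ltW st) ?(ltW stq).
  rewrite -mulrA ler_pM2l//.
  have -> : sin (pi * (r + Q^-1)) = sin (pi * s) + 2 * cos (pi * Q^-1) * sin (pi * r).
    have -> : pi * s = pi * Q^-1 - pi * r by rewrite -mulrBr -rs; congr (_ * _); ring.
    by rewrite mulrDr sinD sinB; ring.
  have sab := @sin_pi_le r s (ltac:(lin)) rles (ltac:(lin)).
  (* Equality holds at q = 3, where cos (π/3) = 1/2; from q = 4 on, cos ≤ 1 suffices. *)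
  have c2 : 2 * cos (pi * Q^-1) <= Q - 2.
    move: q3; rewrite leq_eqVlt => /predU1P[e3|q4].
      by rewrite -e3 cos_pi3; lra.
    have : 4 <= Q by rewrite ler_nat.
    by have := cos_le1 (pi * Q^-1); lra.
  nra.
have h1 := sub_slope_le (_ : - r <= - x); rewrite lerN2 in h1.
have h2 := sub_slope_le (_ : - r - d <= - x - d); rewrite lerD2r lerN2 in h2.
have := h1 xr; have := h2 xr.
have -> : - x - d - (- r - d) = r - x by ring.
have -> : - x - - r = r - x by ring.
lra.
Qed.

(** The argument of [sin_le_3sin] with the exponent 2 / (q - 1) kept, for the finer margins. *)
Lemma ratio_le : r <= s -> sin (pi * s) <= expR (2 / (Q - 1)) * sin (pi * r).
Proof.
move=> rles; have q2 := Q2; have hr := rQ; have hs := sQ; have qi := Qi2.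
have sr : 0 < sin (pi * r) by apply: sin_lobe; lin.
have ss : 0 < sin (pi * s) by apply: sin_lobe; lin.
rewrite -ler_pdivrMr// -[leLHS]lnK ?posrE ?divr_gt0// ler_expR ln_div//.
have := sub_slope_le (_ : - r <= s) => /(_ (ltac:(lin))).
have -> : s - - r = Q^-1 by rewrite -rs; ring.
rewrite sub_tie_ln /lnsin.
have : om * Q^-1 <= 2 / (Q - 1).
  apply: (@le_trans _ _ (2 * Q / (Q - 1) * Q^-1)).
    by rewrite ler_wpM2r ?om_le//; lra.
  by rewrite le_eqVlt; apply/orP; left; apply/eqP; field; lra.
lra.
Qed.

(** [sub_increment_le] with f bounded by its maximum ln q at the far end and d ≤ 1 - 2/q in the
    slope term. *)
Lemma incr_ge4 : r <= s -> (4 <= q)%N -> forall x d, Q^-1 <= d -> d <= 1 - 2 * Q^-1 ->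
  Psi (x + d) - Psi x <=
   ln (Q * sin (pi * r) / sin (pi * (Q * r))) + 2 * (Q - 2) / (Q * (Q - 1)).
Proof.
move=> rles q4 x d d1 d2; have q2 := Q2; have hr := rQ; have hs := sQ; have qi := Qi2.
have rs' := rs.
have Q4 : 4 <= Q by rewrite ler_nat.
have sr : 0 < sin (pi * r) by apply: sin_lobe; lin.
have Qr : 0 < Q * r < 1.
  apply/andP; split; first nra.
  by rewrite mulrC -ltr_pdivlMr ?div1r//; lra.
have sQr : 0 < sin (pi * (Q * r)) by apply: sin_gt0_cycle.
have Q0 : 0 < Q by lra.
rewrite ln_div ?posrE ?mulr_gt0// lnM ?posrE//.
have := sub_increment_le x (_ : 0 <= d <= 1) => /(_ (ltac:(lin))).
have := @flog_le R q hq (- r + d / Q); rewrite flogN (flogE hq hr).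
have : om * (d / Q) <= 2 * (Q - 2) / (Q * (Q - 1)).
  have -> : 2 * (Q - 2) / (Q * (Q - 1)) = (2 * Q / (Q - 1)) * ((1 - 2 * Q^-1) / Q).
    by field; lra.
  rewrite ler_pM ?om_le ?om0//; first by rewrite divr_ge0//; lra.
  by rewrite ler_wpM2r// invr_ge0; lin.
move: (f _) => *.
lra.
Qed.

End one_subaction.

End subaction.

(** * The margin between distant points of a fibre, q ≥ 3 *)

Section gap.
Context {R : realType}.
Implicit Types (q : nat) (r s x y : R).
Local Notation Q q := (q%:R : R).

Lemma gap_facts q r s : (3 <= q)%N -> 0 < r -> r <= s -> r + s = (Q q)^-1 ->
  [/\ 0 < sin (pi * r), 0 < sin (pi * s), sin (pi * r) <= sin (pi * s),
      s < 3^-1 & r <= 6^-1].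
Proof.
move=> q3 r0 rs e; have Q3 : 3 <= Q q by rewrite ler_nat.
have Qi3 : (Q q)^-1 <= 3^-1 by rewrite lef_pV2 ?posrE//; lra.
by split; [apply: sin_gt0_cycle|apply: sin_gt0_cycle|apply: sin_pi_le|..]; lra.
Qed.

Lemma sin_gap q r s : r + s = (Q q)^-1 ->
  sin (pi * (r + (Q q)^-1)) = sin (pi * s) + 2 * cos (pi / Q q) * sin (pi * r).
Proof.
move=> rs; have -> : pi * s = pi * (Q q)^-1 - pi * r.
  by rewrite -mulrBr -rs; congr (_ * _); ring.
by rewrite mulrDr sinD sinB; ring.
Qed.

(** Exponentiating, with [sin_gap], reduces the margin to an inequality between sines that
    polynomial arithmetic can settle. *)
Lemma gap_of_exp q r s (V e : R) : (3 <= q)%N -> 0 < r -> r <= s -> r + s = (Q q)^-1 ->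
  0 < V ->
  V * expR e * sin (pi * s) < sin (pi * s) + 2 * cos (pi / Q q) * sin (pi * r) ->
  ln V + e < lnsin (r + (Q q)^-1) - lnsin s.
Proof.
move=> q3 r0 rles rs V0; rewrite -sin_gap//.
have [sr ss _ _ _] := gap_facts q3 r0 rles rs => h.
have Ve : 0 < V * expR e * sin (pi * s) by rewrite !mulr_gt0// expR_gt0.
have srq := lt_trans Ve h.
rewrite -[e]expRK /lnsin -lnM ?posrE ?expR_gt0// ltrBrDr -lnM ?posrE ?mulr_gt0 ?expR_gt0//.
by rewrite ltr_ln ?posrE.
Qed.

Lemma sinc_le x y : 0 < x -> x <= y -> y <= pi -> x * sin y <= y * sin x.
Proof.
move=> x0 xy yp; pose h t : R := x * sin t - t * sin x.
suff : h y - h x <= 0 * (y - x) by rewrite /h; lra.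
apply: (@increment_le _ h (fun t => x * cos t - sin x)) => [//|t _|t /andP[t1 t2]].
  by rewrite /h; apply: is_derive_eq; rewrite /GRing.scale/= ?mulr1; ring.
have : x * cos x <= sin x by apply: x_cos_le_sin; apply/andP; split; lra.
have : cos t <= cos x.
  by rewrite leNgt ltr_cos ?in_itv/= -?leNgt ?(ltW t1)//; apply/andP; split; lra.
nra.
Qed.

(** S, C, c stand for sin πr, cos πr, cos (π/4), so that c (C - S) is sin πs, and E is the
    exponential of the slope term. The two bounds on c (C - S) confine S / C, which makes (C + S)^2
    C exceed 7/5. *)
Lemma gap4_poly (S C c E : R) : 0 < S -> 0 < C -> 0 < c -> 2 * c ^+ 2 = 1 ->
  C ^+ 2 + S ^+ 2 = 1 -> E <= 7 / 5 -> 0 < E -> S <= c * (C - S) -> c * (C - S) <= 2 * S ->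
  S < C /\ (c * (C - S)) * E < (c * (C - S)) * ((C + S) ^+ 2 * C).
Proof.
move=> S0 C0 c0 c2 SC e13 E0 sab rat.
have c7 : 7 / 10 <= c by clear -c0 c2; nra.
have c8 : c <= 17 / 24 by clear -c0 c2; nra.
have CS : S < C.
  have : 0 < c * (C - S) by clear -S0 sab; lra.
  by rewrite pmulr_rgt0// subr_gt0.
have CS' : 0 <= C - S by clear -CS; lra.
have Sl : 7 / 27 * C <= S.
  by have := ler_wpM2r CS' c7; clear -rat C0; lra.
have Su : S <= 5 / 12 * C.
  by have := ler_wpM2r CS' c8; clear -sab C0; lra.
have key : 7 / 5 < (C + S) ^+ 2 * C.
  have -> : (C + S) ^+ 2 * C = (C ^+ 2 + S ^+ 2 + 2 * S * C) * C by ring.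
  (* For C near 1 the lower bound on S / C suffices; otherwise C^2 + S^2 = 1 bounds S itself from
     below. *)
  rewrite SC; have [C95|C95] := leP (191 / 200) C.
    have : 1 + 14 / 27 * C ^+ 2 <= 1 + 2 * S * C by clear -C0 Sl; nra.
    have : (191 / 200) ^+ 2 <= C ^+ 2 by clear -C95; nra.
    by clear -C95 C0; nra.
  have S29 : 37 / 125 <= S by clear -SC C95 S0 C0; nra.
  have C92 : 23 / 25 <= C by clear -SC Su S0 C0; nra.
  have : 1 + 74 / 125 * C <= 1 + 2 * S * C by clear -S29 C0; nra.
  by clear -C92; nra.
split=> //; rewrite ltr_pM2l; first by clear -key e13; lra.
by rewrite mulr_gt0// subr_gt0.
Qed.

Lemma gap4 r s : 0 < r -> r <= s -> r + s = (Q 4)^-1 ->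
  sin (pi * s) <= expR (2 / (Q 4 - 1)) * sin (pi * r) ->
  ln (Q 4 * sin (pi * r) / sin (pi * (Q 4 * r))) + 2 * (Q 4 - 2) / (Q 4 * (Q 4 - 1)) <
  lnsin (r + (Q 4)^-1) - lnsin s.
Proof.
move=> r0 rles rs rat; have p0 := @pi_gt0 R.
have [sr ss sab _ _] := gap_facts (isT : (3 <= 4)%N) r0 rles rs.
have es : pi * s = pi / 4 - pi * r by rewrite -mulrBr -rs; congr (_ * _); ring.
have er : pi * (4 * r) = (pi * r + pi * r) + (pi * r + pi * r) by ring.
have sQr : 0 < sin (pi * (4 * r)) by apply: sin_gt0_cycle; lin.
have c4 : cos (pi / 4) = sin (pi / 4) :> R.
  by rewrite -cosBpihalf -cosN; congr cos; field.
have c4' : 2 * cos (pi / 4) ^+ 2 = 1 :> R.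
  by have := cos2Dsin2 (pi / 4 : R); rewrite -c4; move: (cos _) => c; lra.
have c40 : 0 < cos (pi / 4) :> R by rewrite c4; apply: sin_gt0_pi; clear -p0; lra.
have e23 : expR (2 / (4 - 1)) <= 2 :> R.
  have -> : 2 / (4 - 1) = 2 / 3 :> R by congr (_ / _); lin.
  by apply: expR_le; lin.
have e13 : expR (2 * (4 - 2) / (4 * (4 - 1))) <= 7 / 5 :> R.
  have -> : 2 * (4 - 2) / (4 * (4 - 1)) = 3^-1 :> R by field.
  by apply: expR_le; lin.
apply: gap_of_exp => //; first by rewrite divr_gt0// mulr_gt0.
have cr : 0 < cos (pi * r) by apply: cos_gt0_pihalf; apply/andP; split; clear -p0 r0 rles rs; nra.
have e0 := expR_gt0 (2 * (4 - 2) / (4 * (4 - 1)) : R).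
move: rat e23 e13 e0 sab ss sQr.
rewrite er es sinB -c4 [sin (_ + _ + _)]sinD !(sinD, cosD).
have := cos2Dsin2 (pi * r).
move: (sin (pi * r)) (cos (pi * r)) (cos (pi / 4)) sr cr c40 c4' => S C c S0 C0 c0 c2 SC.
move: (expR (2 / _)) (expR (2 * _ / _)) => E2 E rat e23 e13 E0 sab ss sQr.
clear -S0 C0 c0 c2 SC rat e23 e13 E0 sab ss.
have rat' : c * (C - S) <= 2 * S by nra.
have [|CS key] := @gap4_poly S C c E S0 C0 c0 c2 SC e13 E0 _ rat'; first lra.
have CS2 : 0 < C * C - S * S by nra.
have -> : (S * C + C * S) * (C * C - S * S) + (C * C - S * S) * (S * C + C * S) =
   (4 * S) * ((C * C - S * S) * C) by ring.
rewrite -[X in X / _]mulr1 -mulf_div divff ?mul1r; last by rewrite mulf_neq0 ?gt_eqF.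
rewrite -mulrA ltr_pdivrMl ?mulr_gt0//.
have -> : (C * C - S * S) * C * (c * C - c * S + 2 * c * S) =
  (c * (C - S)) * ((C + S) ^+ 2 * C) by ring.
by have -> : E * (c * C - c * S) = (c * (C - S)) * E by ring.
Qed.

Lemma gap5 q r s : (5 <= q)%N -> 0 < r -> r <= s -> r + s = (Q q)^-1 ->
  sin (pi * s) <= expR (2 / (Q q - 1)) * sin (pi * r) ->
  ln (Q q * sin (pi * r) / sin (pi * (Q q * r))) + 2 * (Q q - 2) / (Q q * (Q q - 1)) <
  lnsin (r + (Q q)^-1) - lnsin s.
Proof.
move=> q5 r0 rles rs rat; have p0 := @pi_gt0 R.
have q3 : (3 <= q)%N by exact: leq_trans q5.
have [sr ss sab _ _] := gap_facts q3 r0 rles rs.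
apply: gap_of_exp => //.
all: have : 5 <= Q q by rewrite ler_nat.
all: move: (Q q) rs rat => Q rs rat Q5.
all: have Q50 : 0 < Q by lin.
all: pose rho := Q * r; have rho0 : 0 < rho by rewrite mulr_gt0.
all: have rho1 : rho + Q * s = 1 by rewrite /rho -mulrDr rs mulfV// gt_eqF.
all: have rhos : rho <= Q * s by rewrite ler_pM2l.
all: have srho : 0 < sin (pi * rho) by apply: sin_gt0_cycle; lin.
  by rewrite divr_gt0// mulr_gt0.
have Qi5 : Q^-1 <= 5^-1 by rewrite lef_pV2 ?posrE//; lin.
have pl := @pi_le R.
have e05 : expR (2 / (Q - 1)) <= 5 / 3 :> R.
  apply: (@le_trans _ _ (expR (4^-1 + 4^-1))).
    by rewrite ler_expR ler_pdivrMr; clear -Q5; lra.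
  have h : expR (4^-1 : R) <= 9 / 7 by apply: expR_le; lin.
  by rewrite expRD; move: h (expR_gt0 (4^-1 : R)); move: (expR _) => E; clear; nra.
have e03 : expR (2 * (Q - 2) / (Q * (Q - 1))) <= 23 / 17 :> R.
  apply: (@le_trans _ _ (expR (3 / 20 + 3 / 20))).
    rewrite ler_expR ler_pdivrMr; clear -Q5; first nra.
    by rewrite mulr_gt0//; lra.
  have h : expR (3 / 20 : R) <= 43 / 37 by apply: expR_le; lin.
  by rewrite expRD; move: h (expR_gt0 (3 / 20 : R)); move: (expR _) => E; clear; nra.
have c8 : 51 / 64 <= cos (pi / Q).
  apply: le_trans (cos_ge_quadratic _).
  have : 0 <= pi / Q by rewrite divr_ge0// ltW.
  have : pi / Q <= 65 / 102 by clear -pl Qi5 p0; nra.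
  by move: (pi / Q) => x; clear; nra.
rewrite -/rho; set V := Q * sin (pi * r) / sin (pi * rho).
have V0 : 0 < V by rewrite divr_gt0// mulr_gt0.
have E0 := expR_gt0 (2 * (Q - 2) / (Q * (Q - 1)) : R).
have rr : 0 < pi * r by rewrite mulr_gt0.
have hV k : 0 < k -> pi * rho <= k * sin (pi * rho) -> V <= k.
  move=> k0 hk; rewrite /V ler_pdivrMr//; apply: le_trans hk.
  have := sin_lt_id rr; have -> : pi * rho = Q * (pi * r) by rewrite /rho; ring.
  by rewrite ler_pM2l// => /ltW.
have [hrho|hrho] := leP (17 / 40) rho.
(* Above the threshold 17/40 for rho = q r, the ratio s / r = (1 - rho) / rho is at most 23/17 but V
   is bounded only by π/2; below it V is smaller, and the ratio of sines is bounded by exp (1/2) ≤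
   5/3. *)
- have V1 : V <= 43 / 27.
    apply: le_trans (_ : pi / 2 <= _); last by clear -pl; lra.
    apply: hV; first by clear -p0; lra.
    have := @sinc_le (pi * rho) (pi / 2).
    rewrite sin_pihalf mulr1; apply; first by rewrite mulr_gt0.
    + by rewrite ler_pM2l//; clear -rho1 rhos; lra.
    + by clear -p0; lra.
  have hs' : sin (pi * s) <= 23 / 17 * sin (pi * r).
    have s_r : s <= 23 / 17 * r.
      have : Q * s <= 23 / 17 * (Q * r) by rewrite -/rho; clear -rho1 hrho; lra.
      by rewrite mulrCA ler_pM2l.
    have s13 : s < 1.
      by have := ler_pM2l Q50 1 s; clear -rho1 rho0 Q5; nra.
    have h1 : pi * r <= pi * s by rewrite ler_pM2l.
    have h2 : pi * s <= pi by rewrite -[leRHS]mulr1 ler_pM2l// ltW.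
    have h := sinc_le rr h1 h2.
    rewrite -(ler_pM2l rr); apply: le_trans h _.
    have : pi * s <= 23 / 17 * (pi * r) by clear -s_r p0; nra.
    by move: (sin (pi * r)) sr => S S0; clear -S0; nra.
  move: (expR (2 * _ / _)) E0 e03 => E E0 E1.
  have VE : V * E <= 13 / 6 by clear -V0 V1 E0 E1; nra.
  move: (sin (pi * s)) (sin (pi * r)) (cos _) sr ss c8 hs' VE => b a c a0 b0 c8 ba VE.
  by clear -a0 b0 c8 ba VE; nra.
- have V1 : V <= 75 / 52.
    apply: hV; first by lin.
    have x0 : 0 < pi * rho by rewrite mulr_gt0.
    have := @sin_ge_cubic R (pi * rho) (ltW x0).
    have : pi * rho <= 65 / 48 by clear -rho0 hrho pl p0; nra.
    move: (pi * rho) (sin _) x0 => x S x0 x1 h; clear -x0 x1 h.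
    have : x ^+ 3 <= 68 / 37 * x.
      have -> : x ^+ 3 = x ^+ 2 * x by ring.
      by rewrite ler_wpM2r ?(ltW x0)//; nra.
    by lra.
  move: (expR (2 * _ / _)) E0 e03 => E E0 E1.
  have VE : V * E <= 41 / 21 by clear -V0 V1 E0 E1; nra.
  move: (expR _) e05 rat => E2 e05 rat.
  move: (sin (pi * s)) (sin (pi * r)) (cos _) sr ss c8 rat VE => b a c a0 b0 c8 ba VE.
  clear -a0 b0 c8 ba VE e05; have : b <= 5 / 3 * a by nra.
  by nra.
Qed.


Lemma sin3 x : sin (3 * x) = sin x * (3 - 4 * sin x ^+ 2).
Proof.
have -> : 3 * x = x + x + x by ring.
have := cos2Dsin2 x; rewrite !(sinD, cosD); move: (sin x) (cos x) => S C h.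
have -> : S * (3 - 4 * S ^+ 2) = S * (3 * (1 - S ^+ 2) - S ^+ 2) by ring.
by have -> : 1 - S ^+ 2 = C ^+ 2 by [lra]; ring.
Qed.

Lemma cos3 x : cos (3 * x) = cos x * (1 - 4 * sin x ^+ 2).
Proof.
have -> : 3 * x = x + x + x by ring.
have := cos2Dsin2 x; rewrite !(sinD, cosD); move: (sin x) (cos x) => S C h.
have -> : C * (1 - 4 * S ^+ 2) = C * (1 - S ^+ 2 - 3 * S ^+ 2) by ring.
by have -> : 1 - S ^+ 2 = C ^+ 2 by [lra]; ring.
Qed.

Lemma flog3E x : 0 < x < 3^-1 -> flog 3 x = ln (3 - 4 * sin (pi * x) ^+ 2).
Proof.
move=> hx; rewrite (@flogE _ 3)//.
have s1 : 0 < sin (pi * x) by apply: sin_gt0_cycle; lin.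
have : 0 < sin (pi * (3 * x)) by apply: sin_gt0_cycle; lin.
by rewrite mulrCA sin3 pmulr_rgt0// => h; rewrite lnM ?posrE// addrAC subrr add0r.
Qed.

(** a and b stand for sin πr and sin πs, and the quadratic relation for sin^2 (π/3) = 3/4. Setting b
    = 11/10 a + t leaves a cubic form in a and t with nonnegative coefficients. *)
Lemma gap3_poly_far (a b y : R) : 0 < a -> 11 / 10 * a <= b -> a ^+ 2 + a * b + b ^+ 2 = 3 / 4 ->
  y < 2 -> y * (b * (a + b)) <= 9 / 44 * (a * (2 * b + a)) ->
  3 * (2 + y) < 4 * (a + b) ^+ 2 * (2 - y).
Proof.
move=> a0 ab e y2 hy; have b0 : 0 < b by lra.
have -> : 3 * (2 + y) = 4 * (a ^+ 2 + a * b + b ^+ 2) * (2 + y) by rewrite e; field.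
suff : y * (2 * a ^+ 2 + 3 * (a * b) + 2 * b ^+ 2) < 2 * (a * b) by clear; lra.
have p0 : 0 < b * (a + b) by rewrite mulr_gt0//; lra.
have P0 : 0 < 2 * a ^+ 2 + 3 * (a * b) + 2 * b ^+ 2 by have := mulr_gt0 a0 b0; have := sqr_ge0 a; have := sqr_ge0 b; lra.
rewrite -(ltr_pM2r p0) mulrAC.
apply: (@le_lt_trans _ _ (9 / 44 * (a * (2 * b + a)) * (2 * a ^+ 2 + 3 * (a * b) + 2 * b ^+ 2))).
  by rewrite ler_pM2r.
suff : 9 / 44 * (2 * b + a) * (2 * a ^+ 2 + 3 * (a * b) + 2 * b ^+ 2) < 2 * b * (b * (a + b)).
  by move=> h; have := h; rewrite -(ltr_pM2l a0); clear; lra.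
have [t t0 ->] : exists2 t, 0 <= t & b = 11 / 10 * a + t.
  by exists (b - 11 / 10 * a); [lra|ring].
have h1 : 0 < a ^+ 3 by rewrite exprn_gt0.
have h2 : 0 <= a ^+ 2 * t by rewrite mulr_ge0// ltW// exprn_gt0.
have h3 : 0 <= a * t ^+ 2 by rewrite mulr_ge0 ?exprn_ge0// ltW.
have h4 : 0 <= t ^+ 3 by rewrite exprn_ge0.
by clear -h1 h2 h3 h4; lra.
Qed.

Lemma gap3_poly_le (a b y : R) : 0 < a -> a <= b ->
  y * (b * (a + b)) <= 9 / 44 * (a * (2 * b + a)) -> y <= 27 / 88.
Proof.
move=> a0 ab hy; have p0 : 0 < b * (a + b) by rewrite mulr_gt0//; lra.
rewrite -(ler_pM2r p0); apply: le_trans hy _.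
by clear -a0 ab; nra.
Qed.

Lemma gap3_poly_near (a b : R) : 0 < a -> a <= b -> b <= 11 / 10 * a ->
  a ^+ 2 + a * b + b ^+ 2 = 3 / 4 ->
  117 / 40 * (15 / 11) < 4 * (a + b) ^+ 2.
Proof.
move=> a0 ab ba e; have b0 : 0 < b by lra.
suff : 99 / 400 <= a * b.
  have -> : 4 * (a + b) ^+ 2 = 4 * (a ^+ 2 + a * b + b ^+ 2) + 4 * (a * b) by ring.
  by rewrite e; clear; lra.
have : (b - a) ^+ 2 <= 1 / 110 * (a * b).
  have h1 : 0 <= a - 10 * (b - a) by lra.
  have h2 : 0 <= a + 11 * (b - a) by lra.
  by have := mulr_ge0 h1 h2; clear; lra.
have -> : (b - a) ^+ 2 = (a ^+ 2 + a * b + b ^+ 2) - 3 * (a * b) by ring.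
by rewrite e; clear; lra.
Qed.

(** For q = 3 the only distance d to treat is 1/3, and the value of f at -r + 1/9 is kept: at r = s
    bounding it by ln 3 would just fail. Hence f ≤ ln 3 is used when sin πs ≥ 11/10 sin πr, and f ≤
    ln (117/40) otherwise. *)
Lemma gap3 r s : 0 < r -> r <= s -> r + s = (Q 3)^-1 ->
  flog 3 (- r + (Q 3)^-1 / 3) - flog 3 (- r) + slope 3 r / (Q 3 - 1) * ((Q 3)^-1 / 3) <
  lnsin (r + (Q 3)^-1) - lnsin s.
Proof.
move=> r0 rles rs; have p0 := @pi_gt0 R.
have [sr ss sab s3 r6] := gap_facts (isT : (3 <= 3)%N) r0 rles rs.
have es : pi * s = pi / 3 - pi * r by rewrite -mulrBr -rs; congr (_ * _); ring.
have er : pi * (3 * r) = 3 * (pi * r) by ring.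
have w0 : 0 < sin (pi / 3) :> R by apply: sin_gt0_pi; clear -p0; lra.
have w2 : sin (pi / 3) ^+ 2 = 3 / 4 :> R.
  by have := cos2Dsin2 (pi / 3 : R); rewrite cos_pi3; move: (sin _) => w; clear; lra.
have C1 := cos2Dsin2 (pi * r).
have eb : sin (pi * s) = sin (pi / 3) * cos (pi * r) - 2^-1 * sin (pi * r).
  by rewrite es sinB cos_pi3.
have eab : sin (pi * r) ^+ 2 + sin (pi * r) * sin (pi * s) + sin (pi * s) ^+ 2 = 3 / 4.
  rewrite eb; move: (sin (pi / 3)) (sin (pi * r)) (cos _) w2 C1 => w a C w2 C1.
  have -> : a ^+ 2 + a * (w * C - 2^-1 * a) + (w * C - 2^-1 * a) ^+ 2 =
    w ^+ 2 * C ^+ 2 + 3 / 4 * a ^+ 2 by field.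
  by rewrite w2 -mulrDr C1 mulr1.
have e4 : 3 - 4 * sin (pi * r) ^+ 2 = 4 * (sin (pi * s) * (sin (pi * r) + sin (pi * s))).
  by move: (sin _) (sin _) eab => a b; clear; lra.
pose y := slope 3 r / (Q 3 - 1) * ((Q 3)^-1 / 3).
have ey : y * (sin (pi * s) * (sin (pi * r) + sin (pi * s))) = pi / 9 * (cos (pi * r) * sin (pi * r)).
  rewrite /y (@slopeE _ 3)//; last by rewrite r0; lin.
  rewrite /cot cos3 sin3 e4; move: (sin (pi * r)) (sin (pi * s)) (cos _) sr ss e4 => a b C a0 b0 e4.
  have b4 : 4 * (b * (a + b)) != 0 by rewrite gt_eqF// !mulr_gt0// addr_gt0.
  have -> : 1 - 4 * a ^+ 2 = 4 * (b * (a + b)) - 2 by rewrite -e4; ring.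
  have Y0 : 0 < b * (a + b) by rewrite mulr_gt0// addr_gt0.
  move: (b * _) Y0 {b4} e4 => Y Y0 e4.
  transitivity (pi * C * (2 * (3 - 4 * Y)) / (72 * a)).
    by field; rewrite !gt_eqF.
  have -> : 3 - 4 * Y = 4 * a ^+ 2 by rewrite -e4; ring.
  by field; rewrite gt_eqF.
have F0 : 0 < 3 - 4 * sin (pi * r) ^+ 2 by rewrite e4 !mulr_gt0// addr_gt0.
have fr : flog 3 r = ln (3 - 4 * sin (pi * r) ^+ 2) by apply: flog3E; rewrite r0; lin.
have hy : y * (sin (pi * s) * (sin (pi * r) + sin (pi * s))) <= 9 / 44 * (sin (pi * r) * (2 * sin (pi * s) + sin (pi * r))).
  rewrite ey eb; have pl := @pi_le R.
  have cr : 0 < cos (pi * r) by apply: cos_gt0_pihalf; apply/andP; split; clear -p0 r0 r6; nra.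
  move: (sin (pi / 3)) (sin (pi * r)) (cos _) sr cr w0 w2 => w a C a0 C0 w0 w2.
  have w8 : 45 / 52 <= w by clear -w0 w2; nra.
  have -> : a * (2 * (w * C - 2^-1 * a) + a) = 2 * w * (C * a) by field.
  rewrite [leRHS]mulrA ler_wpM2r ?mulr_ge0 ?(ltW C0) ?(ltW a0)//.
  by clear -pl w8; lra.
suff [F F00 [hF hE]] : exists2 F, 0 < F & flog 3 (- r + (Q 3)^-1 / 3) <= ln F /\
    F * expR y < 4 * (sin (pi * r) + sin (pi * s)) ^+ 2.
  apply: (@le_lt_trans _ _ (ln (F / (3 - 4 * sin (pi * r) ^+ 2)) + y)).
    by rewrite (@flogN _ 3)// fr ln_div ?posrE// lerD2r lerD2r.
  apply: gap_of_exp => //; first by rewrite divr_gt0.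
  rewrite cos_pi3 mulfV// mul1r e4.
  move: (expR _) hE => E hE.
  move: hE {ey hy eab e4 F0 fr eb C1 es sab}.
  move: (sin (pi * r)) (sin (pi * s)) sr ss => a b a0 b0 hE.
  have ab0 : 0 < 4 * (a + b) by rewrite mulr_gt0// addr_gt0.
  have -> : F / (4 * (b * (a + b))) * E * b = F * E / (4 * (a + b)).
    by field; rewrite !gt_eqF// addr_gt0.
  by rewrite ltr_pdivrMr//; move: hE; clear; lra.
have y3 := gap3_poly_le sr sab hy.
have y0 : 0 <= y.
  apply: mulr_ge0; last by lin.
  by apply: divr_ge0; [apply: (@slope_ge0 _ 3) => //; rewrite (ltW r0); lin|lin].
have [hab|hab] := leP (11 / 10 * sin (pi * r)) (sin (pi * s)).
  exists 3 => //; split; first exact: flog_le.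
  have y2 : y < 2 by clear -y3; lra.
  have h := gap3_poly_far sr hab eab y2 hy.
  have : expR y <= (2 + y) / (2 - y) by apply: expR_le_pade; rewrite y0.
  have y20 : 0 < 2 - y by clear -y2; lra.
  rewrite ler_pdivlMr//; move: (expR y) => E hE.
  by rewrite -(ltr_pM2r y20); apply: le_lt_trans h; move: hE; clear; lra.
have hn := gap3_poly_near sr sab (ltW hab) eab.
have F1 : 0 < 117 / 40 :> R by lin.
exists (117 / 40) => //; split; last first.
  apply: le_lt_trans hn; rewrite ler_pM2l//.
  by apply: expR_le; [rewrite y0|]; clear -y3; lra.
have p31 := @pi_ge R; have pl := @pi_le R.
(* th vanishes at r = s, and sin th is proportional to sin πs - sin πr: nearly equal sines keep th
   small, and so keep the argument ph of the sine in f close to π/18. *)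
pose th := pi / 6 - pi * r.
have c6 : cos (pi / 6) = sin (pi / 3) :> R.
  by rewrite -cosBpihalf -cosN; congr cos; field.
have eth : 2 * sin (pi / 3) * sin th = sin (pi * s) - sin (pi * r).
  rewrite eb /th sinB c6 sin_pi6.
  move: (sin (pi * r)) (cos (pi * r)) (sin (pi / 3)) w2 => a C w w2.
  by have -> : 2 * w * (2^-1 * C - w * a) = w * C - 2 * w ^+ 2 * a by [field]; rewrite w2; field.
have a5 : sin (pi * r) <= 2^-1.
  by move: (sin _) (sin _) sr sab eab => a b; clear; nra.
have th0 : 0 <= th by rewrite /th; clear -p0 r6; nra.
have th5 : th <= 17 / 32.
  have : 0 < pi * r by rewrite mulr_gt0.
  by rewrite /th; clear -pl; lra.
have hth : th <= 3 / 98.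
  have h := sin_ge_cubic th0.
  have h3 : th ^+ 3 <= 17 / 60 * th.
    have -> : th ^+ 3 = th ^+ 2 * th by ring.
    by rewrite ler_wpM2r//; clear -th0 th5; nra.
  move: (sin th) (sin (pi / 3)) eth h w0 w2 => S w eth h w0 w2.
  have w8 : 45 / 52 <= w by clear -w0 w2; nra.
  have hS : 2 * w * S <= 1 / 20 by rewrite eth; clear -hab a5; lra.
  have : S <= 3 / 103 by clear -hS w8; nra.
  by clear -h h3; lra.
pose ph := pi * (r - (Q 3)^-1 / 3).
have eph : ph = pi / 18 - th by rewrite /ph /th; field.
have ph1 : 12 / 85 <= ph by rewrite eph; clear -hth p31; lra.
have ph2 : ph <= 17 / 96 by rewrite eph; clear -th0 pl; lra.
have -> : - r + (Q 3)^-1 / 3 = - (r - (Q 3)^-1 / 3) by ring.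
have r9 : 0 < r - 3^-1 / 3.
  by rewrite -(pmulr_rgt0 _ p0) -/ph; clear -ph1; lra.
rewrite (@flogN _ 3)// flog3E ?r9; last by lin.
have S1 : 7 / 50 <= sin ph.
  have ph0 : 0 <= ph by clear -ph1; lra.
  have h := sin_ge_cubic ph0.
  have h3 : ph ^+ 3 <= 2 / 63 * ph.
    have -> : ph ^+ 3 = ph ^+ 2 * ph by ring.
    by rewrite ler_wpM2r//; clear -ph0 ph2; nra.
  by clear -h h3 ph1; lra.
have S0 : sin ph <= 17 / 96.
  by apply: le_trans ph2; apply: ltW; apply: sin_lt_id; clear -ph1; lra.
rewrite -/ph; move: (sin ph) S1 S0 => S S1 S0.
by rewrite ler_ln ?posrE//; clear -S1 S0; nra.
Qed.
End gap.

(** * Comparison of the points of a fibre for q = 2 *)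

Section doubling.
Context {R : realType}.
Implicit Types (x y t d : R).

Lemma slope2E x : cos (pi * x) != 0 -> slope 2 x = pi * (sin (pi * x) / cos (pi * x)) :> R.
Proof.
move=> c0; rewrite /slope /= !(mul0r, mul1r, cos0, subr0, sub0r, add0r, oppr0).
have -> : cos (pi * x) + cos (pi * x) = 2 * cos (pi * x) by ring.
by field.
Qed.

Lemma flog2E x : flog 2 x = ln `|2 * cos (pi * x)|.
Proof.
rewrite /flog /= !mul0r !mul1r cos0 !add0r mul1r.
by congr (ln `|_|); ring.
Qed.

Lemma cos_pi4 : [/\ sin (pi / 4) = cos (pi / 4) :> R, 0 < cos (pi / 4) :> R &
  2 * cos (pi / 4) ^+ 2 = 1 :> R].
Proof.
have p0 := @pi_gt0 R.
have c4 : sin (pi / 4) = cos (pi / 4) :> R.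
  by rewrite -cosBpihalf -cosN; congr cos; field.
have c40 : 0 < cos (pi / 4) :> R by rewrite -c4; apply: sin_gt0_pi; clear -p0; lra.
split=> //; have := cos2Dsin2 (pi / 4 : R); rewrite c4.
by move: (cos _) => c; lra.
Qed.

(* tan (y + pi/4) - tan y = sin (pi/4) / (cos (y + pi/4) cos y), and the denominator
   is smallest at the right end of the range of y. *)
Lemma slope2_incr (r p : R) : 0 < r -> r <= 4^-1 -> - r <= p -> p <= 4^-1 - r ->
  slope 2 (p + 4^-1) - slope 2 p <=
    pi / (sin (pi * r) * (sin (pi * r) + cos (pi * r))).
Proof.
move=> r0 r4 rp pr; have p0 := @pi_gt0 R; have [s4 c40 c4] := cos_pi4.
have cpos x : - 2^-1 < x -> x < 2^-1 -> 0 < cos (pi * x).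
  by move=> x1 x2; apply: cos_gt0_pihalf; apply/andP; split; clear -p0 x1 x2; nra.
have cp : 0 < cos (pi * p) by apply: cpos; lin.
have cp4 : 0 < cos (pi * (p + 4^-1)) by apply: cpos; lin.
have sr : 0 < sin (pi * r) by apply: sin_gt0_cycle; lin.
have cr : 0 < cos (pi * r) by apply: cpos; lin.
rewrite !slope2E ?gt_eqF// -mulrBr ler_pM2l//.
have -> : sin (pi * (p + 4^-1)) / cos (pi * (p + 4^-1)) - sin (pi * p) / cos (pi * p) =
   cos (pi / 4) / (cos (pi * (p + 4^-1)) * cos (pi * p)).
  apply: (@mulIf _ (cos (pi * (p + 4^-1)) * cos (pi * p))); first by rewrite mulf_neq0 ?gt_eqF.
  rewrite divfK ?mulf_neq0 ?gt_eqF//.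
  have e : sin (pi * (p + 4^-1)) * cos (pi * p) - cos (pi * (p + 4^-1)) * sin (pi * p) = cos (pi / 4).
    by rewrite -sinB -mulrBr addrAC subrr add0r -s4.
  move: cp cp4 e; move: (sin _) (cos _) (sin (pi * p)) (cos _) => S C S' C' cp cp4 e.
  by rewrite -e; field; rewrite !gt_eqF.
suff h : cos (pi / 4) * (sin (pi * r) * (sin (pi * r) + cos (pi * r))) <=
    cos (pi * (p + 4^-1)) * cos (pi * p).
  by rewrite ler_pdivrMr ?mulr_gt0// ler_pdivlMl ?mulr_gt0 ?addr_gt0// mulrC.
have e1 : cos (pi * (p + 4^-1)) * cos (pi * p) =
    (cos (pi * (2 * p + 4^-1)) + cos (pi / 4)) / 2.
  have -> : pi * (2 * p + 4^-1) = pi * (p + 4^-1) + pi * p by ring.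
  have -> : pi / 4 = pi * (p + 4^-1) - pi * p by ring.
  by rewrite cosD cosB; field.
have e2 : cos (pi / 4) * (sin (pi * r) * (sin (pi * r) + cos (pi * r))) =
    (cos (pi * (2^-1 + 4^-1 - 2 * r)) + cos (pi / 4)) / 2.
  have -> : pi * (2^-1 + 4^-1 - 2 * r) = pi / 4 + pi / 2 - (pi * r + pi * r) by field.
  rewrite cosB cosDpihalf sinDpihalf sinD cosD s4.
  have := cos2Dsin2 (pi * r); move: (cos (pi / 4)) (sin _) (cos _) => c S C h.
  have -> : C * C = C ^+ 2 by []; have -> : C ^+ 2 = 1 - S ^+ 2 by clear -h; lra.
  by field.
rewrite e1 e2 ler_pM2r// lerD2r.
have eN : cos (pi * (2 * p + 4^-1)) = cos (pi * - (2 * p + 4^-1)) by rewrite mulrN cosN.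
have [h|h] := leP 0 (2 * p + 4^-1); last rewrite eN.
  rewrite leNgt ltr_cos ?in_itv/= -?leNgt;
    [by rewrite ler_pM2l//; lin|by apply/andP; split; clear -p0 h r0 r4 rp pr; nra..].
rewrite leNgt ltr_cos ?in_itv/= -?leNgt;
  [by rewrite ler_pM2l//; lin|by apply/andP; split; clear -p0 h r0 r4 rp pr; nra..].
Qed.

(** With a = sin πr and b = cos πr this says that the Lipschitz constant [M] below is less than 2π.
    The relation a^2 + b^2 = 1 makes both sides cubic forms in a and t = b - a. *)
Lemma ratio2_poly (a b : R) : 0 < a -> a <= b -> b <= 9 / 5 * a -> a ^+ 2 + b ^+ 2 = 1 ->
  a + 2 * b < 4 * (a * b * (a + b)).
Proof.
move=> a0 ab ba e.
have -> : a + 2 * b = (a + 2 * b) * (a ^+ 2 + b ^+ 2) by rewrite e mulr1.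
have t0 : 0 <= b - a by rewrite subr_ge0.
have -> : b = a + (b - a) by ring.
have ta : b - a <= 4 / 5 * a by clear -ba; lra.
move: (b - a) t0 ta => t t0 ta.
have h1 : 0 < a ^+ 3 by rewrite exprn_gt0.
have h2 : a ^+ 2 * t <= 4 / 5 * a ^+ 3.
  have -> : 4 / 5 * a ^+ 3 = a ^+ 2 * (4 / 5 * a) by ring.
  by rewrite ler_wpM2l// exprn_ge0// ltW.
have h3 : a * t ^+ 2 <= 4 / 5 * (a ^+ 2 * t).
  have -> : 4 / 5 * (a ^+ 2 * t) = a * (4 / 5 * a * t) by ring.
  by rewrite ler_pM2l// expr2 ler_wpM2r.
have h4 : t ^+ 3 <= 4 / 5 * (a * t ^+ 2).
  have -> : 4 / 5 * (a * t ^+ 2) = 4 / 5 * a * t ^+ 2 by ring.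
  have -> : t ^+ 3 = t * t ^+ 2 by ring.
  by rewrite ler_wpM2r// exprn_ge0.
by clear -h1 h2 h3 h4; lra.
Qed.

Lemma ratio2_num (a b c : R) : 0 < a -> 0 < b -> 9 / 5 * a < b -> 0 < c -> 2 * c ^+ 2 = 1 ->
  ln `|2 * (c * (a + b))| - ln `|2 * b| + pi * (a / b) / (2 - 1) * (2^-1 / 2) < ln b - ln a.
Proof.
move=> a0 b0 hab c0 c2.
have ab0 : 0 < a + b by rewrite addr_gt0.
have c7 : c <= 71 / 100 by clear -c0 c2; nra.
have e0 : expR (pi * (a / b) / (2 - 1) * (2^-1 / 2)) <= 159 / 100.
  have pl := @pi_le R; have p0 := @pi_gt0 R.
  have ab5 : a / b <= 5 / 9 by rewrite ler_pdivrMr//; clear -hab; lra.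
  have ab1 : 0 <= a / b by rewrite divr_ge0 ?ltW.
  apply: (@le_trans _ _ (expR (9 / 20))); last by apply: expR_le; lin.
  have -> : 2 - 1 = 1 :> R by ring.
  rewrite ler_expR divr1; move: (a / b) ab5 ab1 => x ab5 ab1.
  have h : pi * x <= 9 / 5 by clear -pl p0 ab5 ab1; nra.
  by move: (pi * x) h => z; clear; lra.
have E0 := expR_gt0 (pi * (a / b) / (2 - 1) * (2^-1 / 2)).
rewrite -[X in _ + X]expRK.
rewrite !ger0_norm ?mulr_ge0 ?(ltW b0) ?(ltW c0) ?(ltW ab0)//.
rewrite -!ln_div ?posrE ?mulr_gt0// -lnM ?posrE ?divr_gt0 ?mulr_gt0// ltr_ln ?posrE ?divr_gt0 ?mulr_gt0 ?divr_gt0 ?invr_gt0 ?mulr_gt0//.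
move: (expR _) e0 E0 => E E1 E0.
have -> : 2 * (c * (a + b)) / (2 * b) * E = c * (a + b) * E / b by field; rewrite gt_eqF.
rewrite ltr_pdivlMr// mulrAC ltr_pdivrMr//.
have cE : c * E <= 113 / 100 by clear -c0 c7 E0 E1; nra.
have h : c * (a + b) * E <= 113 / 100 * (a + b).
  by rewrite mulrAC ler_pM2r.
have : 113 / 100 * (a + b) * a < b * b by clear -hab a0 b0; nra.
by apply: le_lt_trans; rewrite ler_pM2r.
Qed.

Section subaction2.
Variables (K r s : R) (Psi : R -> R).
Hypothesis sub : subaction 2 K r s Psi.
Hypothesis rles : r <= s.

Let h2 : (2 <= 2)%N := isT.

Let bnd : [/\ 0 < r, r <= 4^-1, 4^-1 <= s & s = 2^-1 - r].
Proof.
have r0 := sub_r0 sub; have s0 := sub_s0 sub; have rs := sub_rs sub; have rs' := rles.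
split; lin.
Qed.

Let trig : [/\ 0 < sin (pi * r), sin (pi * s) = cos (pi * r),
  sin (pi * r) <= cos (pi * r) & 0 < cos (pi * r)].
Proof.
have [r0 r4 s4 es] := bnd; have rs' := rles; have p0 := @pi_gt0 R.
have e : sin (pi * s) = cos (pi * r).
  by rewrite es mulrBr -cosBpihalf -cosN; congr cos; field.
have sr : 0 < sin (pi * r) by apply: sin_gt0_cycle; lin.
split=> //; rewrite -e; first by apply: sin_pi_le; lin.
by apply: sin_gt0_cycle; lin.
Qed.

(** [ratio_le] would only give the factor exp 2. Here the increment of Psi from -r to s is replaced
    by one of f + Psi over half the length, and the slope bound is spent on its Psi part alone. *)
Lemma ratio2_le : cos (pi * r) <= 9 / 5 * sin (pi * r).
Proof.
have [r0 r4 s4 es] := bnd; have [a0 eb ab b0] := trig.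
have [e4 c0 c2] := cos_pi4.
have := sub_increment_le h2 sub (- r) (_ : 0 <= 2^-1 <= 1) => /(_ (ltac:(lin))).
have -> : - r + 2^-1 = s by rewrite es; ring.
rewrite (sub_tie_ln h2 sub) /lnsin eb !flog2E slope2E ?gt_eqF//.
have -> : cos (pi * - r) = cos (pi * r) by rewrite mulrN cosN.
have -> : cos (pi * (- r + 2^-1 / 2)) = cos (pi / 4) * (sin (pi * r) + cos (pi * r)).
  have -> : pi * (- r + 2^-1 / 2) = pi / 4 - pi * r by field.
  by rewrite cosB e4; ring.
move=> h; rewrite leNgt; apply/negP => hab; move: h; apply/negP; rewrite -ltNge.
move: (sin (pi * r)) (cos (pi * r)) (cos (pi / 4)) a0 b0 ab hab c0 c2 => a b c a0 b0 ab hab c0 c2.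
exact: ratio2_num.
Qed.

(** For q = 2 the sum om + al is π / (sin πr cos πr) ≥ 2π, the very value of m in [neighbours], so
    [shift_incr_lipschitz] never suffices. But E (u + 1/2) = - E u, and on the half period after the
    jump E is an increment of f + Psi over 1/4 inside the arc. Concavity makes the variation of its
    f part one-sided, and the argument moves at half speed, whence [M]. *)
Let E x : R := Psi (x + 2^-1) - Psi x.

Let M : R := (pi / (sin (pi * r) * (sin (pi * r) + cos (pi * r))) +
  pi / (sin (pi * r) * cos (pi * r))) / 2.

Let half_lipschitz t t' : 0 <= t -> t <= t' -> t' <= 2^-1 ->
  `|E (2 * - r + K + t') - E (2 * - r + K + t)| <= M * (t' - t).
Proof.
move=> t0 tt t1; have [r0 r4 s4 es] := bnd; have [a0 eb ab b0] := trig.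
have eE u : 0 <= u <= 2^-1 -> E (2 * - r + K + u) =
    flog 2 (- r + u / 2 + 4^-1) + Psi (- r + u / 2 + 4^-1) - (flog 2 (- r + u / 2) + Psi (- r + u / 2)).
  move=> hu; rewrite /E -addrA (sub_eq sub) ?(sub_eq sub); [|lin..].
  have -> : - r + (u + 2^-1) / 2 = - r + u / 2 + 4^-1 by field.
  ring.
rewrite !eE; [|lin..].
set p := - r + t / 2; set p' := - r + t' / 2.
have pp : p <= p' by rewrite /p /p'; lin.
have hp : - r <= p by rewrite /p; lin.
have hp' : p' <= 4^-1 - r by rewrite /p'; lin.
have -> : t' - t = 2 * (p' - p) by rewrite /p /p'; field.
have sl1 := sub_slope_le sub pp.
have sl2 := sub_slope_le sub (_ : p + 4^-1 <= p' + 4^-1).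
rewrite lerD2r in sl2; have {}sl2 := sl2 pp.
have e4 : p' + 4^-1 - (p + 4^-1) = p' - p by ring.
rewrite e4 in sl2.
have lam : slope 2 r / (2 - 1) + slope 2 s / (2 - 1) = pi / (sin (pi * r) * cos (pi * r)).
  rewrite -mulrDl (slope_sum h2 sub) sin_pihalf eb.
  by have -> : 2 - 1 = 1 :> R by [ring]; rewrite divr1 div1r.
have d1 : flog 2 (p' + 4^-1) - flog 2 p' <= flog 2 (p + 4^-1) - flog 2 p.
  by apply: (flog_concave_shift h2); lin.
have d2 : - (pi / (sin (pi * r) * (sin (pi * r) + cos (pi * r)))) * (p' - p) <=
   (flog 2 (p' + 4^-1) - flog 2 p') - (flog 2 (p + 4^-1) - flog 2 p).
  pose h x : R := flog 2 (x + 4^-1) - flog 2 x.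
  apply: (@increment_ge _ h (fun x => - slope 2 (x + 4^-1) - - slope 2 x)) => [//|x /andP[x1 x2]|x /andP[x1 x2]].
    have e1 : is_derive x 1 (flog 2) (- slope 2 x).
      by apply: is_derive_flog => //; rewrite ltr_norml; lin.
    have e2 : is_derive x 1 (fun x => flog 2 (x + 4^-1)) (- slope 2 (x + 4^-1)).
      by apply: is_derive_comp_shift; apply: is_derive_flog => //; rewrite ltr_norml; lin.
    exact: is_deriveB.
  have := @slope2_incr r x r0 r4 (ltac:(lin)) (ltac:(lin)).
  by move: (slope _ _) (slope _ _) (pi / _) => u v w; lin.
have eM : M * (2 * (p' - p)) = pi / (sin (pi * r) * (sin (pi * r) + cos (pi * r))) * (p' - p) +
   (slope 2 r / (2 - 1) + slope 2 s / (2 - 1)) * (p' - p).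
  rewrite lam /M; set D := pi / (sin (pi * r) * (_ + _)); set w := pi / (sin (pi * r) * cos _).
  move: D w => D w.
  by field.
rewrite eM ler_norml; move: d1 d2 sl1 sl2.
move: (flog 2 (p' + 4^-1)) (flog 2 p') (flog 2 (p + 4^-1)) (flog 2 p) => f1 f2 f3 f4.
move: (Psi (p' + 4^-1)) (Psi p') (Psi (p + 4^-1)) (Psi p) => g1 g2 g3 g4.
move: (pi / _) (slope 2 r / _) (slope 2 s / _) => D w1 w2.
by lin.
Qed.

Let E_lipschitz x y : x <= y -> `|E y - E x| <= M * (y - x).
Proof.
move=> xy; set j := 2 * - r + K.
have anti u : E (u + 2^-1) = - E u.
  rewrite /E -addrA (_ : 2^-1 + 2^-1 = 1 :> R) ?(sub_per sub)//; last by field.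
  ring.
pose e0 t := E (j + t) - E j.
have Ej0 : E (j + 1) = E j by rewrite /E addrAC !(sub_per sub).
have e1 : e0 1 = 0 by rewrite /e0 Ej0 subrr.
have eE u : E u - E j = qext e0 (u - j).
  rewrite /qext e1 mulr0 add0r /e0; congr (_ - _).
  have := floor_frac (u - j) => h.
  have {1}-> : u = j + frac (u - j) + (Num.floor (u - j))%:~R by lin.
  by rewrite /E addrAC !(sub_perz sub).
have hl : bounded_slope (- M) M 0 1 e0.
  move=> t t' t0 tt t1.
  have -> : e0 t' - e0 t = E (j + t') - E (j + t) by rewrite /e0; ring.
  have sh u : 2^-1 <= u -> E (j + u) = - E (j + (u - 2^-1)).
    by move=> hu; rewrite -anti; congr E; ring.
  have [t'2|t'2] := leP t' 2^-1.
    by have := half_lipschitz t0 tt t'2; rewrite ler_norml -/j; lin.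
  have [t2|t2] := leP 2^-1 t.
    rewrite (sh t') ?(ltW t'2)// (sh t)//.
    have := @half_lipschitz (t - 2^-1) (t' - 2^-1) (ltac:(lin)) (ltac:(lin)) (ltac:(lin)).
    rewrite ler_norml -/j.
    by have -> : t' - 2^-1 - (t - 2^-1) = t' - t by [ring]; lin.
  have l1 := @half_lipschitz t 2^-1 t0 (ltW t2) (lexx _).
  have l2 := @half_lipschitz 0 (t' - 2^-1) (lexx _) (ltac:(lin)) (ltac:(lin)).
  move: l1 l2; rewrite -/j (sh t') ?(ltW t'2)// (sh 2^-1)// subrr subr0 !ler_norml.
  by lin.
have -> : E y - E x = (E y - E j) - (E x - E j) by ring.
have -> : y - x = (y - j) - (x - j) by ring.
rewrite !eE ler_norml -mulNr; apply: bounded_slope_qext => //; last by lin.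
by rewrite /e0 addr0 subrr.
Qed.

Lemma neighbours2 :
  (forall x, 0 < x < r ->
     Psi (2^-1 - x) - lnsin (2^-1 - x) < Psi (- x) - lnsin x) /\
  (forall y, 0 < y < s -> Psi (y - 2^-1) - lnsin (2^-1 - y) < Psi y - lnsin y).
Proof.
have [r0 r4 s4 es] := bnd; have [a0 eb ab b0] := trig; have p0 := @pi_gt0 R.
apply: (@neighbours _ 2 h2 K r s Psi sub (2 * pi) M).
- move=> t ht; rewrite -mulrDr mulrC ler_pM2l//.
  have st : 0 < sin (pi * t) by apply: sin_gt0_cycle; lin.
  have st' : 0 < sin (pi * (2^-1 - t)) by apply: sin_gt0_cycle; lin.
  rewrite cotD ?gt_eqF// -mulrDr subrK sin_pihalf div1r.
  have -> : sin (pi * (2^-1 - t)) = cos (pi * t).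
    by rewrite mulrBr -cosBpihalf -cosN; congr cos; field.
  rewrite -[2]invrK lef_pV2 ?posrE ?mulr_gt0//; last first.
    by move: st'; congr (0 < _); rewrite mulrBr -cosBpihalf -cosN; congr cos; field.
  have := cos2Dsin2 (pi * t); have := sqr_ge0 (sin (pi * t) - cos (pi * t)).
  by move: (sin _) (cos _) => S C; rewrite sqrrB; lin.
- exact: E_lipschitz.
- have e := cos2Dsin2 (pi * r); rewrite addrC in e.
  have key := ratio2_poly a0 ab ratio2_le e.
  rewrite /M; move: (sin _) (cos _) a0 b0 key => a b a0 b0 key.
  have ab0 : 0 < a + b by rewrite addr_gt0.
  have -> : (pi / (a * (a + b)) + pi / (a * b)) / 2 = pi * (a + 2 * b) / (2 * (a * b * (a + b))).
    by field; rewrite !gt_eqF.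
  by rewrite ltr_pdivrMr ?mulr_gt0//; move: key; rewrite -(ltr_pM2l p0); lin.
Qed.

End subaction2.
End doubling.

(** * The strict inequality off the arc and the existence of sub-actions *)

Section pre_sturmian.
Context {R : realType} (q : nat).
Hypothesis hq : (2 <= q)%N.
Implicit Types (K r s x y u d : R) (Psi : R -> R).

Local Notation Q := (q%:R : R).
Local Notation f := (@flog R q).

Let Q2 : 2 <= Q. Proof. by rewrite ler_nat. Qed.

Let Qi : 0 < Q^-1 <= 2^-1.
Proof. by rewrite invr_gt0 lef_pV2 ?posrE//; have := Q2; lra. Qed.

Definition lnabs u : R := ln `|sin (pi * u)|.

Lemma norm_sinD (u : R) (m : int) : `|sin (pi * (u + m%:~R))| = `|sin (pi * u)|.
Proof.
have pn n (v : R) : `|sin (pi * (v + n%:R))| = `|sin (pi * v)|.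
  elim: n v => [|n IH] v; first by rewrite addr0.
  by rewrite -natr1 addrA mulrDr mulr1 sinDpi normrN.
case: m => n; first exact: pn.
by have := pn n.+1 (u - n.+1%:R); rewrite subrK NegzE mulrNz => ->.
Qed.

Lemma lnabsD u (m : int) : lnabs (u + m%:~R) = lnabs u.
Proof. by rewrite /lnabs norm_sinD. Qed.

Lemma lnabsN u : lnabs (- u) = lnabs u.
Proof. by rewrite /lnabs mulrN sinN normrN. Qed.

Lemma lnabsE u : 0 < u < 1 -> lnabs u = lnsin u.
Proof. by move=> /sin_gt0_cycle h; rewrite /lnabs gtr0_norm. Qed.

Lemma sub_neighbours K r s Psi : subaction q K r s Psi -> r <= s ->
  (forall x, 0 < x < r ->
     Psi (Q^-1 - x) - lnsin (Q^-1 - x) < Psi (- x) - lnsin x) /\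
  (forall y, 0 < y < s -> Psi (y - Q^-1) - lnsin (Q^-1 - y) < Psi y - lnsin y).
Proof.
move=> sub rs; have [q3|q2] := leqP 3 q; first exact: neighbours_ge3 sub rs q3.
have e : q = 2%N by lia.
by move: sub hq; rewrite e => sub _; exact: neighbours2 sub rs.
Qed.

Lemma sub_far K r s Psi : subaction q K r s Psi -> r <= s -> (3 <= q)%N ->
  forall y d, 0 < y -> y <= s -> Q^-1 <= d -> d <= 1 - 2 * Q^-1 ->
  Psi (y + d) - lnsin (y + d) < Psi y - lnsin y.
Proof.
move=> sub rs q3; have r0 := sub_r0 sub; have e := sub_rs sub.
have [q4|q3'] := leqP 4 q.
  apply: (far_right hq sub rs q3 (incr_ge4 hq sub rs q4)).
  have rat := ratio_le hq sub rs.
  have [q5|q4'] := leqP 5 q; first exact: gap5.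
  by have {}q4' : q = 4%N by [lia]; move: e rat; rewrite q4'; exact: gap4.
have {}q3' : q = 3%N by lia.
have sub3 := sub; rewrite q3' in sub3.
move: hq q3 e; rewrite q3' => h3 q3 e.
apply: (far_right h3 sub3 rs q3 _ (gap3 r0 rs e)) => x d d1 d2.
have -> : d = (3%:R)^-1 by lra.
by have := sub_increment_le h3 sub3 x (_ : 0 <= 3^-1 <= 1) => /(_ (ltac:(lin))).
Qed.

(** The excluded pairs are the tie: -r + 1/q = s, and s + (q - 1)/q = -r + 1. At y = 0 [lnabs] has
    the conventional value ln 0 = 0; on that fibre f_c is -oo off the arc. *)
Lemma sub_translate_le K r s Psi y (k : nat) : subaction q K r s Psi -> r <= s ->
  - r <= y <= s -> y != 0 -> (0 < k < q)%N -> (y = - r -> k <> 1%N) -> (y = s -> k <> q.-1) ->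
  Psi (y + k%:R / Q) - lnabs (y + k%:R / Q) < Psi y - lnabs y.
Proof.
move=> sub rs /andP[ry ys] y0 /andP[k0 kq] yr yS.
have kcase : (k <= q - 2)%N /\ (3 <= q)%N \/ k = (q - 1)%N by lia.
have kq1' : (k <= q - 1)%N by lia.
have hq1 : (1 <= q)%N by lia.
have r0 := sub_r0 sub; have s0 := sub_s0 sub; have e := sub_rs sub; have q2 := Q2; have qi := Qi.
have [n1 n2] := sub_neighbours sub rs.
have per x : Psi (x + 1) = Psi x by exact: sub_per sub x.
have per' x : Psi (x - 1) = Psi x by rewrite -[LHS](sub_per sub) subrK.
have lper x : lnabs (x + 1) = lnabs x by exact: (lnabsD x 1).
have lper' x : lnabs (x - 1) = lnabs x by rewrite -[LHS]lper subrK.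
have kQ n : (n <= k)%N -> n%:R / Q <= k%:R / Q.
  by move=> nk; rewrite ler_pM2r ?ler_nat//; lra.
have kQ' n : (k <= n)%N -> k%:R / Q <= n%:R / Q.
  by move=> nk; rewrite ler_pM2r ?ler_nat//; lra.
have eq1 : (q - 1)%:R / Q = 1 - Q^-1 by rewrite natrB ?mulrBl ?divff ?mul1r//; lra.
have eq2 : (q - 2)%:R / Q = 1 - 2 * Q^-1 by rewrite natrB ?mulrBl ?divff//; lra.
have [yp|yn] := ltP 0 y.
  case: kcase => [[kq2 q3]|ek].
    have d1 := kQ 1%N k0; have d2 := kQ' _ kq2; rewrite eq2 mul1r in d1 d2.
    have := sub_far sub rs q3 yp ys d1 d2.
    by rewrite -!lnabsE; lra.
  have {}ys : y < s.
    by rewrite lt_neqAle ys andbT; apply/eqP => h; apply: (yS h); rewrite ek subn1.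
  rewrite ek eq1 addrCA [y + _]addrC.
  have -> : 1 + (- Q^-1 + y) = y - Q^-1 + 1 by ring.
  rewrite per lper -[y - Q^-1]opprB lnabsN opprB !lnabsE; [|lra..].
  by apply: n2; lra.
have {y0 yn} [x x0 ey] : exists2 x, 0 < x & y = - x.
  by exists (- y); rewrite ?opprK// oppr_gt0 lt_neqAle y0.
subst y; rewrite lnabsN.
have [k1|k2] := leqP k 1.
  have {k1} ek : k = 1%N by apply/eqP; rewrite eqn_leq k1.
  have xr : x < r.
    by rewrite lt_neqAle -lerN2 ry andbT; apply/eqP => h; apply: (yr _ ek); rewrite h.
  by rewrite ek mul1r (addrC (- x)) !lnabsE; [apply: n1; lra|lra..].
have q3 : (3 <= q)%N by exact: leq_ltn_trans k2 kq.
have d1 := kQ 2%N k2; have d2 : k%:R / Q <= (q - 1)%:R / Q by exact: kQ'.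
rewrite eq1 in d2.
(* For y = -x, translating by k/q is, modulo 1, translating by -(1 - k/q). *)
have := far_left hq sub rs q3 (sub_far sub rs q3) (d := 1 - k%:R / Q) x0 (ltac:(lra)) (ltac:(lra)) (ltac:(lra)).
have -> : - x - (1 - k%:R / Q) = - x + k%:R / Q - 1 by ring.
rewrite per' -!lnabsE; [|lra..].
have -> : x + (1 - k%:R / Q) = - (- x + k%:R / Q - 1) by ring.
by rewrite lnabsN lper'.
Qed.

Lemma norm_dirD u (m : int) : `|dir q (pi * (u + m%:~R))| = `|dir q (pi * u)|.
Proof.
have := dir_sin q (pi * u); have := dir_sin q (pi * (u + m%:~R)).
have [s0|s0] := eqVneq (sin (pi * u)) 0.
  by rewrite !norm_dir_sin0//; apply/eqP; rewrite -normr_eq0 norm_sinD s0 normr0.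
move=> h1 h2; apply: (@mulIf _ `|sin (pi * u)|); first by rewrite normr_eq0.
rewrite -[in LHS](norm_sinD u m) -!normrM h1 h2.
have -> : Q * (pi * (u + m%:~R)) = pi * (Q * u + (q%:Z * m)%:~R) by rewrite intrM; ring.
by rewrite norm_sinD mulrCA.
Qed.

Lemma flogD u (m : int) : f (u + m%:~R) = f u.
Proof. by rewrite /flog norm_dirD. Qed.

Lemma flog_lnabs u : sin (pi * u) != 0 -> dir q (pi * u) != 0 -> f u = lnabs (Q * u) - lnabs u.
Proof.
move=> s0 d0; rewrite /lnabs mulrCA -dir_sin normrM lnM ?posrE ?normr_gt0//.
by rewrite addrK.
Qed.

Section arc.
Variables (K r s : R) (Psi : R -> R).
Hypothesis sub : subaction q K r s Psi.

Lemma sub_arcE u : frac (u + r) <= Q^-1 ->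
  f u + Psi u - Psi (Q * u + K) = f (- r) + Psi (- r).
Proof.
move=> h; have := floor_frac (u + r); have /andP[v0 _] := frac_itv (u + r).
move: h v0; move: (frac _) (Num.floor _) => v m h v0 eu.
have {eu} -> : u = - r + v + m%:~R by lra.
have q2 := Q2; have q0 : Q != 0 by rewrite gt_eqF//; lra.
have := sub_eq sub (t := Q * v); rewrite (mulrC Q v) mulfK// => /(_ _) e.
have -> : Q * (- r + v + m%:~R) + K = Q * - r + K + v * Q + (q%:Z * m)%:~R.
  by rewrite intrM; ring.
rewrite flogD !(sub_perz sub) e; first ring.
by rewrite -ler_pdivlMr ?mulr_ge0//; lra.
Qed.

(** Writing frac (u + r) = k/q + w/q with 0 < k < q puts u on the fibre of the point y = -r + w/q of
    the arc. The terms lnabs (Q u) in f and Psi (Q u + K) are common to the fibre, which leaves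
    [sub_translate_le]. *)
Lemma sub_arc_lt_of_le u : r <= s -> dir q (pi * u) != 0 -> Q^-1 < frac (u + r) ->
  f u + Psi u - Psi (Q * u + K) < f (- r) + Psi (- r).
Proof.
move=> rs d0 h; have := floor_frac (u + r); have /andP[v0 v1] := frac_itv (u + r).
have r0 := sub_r0 sub; have s0 := sub_s0 sub; have e := sub_rs sub; have q2 := Q2; have qi := Qi.
move: h v0 v1; move: (frac _) (Num.floor _) => v m h v0 v1 eu.
have Qv : 1 < Q * v by rewrite mulrC -ltr_pdivrMr ?div1r//; lra.
have Qv' : Q * v < Q by rewrite gtr_pMr//; lra.
have := floor_frac (Q * v); have := frac_itv (Q * v).
have : 1 <= Num.floor (Q * v) by rewrite floor_ge_int ltW.
case: (Num.floor _) => // k k1; move: (frac _) => w w01 ev; rewrite -pmulrn in ev.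
have kq : (0 < k < q)%N.
  apply/andP; split; first exact: k1.
  by rewrite -(ltr_nat R); lra.
pose y := - r + w / Q.
have w0 : 0 <= w / Q by rewrite mulr_ge0//; lra.
have w1 : w / Q < Q^-1 by rewrite gtr_pMl; lra.
have ev' : v = k%:R / Q + w / Q by rewrite -mulrDl -ev mulrC mulKf// gt_eqF//; lra.
have euy : u = y + k%:R / Q + m%:~R by rewrite /y; lra.
have su : sin (pi * u) != 0.
  rewrite -normr_eq0 euy norm_sinD normr_eq0 gt_eqF//; apply: sin_gt0_cycle.
  by rewrite /y; lra.
have eQ : Q * u = Q * y + (k%:Z + q%:Z * m)%:~R.
  by rewrite euy intrD intrM; field; lra.
have lQ : lnabs (Q * u) = lnabs (Q * y) by rewrite eQ lnabsD.
have sQy : sin (pi * (Q * y)) != 0.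
  rewrite -normr_eq0 -(norm_sinD _ (k%:Z + q%:Z * m)) -eQ normr_eq0 mulrCA -dir_sin.
  by rewrite mulf_neq0.
have y0 : y != 0 by apply: contraNneq sQy => ->; rewrite !mulr0 sin0.
have hy : frac (y + r) <= Q^-1.
  by rewrite /y addrAC addNr add0r frac_id//; lra.
rewrite -(sub_arcE hy).
have sy : sin (pi * y) != 0 /\ dir q (pi * y) != 0.
  move: sQy; rewrite mulrCA -dir_sin mulf_eq0 negb_or => /andP[]//.
have [sy1 sy2] := sy.
rewrite !flog_lnabs// lQ.
have -> : Psi (Q * u + K) = Psi (Q * y + K).
  by rewrite eQ addrAC (sub_perz sub).
have := @sub_translate_le K r s Psi y k sub rs (ltac:(rewrite /y; lra)) y0 kq.
have -> : Psi u = Psi (y + k%:R / Q) by rewrite euy (sub_perz sub).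
have -> : lnabs u = lnabs (y + k%:R / Q) by rewrite euy lnabsD.
move=> H; have {H} : Psi (y + k%:R / Q) - lnabs (y + k%:R / Q) < Psi y - lnabs y.
  apply: H.
    move=> yr k1'; move: h; rewrite ev' k1' mul1r.
    have -> : w / Q = 0 by move: yr; rewrite /y; lra.
    by rewrite addr0 ltxx.
  by rewrite /y => ys; exfalso; lra.
move: (Psi _) (Psi y) (Psi _) (lnabs _) (lnabs y) (lnabs _) => *; lra.
Qed.

End arc.

Lemma sub_arc_lt K r s Psi u : subaction q K r s Psi ->
  dir q (pi * u) != 0 -> Q^-1 < frac (u + r) ->
  f u + Psi u - Psi (Q * u + K) < f (- r) + Psi (- r).
Proof.
move=> sub d0 h; have [rs|/ltW sr] := leP r s; first exact: (sub_arc_lt_of_le sub rs).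
have qi := Qi; have e := sub_rs sub.
have hd : dir q (pi * - u) != 0 by rewrite mulrN dirN.
have hf : Q^-1 < frac (- u + s).
  have h1 := floor_frac (u + r); have h2 := frac_itv (u + r).
  have [_ ->] := @fracP R (- u + s) (- Num.floor (u + r) - 1) (Q^-1 - frac (u + r) + 1)
    (ltac:(lra)) (ltac:(rewrite intrD intrN; lra)).
  by lra.
have := sub_arc_lt_of_le (subaction_opp hq sub) sr hd hf.
by rewrite !flogN opprD !opprK mulrN opprK (sub_tie sub) flogN.
Qed.

(** With r = [r_min] the ratio sin π(1/q - r) / sin πr is at least 26/π, which exceeds e^2. *)
Definition r_min : R := (14 * Q)^-1.

Definition sub_lip : R := slope q (Q^-1 - r_min) / (Q - 1).

Lemma r_min_gap : 2 < lnsin (Q^-1 - r_min) - lnsin r_min.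
Proof.
have q2 := Q2; have qi := Qi; have p0 := @pi_gt0 R; have pl := @pi_le R.
have er : r_min = Q^-1 / 14 by rewrite /r_min; field; lra.
have sr : 0 < sin (pi * r_min) by apply: sin_gt0_cycle; lra.
have ss : 0 < sin (pi * (Q^-1 - r_min)) by apply: sin_gt0_cycle; lra.
rewrite /lnsin -ln_div ?posrE// -[2]expRK ltr_ln ?posrE ?expR_gt0 ?divr_gt0//.
rewrite ltr_pdivlMr//.
have e2 : expR 2 <= 193 / 25 :> R.
  have h : expR 2^-1 <= 5 / 3 :> R by apply: expR_le; lra.
  have -> : 2 = 2^-1 + 2^-1 + (2^-1 + 2^-1) :> R by field.
  rewrite !expRD; move: (expR _) h (expR_gt0 (2^-1 : R)) => E h E0.
  have : E * E <= 25 / 9 by nra.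
  have : 0 < E * E by rewrite mulr_gt0.
  by move: (E * E) => F; nra.
have h1 : sin (pi * r_min) <= pi * r_min by apply/ltW/sin_lt_id; rewrite mulr_gt0//; lra.
have h2 : 2 * (Q^-1 - r_min) <= sin (pi * (Q^-1 - r_min)).
  have := @sinc_le R (pi * (Q^-1 - r_min)) (pi / 2).
  rewrite sin_pihalf mulr1 => H.
  have {H} : pi * (Q^-1 - r_min) <= pi / 2 * sin (pi * (Q^-1 - r_min)).
    by apply: H; [rewrite mulr_gt0//; lra|rewrite ler_pM2l//; lra|lra].
  by rewrite -mulrA ler_pM2l//; move: (sin _) => S; lra.
move: h2; rewrite er; move: h1; rewrite er; move: (sin _) (sin _) => S S'.
move: (Q^-1) qi => k /andP[k0 _] h1 h2.
have h : S' <= 23 / 100 * k.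
  apply: le_trans h1 _; have : pi * k <= 637 / 200 * k by rewrite ler_pM2r.
  by rewrite mulrA; move: (pi * k) => z; lra.
apply: (@le_lt_trans _ _ (193 / 25 * (23 / 100 * k))); last lra.
apply: (@le_trans _ _ (expR 2 * (23 / 100 * k))); first by rewrite ler_pM2l// expR_gt0.
by rewrite ler_wpM2r//; lra.
Qed.

(** At the two ends of the range of a the log-sine difference has opposite signs and size above 2,
    while the adverse increment of the limit over the arc is at most 2 ([small]). So [period_incr]
    changes sign. The range does not involve K, and neither does the final Lipschitz constant. *)
Lemma exists_subaction K : exists r s Psi, subaction q K r s Psi /\
  forall x y, x <= y -> `|Psi y - Psi x| <= sub_lip * (y - x).
Proof.
have q2 := Q2; have qi := Qi.
have er : r_min = Q^-1 / 14 by rewrite /r_min; field; lra.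
pose L := slope q (Q^-1 - r_min).
have L0 : 0 <= L by apply: slope_ge0 => //; lra.
have gap := r_min_gap.
have bs lo hi : - Q^-1 < lo -> lo <= hi -> hi < Q^-1 ->
    bounded_slope (- slope q hi) (slope q (- lo)) lo hi f.
  move=> h1 h2 h3 x y lx xy yh.
  have := @flog_incr_le R q hq x y (ltac:(lra)) xy (ltac:(lra)).
  have := @flog_incr_ge R q hq x y (ltac:(lra)) xy (ltac:(lra)).
  have := @slope_le R q hq lo x (ltac:(lra)) lx (ltac:(lra)).
  have := @slope_le R q hq y hi (ltac:(lra)) yh (ltac:(lra)).
  rewrite slopeN//; last by rewrite ltr_norml; lra.
  move: (slope q hi) (slope q y) (slope q x) (slope q lo) (f y - f x) => a b c d e ba dc eb ce.
  have h : 0 <= y - x by rewrite subr_ge0.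
  have := ler_wpM2r h ba; have := ler_wpM2r h dc; lra.
pose a0 := - (Q^-1 - r_min); pose a1 := - r_min.
have lipf : bounded_slope (- L) L a0 (a1 + Q^-1) f.
  have -> : a1 + Q^-1 = Q^-1 - r_min by rewrite /a1; ring.
  have := bs a0 (Q^-1 - r_min) (ltac:(rewrite /a0; lra)) (ltac:(rewrite /a0; lra)) (ltac:(lra)).
  by have -> : - a0 = Q^-1 - r_min by rewrite /a0 opprK.
have ends r s : 0 < r -> 0 < s -> r + s = Q^-1 -> f s - f (- r) = lnsin r - lnsin s.
  move=> r0 s0 e; rewrite flogN// !flogE//; [|lra..].
  have -> : pi * (Q * s) = - (pi * (Q * r)) + pi.
    have -> : s = Q^-1 - r by lra.
    by field; lra.
  by rewrite sinDpi sinN opprK /lnsin; ring.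
have hl a : a0 <= a -> a <= a1 -> lip Q f L a.
  by move=> h1 h2 x y ax xy ya; apply: lipf; lra.
have sl a : a0 <= a -> a <= a1 -> forall x y, x <= y ->
   - (slope q (a + Q^-1) / (Q - 1)) * (y - x) <=
     branch_limit Q K f L a y - branch_limit Q K f L a x <= slope q (- a) / (Q - 1) * (y - x).
  move=> h1 h2; apply: bounded_slope_branch_limit => //; rewrite ?/a0 ?/a1 in h1 h2.
  - exact: hl.
  - by apply: slope_ge0 => //; lra.
  - by apply: slope_ge0 => //; lra.
  - by apply: bs; lra.
have small : slope q r_min / (Q - 1) * Q^-1 <= 2.
  have := @slope_half_le R q hq r_min (ltac:(lra)) (ltac:(lra)).
  rewrite ler_pdivrMr; last lra.
  rewrite ler_pdivrMr; last lra.
  move: (slope _ _) => S; nra.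
have tie0 a : a0 <= a -> a <= a1 -> period_incr Q K f L a =
    lnsin (- a) - lnsin (a + Q^-1) +
    (branch_limit Q K f L a (a + Q^-1) - branch_limit Q K f L a a).
  move=> h1 h2; rewrite period_incrE//; last exact: hl.
  have := ends (- a) (a + Q^-1); rewrite opprK /a0 /a1 in h1 h2 * => H.
  have := H (ltac:(lra)) (ltac:(lra)) (ltac:(lra)); lra.
have [||||||a /andP[ha0 ha1] ea] := @exists_period_incr0 R Q K f Q2 L L0 a0 a1.
- by rewrite /a0; lra.
- by rewrite /a1; lra.
- exact: lipf.
- by rewrite /a0 /a1; lra.
- rewrite tie0 ?lexx//; last by rewrite /a0 /a1; lra.
  have := sl a0 (lexx _) (ltac:(rewrite /a0 /a1; lra)) a0 (a0 + Q^-1) (ltac:(lra)).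
  have -> : a0 + Q^-1 = r_min by rewrite /a0; ring.
  have -> : r_min - a0 = Q^-1 by rewrite /a0; ring.
  have -> : - a0 = Q^-1 - r_min by rewrite /a0; ring.
  move: (branch_limit _ _ _ _ _ _) (branch_limit _ _ _ _ _ _) => A B /andP[h _].
  rewrite mulNr in h; lra.
- rewrite tie0 ?lexx//; last by rewrite /a0 /a1; lra.
  have := sl a1 (ltac:(rewrite /a0 /a1; lra)) (lexx _) a1 (a1 + Q^-1) (ltac:(lra)).
  have -> : a1 + Q^-1 - a1 = Q^-1 by ring.
  have -> : a1 + Q^-1 = Q^-1 - r_min by rewrite /a1; ring.
  have -> : - a1 = r_min by rewrite /a1; ring.
  move: (branch_limit _ _ _ _ _ _) (branch_limit _ _ _ _ _ _) => A B /andP[_ h].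
  lra.
have la := hl a ha0 ha1; have sla := sl a ha0 ha1.
rewrite /a0 /a1 in ha0 ha1.
exists (- a), (a + Q^-1), (branch_limit Q K f L a); split.
  split; rewrite ?opprK; [lra|lra|ring| | | |].
  - by move=> x; rewrite branch_limitD1// -/(period_incr Q K f L a) ea addr0.
  - by move=> t t01; rewrite branch_limitE.
  - by move: ea; rewrite period_incrE//; lra.
  - exact: sla.
move=> x y xy; have := sla x y xy.
have l1 := @slope_le R q hq (- a) (Q^-1 - r_min) (ltac:(lra)) (ltac:(lra)) (ltac:(lra)).
have l2 := @slope_le R q hq (a + Q^-1) (Q^-1 - r_min) (ltac:(lra)) (ltac:(lra)) (ltac:(lra)).
have q1 : 0 <= (Q - 1)^-1 by rewrite invr_ge0; lra.
have := ler_wpM2r q1 l1; have := ler_wpM2r q1 l2; rewrite -/sub_lip.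
move: (slope q (- a) / _) (slope q (a + Q^-1) / _) sub_lip (branch_limit _ _ _ _ _ y - _) => A B C D.
have h : 0 <= y - x by rewrite subr_ge0.
move=> AC BC; have := ler_wpM2r h AC; have := ler_wpM2r h BC.
rewrite ler_norml; lra.
Qed.

End pre_sturmian.

(** * From sub-actions to maximizing measures *)

Section calibration.
Context {R : realType} (q : nat).
Hypothesis hq : (2 <= q)%N.
Implicit Types (c x y a b : R) (psi : R -> R).

Local Notation Q := (q%:R : R).

(** The value ln q of the extension is that of [dir], since |dir| = q where sin π(x + c) vanishes;
    -oo is taken exactly at the zeros of [dir]. *)
Lemma fcE c x : fc q c x =
  if dir q (pi * (x + c)) == 0 then -oo%E else (flog q (x + c))%:E.
Proof.
have q2 : 2 <= Q by rewrite ler_nat.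
rewrite /fc /flog; have := dir_sin q (pi * (x + c)); rewrite mulrCA mulrA => h.
case: ifPn => [/eqP s0|s0].
  have d := norm_dir_sin0 q s0; rewrite d ifF//.
  by apply/negP => /eqP d0; move: d; rewrite d0 normr0; lra.
by rewrite -h mulf_eq0 (negPf s0) orbF mulfK.
Qed.

(* psi is a calibrated sub-action for f_c with maximum b, and the arc starting at a is
   exactly the set on which the sub-action inequality is an equality. *)
Record calibrated c psi b a : Prop := Calibrated {
  cal_per : forall x (m : int), psi (x + m%:~R) = psi x;
  cal_lip : forall x y, x <= y -> `|psi y - psi x| <= sub_lip q * (y - x);
  cal_eq : forall x, frac (x - a) <= Q^-1 -> fc q c x = (b + psi (Q * x) - psi x)%:E;
  cal_lt : forall x, Q^-1 < frac (x - a) -> (fc q c x < (b + psi (Q * x) - psi x)%:E)%E }.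

Lemma exists_calibrated c : exists psi b a, calibrated c psi b a.
Proof.
have q2 : 2 <= Q by rewrite ler_nat.
(* In u = x + c the map x ↦ q x becomes u ↦ q u + (c - q c). *)
have [r [s [Psi [sub lip]]]] := exists_subaction hq (c - Q * c).
exists (fun x => Psi (x + c)), (flog q (- r) + Psi (- r)), (- r - c).
have eK x : Q * (x + c) + (c - Q * c) = Q * x + c by ring.
have ea x : x - (- r - c) = x + c + r by ring.
split=> [x m|x y xy|x|x].
- by rewrite addrAC (sub_perz sub).
- by have := lip (x + c) (y + c); rewrite lerD2r => /(_ xy); rewrite opprD addrACA subrr addr0.
- rewrite ea => h; have := sub_arcE hq sub h; rewrite eK fcE => e.
  rewrite ifF; first by congr EFin; lra.
  (* The arc lies inside the open main lobe, where [dir] is positive. *)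
  apply/negP => /eqP d0; have r0 := sub_r0 sub; have s0 := sub_s0 sub; have rs := sub_rs sub.
  have := floor_frac (x + c + r); have /andP[v0 _] := frac_itv (x + c + r).
  move: h v0; move: (frac _) (Num.floor _) => v m h v0 eu.
  have := @dir_lobe_gt0 _ _ hq (- r + v) (ltac:(rewrite ltr_norml; lra)).
  have -> : - r + v = x + c - m%:~R by lra.
  have := norm_dirD q (x + c - m%:~R) m; rewrite subrK d0 normr0 => /esym/eqP.
  by rewrite normr_eq0 => /eqP ->; rewrite ltxx.
- rewrite ea => h; rewrite fcE; case: ifPn => [_|d0]; first exact: ltNyr.
  by have := sub_arc_lt hq sub d0 h; rewrite eK lte_fin; lra.
Qed.

Lemma sub_lip_ge0 : 0 <= sub_lip q :> R.
Proof.
have [r [s [Psi [_ lip]]]] := exists_subaction hq (0 : R).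
have := lip 0 1 ler01; rewrite subr0 mulr1; apply: le_trans; exact: normr_ge0.
Qed.

Lemma cal_bound c psi b a x y : calibrated c psi b a -> `|psi y - psi x| <= sub_lip q.
Proof.
move=> cal; have fr z : psi z = psi (frac z).
  by rewrite {1}(floor_frac z) addrC (cal_per cal).
wlog xy : x y / frac x <= frac y.
  have [xy|/ltW yx] := leP (frac x) (frac y); first exact.
  by move=> H; rewrite distrC; apply: H.
rewrite fr [psi x]fr; apply: le_trans (cal_lip cal xy) _.
rewrite ler_piMr ?sub_lip_ge0//; have := frac_itv x; have := frac_itv y; lra.
Qed.

Lemma cal_le c psi b a x : calibrated c psi b a ->
  (fc q c x <= (b + psi (Q * x) - psi x)%:E)%E.
Proof.
move=> cal; have [h|h] := leP (frac (x - a)) Q^-1; first by rewrite (cal_eq cal).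
exact/ltW/(cal_lt cal).
Qed.

(** The sum telescopes, and by periodicity psi oscillates by at most its Lipschitz constant, which
    does not involve c. *)
Lemma cal_sum_le c psi b a x n : calibrated c psi b a ->
  (\sum_(0 <= i < n) fc q c (Q ^+ i * x) <= (n%:R * b + sub_lip q)%:E)%E.
Proof.
move=> cal; apply: (@le_trans _ _ (\sum_(0 <= i < n) (b + psi (Q ^+ i.+1 * x) - psi (Q ^+ i * x))%:E)).
  by apply: lee_sum => i _; rewrite exprS -mulrA; exact: cal_le cal.
rewrite sumEFin lee_fin.
have -> : \sum_(0 <= i < n) (b + psi (Q ^+ i.+1 * x) - psi (Q ^+ i * x)) =
    n%:R * b + (psi (Q ^+ n * x) - psi x).
  elim: n => [|n IH]; first by rewrite big_nil expr0 mul1r mul0r subrr addr0.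
  by rewrite big_nat_recr//= IH -natr1; ring.
by rewrite lerD2l (le_trans (ler_norm _))// (cal_bound _ _ cal).
Qed.

(** A Lipschitz function becomes monotone once a steep linear function is added. *)
Lemma nondecreasing_measurable_shift (g : R -> R) (L : R) :
  (forall x y, x <= y -> `|g y - g x| <= L * (y - x)) -> measurable_fun setT g.
Proof.
move=> hg; have -> : g = (fun x => (g x + L * x) - L * x) by apply/funext => x; ring.
apply: measurable_funB; last exact: measurable_funM.
apply: nondecreasing_measurable => // x y xy.
by have := hg _ _ xy; rewrite ler_norml; lra.
Qed.

Lemma measurable_frac : measurable_fun setT (@frac R).
Proof.
apply: measurable_funB => //; apply: nondecreasing_measurable => // x y xy.
by rewrite ler_int le_floor.
Qed.

Lemma measurable_frac_shift a : measurable_fun setT (fun x : R => frac (x - a)).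
Proof. by apply: (measurableT_comp measurable_frac); exact: measurable_funB. Qed.

Lemma measurable_Tmap : measurable_fun setT (@Tmap R q).
Proof. by apply: (measurableT_comp measurable_frac); exact: measurable_funM. Qed.

Lemma measurable_arc a : measurable (arc q a).
Proof.
rewrite /arc; have := measurable_frac_shift a measurableT (measurable_itv `]-oo, Q^-1]).
rewrite setTI; congr measurable.
Qed.

Lemma measurable_dir n : measurable_fun setT (@dir R n).
Proof.
elim: n => [|n IH]; first exact: measurable_cst.
apply: measurable_funD; last first.
  apply: (measurableT_comp (f := cos)); last exact: measurable_funM.
  by apply: continuous_measurable_fun; exact: continuous_cos.
apply: measurable_funM => //.
by apply: continuous_measurable_fun; exact: continuous_cos.
Qed.

Lemma measurable_fc c : measurable_fun setT (fc q c).
Proof.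
have -> : fc q c = fun x => if dir q (pi * (x + c)) == 0 then -oo%E else (flog q (x + c))%:E.
  by apply/funext => x; exact: fcE.
have md : measurable_fun setT (fun x : R => dir q (pi * (x + c))).
  apply: (measurableT_comp (measurable_dir q)); apply: measurable_funM => //.
  exact: measurable_funD.
apply: measurable_fun_ifT => //; first exact: measurable_fun_eqr.
apply/measurable_EFinP; apply: (measurableT_comp (@measurable_ln R)).
exact: measurableT_comp.
Qed.

Section invariant.
Variable mu : probability R R.
Hypothesis inv : Tinvariant q mu.

Lemma integral_cst_prob (r : R) : (\int[mu]_x r%:E = r%:E)%E.
Proof.
rewrite integral_cst//; have h : mu setT = 1%E := probability_setT mu.
by transitivity (r%:E * 1)%E; [congr (_ * _)%E|rewrite mule1].
Qed.

Lemma integrable_bounded (g : R -> R) (M : R) : measurable_fun setT g ->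
  (forall x, `|g x| <= M) -> mu.-integrable setT (EFin \o g).
Proof.
move=> mg hM; apply: measurable_bounded_integrable => //.
  by rewrite -ge0_fin_numE// fin_num_measure.
by exists M; split => [|N MN x _ /=]; [exact: num_real|exact: le_trans (hM x) (ltW MN)].
Qed.

Lemma Tinvariant_integral (g : R -> R) (M : R) : measurable_fun setT g ->
  (forall x, `|g x| <= M) ->
  (\int[mu]_x (g (Tmap q x))%:E = \int[mu]_x (g x)%:E)%E.
Proof.
move=> mg hM; have mT := measurable_Tmap.
have i1 : mu.-integrable setT (EFin \o (g \o Tmap q)).
  by apply: (@integrable_bounded _ M); [exact: measurableT_comp|move=> x /=].
have := @integral_pushforward _ _ _ _ R _ mT mu setT (EFin \o g) _ _ measurableT.
rewrite preimage_setT => <-//; last exact/measurable_EFinP.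
by apply: eq_measure_integral => A mA _; rewrite /pushforward; case: inv => _ h; exact: h.
Qed.

Variables (c : R) (psi : R -> R) (b a : R).
Hypothesis cal : calibrated c psi b a.

Let G x := b + psi (Q * x) - psi x.

Let mpsi : measurable_fun setT psi.
Proof. exact: nondecreasing_measurable_shift (cal_lip cal). Qed.

Let mG : measurable_fun setT G.
Proof.
apply: measurable_funB => //; apply: measurable_funD => //.
by apply: (measurableT_comp mpsi); exact: measurable_funM.
Qed.

Let psi_bounded x : `|psi x| <= `|psi 0| + sub_lip q.
Proof.
have -> : psi x = psi 0 + (psi x - psi 0) by ring.
by rewrite (le_trans (ler_normD _ _))// lerD2l (cal_bound _ _ cal).
Qed.

Let G_integrable : mu.-integrable setT (EFin \o G).
Proof.
apply: (@integrable_bounded _ (`|b| + sub_lip q) mG) => x.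
have -> : G x = b + (psi (Q * x) - psi x) by rewrite /G; ring.
by rewrite (le_trans (ler_normD _ _))// lerD2l (cal_bound _ _ cal).
Qed.

(** Invariance of mu cancels the coboundary psi ∘ T - psi. *)
Let G_integral : (\int[mu]_x (G x)%:E = b%:E)%E.
Proof.
have ipsi := integrable_bounded mpsi psi_bounded.
have psiT x : psi (Q * x) = psi (Tmap q x).
  by rewrite /Tmap -[in RHS](cal_per cal _ (Num.floor (Q * x))) /frac subrK.
have ipsiT : mu.-integrable setT (EFin \o (fun x => psi (Q * x))).
  apply: integrable_bounded => [|x]; last exact: psi_bounded.
  by apply: (measurableT_comp mpsi); exact: measurable_funM.
have -> : (fun x => (G x)%:E) = (fun x => (b%:E + ((psi (Q * x))%:E - (psi x)%:E))%E).
  by apply/funext => x; rewrite /G -EFinB -EFinD addrA.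
rewrite integralD//=; last 2 first.
- exact: finite_measure_integrable_cst.
- exact: (integrableB _ ipsiT ipsi).
rewrite integralB_EFin// integral_cst_prob.
under eq_integral do rewrite psiT.
rewrite (Tinvariant_integral mpsi psi_bounded) subee ?adde0//.
exact: integrable_fin_num.
Qed.

Let fc_le_G x : (fc q c x <= (G x)%:E)%E.
Proof. exact: cal_le cal. Qed.

Let integral_fc_pos : (\int[mu]_x (fc q c)^\+ x < +oo)%E.
Proof.
apply: (@le_lt_trans _ _ (\int[mu]_x (cst (ln Q)%:E) x)%E); last first.
  by rewrite integral_cst_prob ltry.
apply: ge0_le_integral => //.
- by apply: measurable_funepos; exact: measurable_fc.
- move=> x _; rewrite funeposE ge_max lee_fin ln_ge0 ?ler1n ?(ltnW hq)// andbT fcE.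
  by case: ifP => _; [exact: leNye|rewrite /= lee_fin flog_le].
Qed.

Let integrable_fc : (\int[mu]_x (fc q c)^\- x < +oo)%E -> mu.-integrable setT (fc q c).
Proof.
move=> h; have mf := measurable_fc c; apply/integrableP; split=> //.
rewrite -[X in integral _ _ X]/(abse \o fc q c) fune_abse ge0_integralD//.
- by apply: lte_add_pinfty => //; exact: integral_fc_pos.
- exact: measurable_funepos.
- exact: measurable_funeneg.
Qed.

Lemma integral_fc_le : (\int[mu]_x fc q c x <= b%:E)%E.
Proof.
(* If the negative part has infinite integral, the integral is -oo. *)
have [h|h] := leP +oo%E (\int[mu]_x (fc q c)^\- x)%E.
  rewrite integralE; move: h; rewrite leye_eq => /eqP ->.
  by rewrite addeNy leNye.
rewrite -G_integral; apply: le_integral => //; exact: integrable_fc.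
Qed.

Lemma integral_fc_eq : mu (~` arc q a) = 0%E -> (\int[mu]_x fc q c x = b%:E)%E.
Proof.
move=> h; rewrite -G_integral; apply: ae_eq_integral => //.
- exact: measurable_fc.
- exact/measurable_EFinP.
exists (~` arc q a); split=> //; first by apply: measurableC; exact: measurable_arc.
by move=> x /= hx hA; apply: hx => _; exact: cal_eq cal _ hA.
Qed.

(** Finiteness of b first forces integrability; then G - f_c is nonnegative with zero integral,
    hence null almost everywhere, yet positive off the arc. *)
Lemma integral_fc_arc : (\int[mu]_x fc q c x = b%:E)%E -> mu (~` arc q a) = 0%E.
Proof.
move=> h; have if_ : mu.-integrable setT (fc q c).
  apply: integrable_fc; rewrite ltey; apply/eqP => e.
  by move: h; rewrite integralE e addeNy.
have mf := measurable_fc c.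
pose D x := ((G x)%:E - fc q c x)%E.
have D0 x : (0 <= D x)%E by rewrite /D sube_ge0 ?orbT//; exact: fc_le_G.
have mD : measurable_fun setT D.
  by apply: emeasurable_funB => //; exact/measurable_EFinP.
have iD : (\int[mu]_x `|D x| = 0)%E.
  under eq_integral do rewrite gee0_abs//.
  by rewrite (integralB measurableT G_integrable if_) G_integral h subee.
have [N [mN N0 hN]] := (ae_eq_integral_abs mu measurableT mD).1 iD.
apply: (subset_measure0 _ mN _ N0); first by apply: measurableC; exact: measurable_arc.
move=> x /= /negP; rewrite -ltNge => hx; apply: hN => /= /(_ I) /eqP.
by rewrite gt_eqF// /D sube_gt0; exact: cal_lt cal _ hx.
Qed.

End invariant.
End calibration.

(** * Uniqueness of the invariant measure on an arc *)

(** Integer bookkeeping for [cdf_lt_step]: n and n' are the digits of y and of the point x, k is the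
    smaller of the two possible digits, p says that x precedes y and s that the image of x precedes
    that of y. *)
Lemma carry_lt (n n' k : int) (p s : bool) : k <= n <= k + 1 -> k <= n' <= k + 1 ->
  (p -> s -> n <= n') -> (~~ p -> n <= n') -> (~~ p -> s -> n != n') ->
  s%:Z + (n - k) <= p%:Z + (n' == k + 1)%:Z.
Proof. by case: p; case: s => /=; case: eqP; lia. Qed.

Lemma carry_le (n n' k : int) (p s : bool) : k <= n <= k + 1 -> k <= n' <= k + 1 ->
  (p -> n' <= n) -> (p -> ~~ s -> n != n') -> (~~ p -> ~~ s -> n' <= n) ->
  p%:Z + (n' == k + 1)%:Z + (k - n) <= s%:Z.
Proof. by case: p; case: s => /=; case: eqP; lia. Qed.

Lemma carry_eq (n n' k : int) : k <= n' -> n <= k + 1 -> n' < n -> n' = k /\ n = k + 1.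
Proof. lia. Qed.

Section arc_uniqueness.
Context {R : realType} (q : nat) (g : R).
Hypothesis hq : (2 <= q)%N.

Local Notation Q := (q%:R : R).

Let Q2 : 2 <= Q. Proof. by rewrite ler_nat. Qed.

Let Qi : 0 < Q^-1 <= 2^-1.
Proof. by rewrite invr_gt0 lef_pV2 ?posrE//; have := Q2; lra. Qed.

(* The position of a point relative to the start g of the arc, in which the arc is [0, 1/q],
   and T composed with the retraction of [0, 1[ onto the arc: a map of degree one that
   lifts to a nondecreasing one. *)
Definition pos (x : R) : R := frac (x - g).

Definition lift_step (y : R) : R := Num.min (Q * y) 1 + (Q - 1) * g.

Definition digit (y : R) : int := Num.floor (lift_step y).

Definition arc_step (y : R) : R := frac (lift_step y).

Definition digit_sum (y : R) (k : nat) : int := \sum_(i < k) digit (iter i arc_step y).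

Lemma digit_sumS y k : digit_sum y k.+1 = digit_sum y k + digit (iter k arc_step y).
Proof. by rewrite /digit_sum big_ord_recr. Qed.

Lemma lift_stepE y : lift_step y = (digit y)%:~R + arc_step y.
Proof. exact: floor_frac. Qed.

Lemma arc_step_itv y : 0 <= arc_step y < 1. Proof. exact: frac_itv. Qed.

Lemma iter_arc_step_itv y k : 0 <= y < 1 -> 0 <= iter k arc_step y < 1.
Proof. by case: k => [//|k] _; exact: arc_step_itv. Qed.

Lemma pos_itv x : 0 <= pos x < 1. Proof. exact: frac_itv. Qed.

Lemma lift_step_itv y : 0 <= y -> (Q - 1) * g <= lift_step y <= (Q - 1) * g + 1.
Proof.
move=> y0; rewrite /lift_step lerDr le_min ler01 mulr_ge0 ?ler0n//=.
by rewrite addrC lerD2l ge_min lexx orbT.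
Qed.

Lemma lift_step_le x y : x <= y -> lift_step x <= lift_step y.
Proof.
move=> xy; rewrite /lift_step lerD2r le_min ge_min ler_wpM2l ?ler0n//=.
by rewrite ge_min lexx orbT.
Qed.

Lemma digit_le x y : x <= y -> digit x <= digit y.
Proof. by move=> xy; rewrite /digit le_floor// lift_step_le. Qed.

Lemma digit_itv y : 0 <= y ->
  Num.floor ((Q - 1) * g) <= digit y <= Num.floor ((Q - 1) * g) + 1.
Proof.
move=> y0; have /andP[h1 h2] := lift_step_itv y0.
rewrite /digit le_floor//=; apply: le_trans (le_floor h2) _.
by rewrite floorDrz ?floor1.
Qed.

Lemma pos_Tmap x : frac (x - g) <= Q^-1 -> pos (Tmap q x) = arc_step (pos x).
Proof.
move=> hx; rewrite /arc_step /lift_step /Tmap.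
have h : Q * pos x <= 1 by rewrite mulrC -ler_pdivlMr ?div1r//; have := Q2; lra.
rewrite (min_idPl h) /pos.
have e1 := floor_frac (x - g); have e2 := floor_frac (Q * x).
have e3 := floor_frac (Q * frac (x - g) + (Q - 1) * g).
have -> : frac (Q * x) - g = Q * frac (x - g) + (Q - 1) * g +
    (q%:Z * Num.floor (x - g) - Num.floor (Q * x))%:~R.
  by rewrite intrB intrM; move: e1 e2; rewrite /frac; lra.
by rewrite fracDz.
Qed.

Section one_measure.
Variable mu : probability R R.
Hypothesis inv : Tinvariant q mu.
Hypothesis arc1 : mu (~` arc q g) = 0%E.

Definition cdf_lt (t : R) : R := fine (mu [set x | pos x < t]).
Definition cdf_le (t : R) : R := fine (mu [set x | pos x <= t]).

Let carry := [set x | digit (pos x) == Num.floor ((Q - 1) * g) + 1].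

(** The mean of [digit] under mu, since by [digit_itv] a digit is floor ((Q - 1) g) or one more: the
    rotation number of the circle map [arc_step]. *)
Definition rotation : R := (Num.floor ((Q - 1) * g))%:~R + fine (mu carry).

Let measurable_pos_preimage (B : set R) : measurable B -> measurable [set x | B (pos x)].
Proof. by move=> mB; rewrite -[X in measurable X]setTI; exact: measurable_frac_shift. Qed.

Let measurable_pos_lt t : measurable [set x | pos x < t].
Proof.
have := measurable_pos_preimage (measurable_itv `]-oo, t[).
by congr measurable; apply/seteqP; split=> x /=; rewrite in_itv.
Qed.

Let measurable_pos_le t : measurable [set x | pos x <= t].
Proof.
have := measurable_pos_preimage (measurable_itv `]-oo, t]).
by congr measurable; apply/seteqP; split=> x /=; rewrite in_itv.
Qed.

Let measurable_carry : measurable carry.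
Proof.
have md : measurable_fun setT (fun y => (digit y)%:~R : R).
  by apply: nondecreasing_measurable => // x y xy; rewrite ler_int digit_le.
have := md measurableT _ (measurable_set1 (Num.floor ((Q - 1) * g) + 1)%:~R).
rewrite setTI => /measurable_pos_preimage; congr measurable.
by apply/seteqP; split=> x /=; [move/intr_inj/eqP|move/eqP ->].
Qed.

Let measurable_TmapI (S : set R) : measurable S -> measurable [set x | S (Tmap q x)].
Proof. by move=> mS; rewrite -[X in measurable X]setTI; exact: measurable_Tmap. Qed.

(** The pointwise inequality is available only on the arc. Elsewhere it fails by at most |d| + 2,
    which K times the indicator of the null complement absorbs. *)
Lemma probability_le_count (p1 p2 p3 p4 : R -> bool) (d : int) :
  measurable [set x | p1 x] -> measurable [set x | p2 x] ->
  measurable [set x | p3 x] -> measurable [set x | p4 x] ->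
  (forall x, arc q g x -> (p1 x)%:Z + (p2 x)%:Z + d <= (p3 x)%:Z + (p4 x)%:Z) ->
  fine (mu [set x | p1 x]) + fine (mu [set x | p2 x]) + d%:~R <=
  fine (mu [set x | p3 x]) + fine (mu [set x | p4 x]).
Proof.
move=> m1 m2 m3 m4 h; have mA := measurable_arc q g; have mN := measurableC mA.
pose K : R := `|d%:~R| + 2.
pose n : R -> R := \1_(~` arc q g).
have mind S : measurable S -> measurable_fun setT (\1_S : R -> R) by exact: measurable_indic.
have ind S : measurable S -> mu.-integrable setT (EFin \o (\1_S : R -> R)).
  move=> mS; apply: (@integrable_bounded _ _ _ 1) => [|x]; first exact: mind.
  by rewrite indicE; case: (_ \in _); rewrite ?normr1 ?normr0.
have eind S : measurable S -> (\int[mu]_x (\1_S x)%:E = (fine (mu S))%:E)%E.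
  by move=> mS; rewrite integral_indic// setIT fineK// fin_num_measure.
have mKn : measurable_fun setT (fun x => K * n x).
  by apply: measurable_funM => //; exact: mind.
have iKn : mu.-integrable setT (EFin \o (fun x => K * n x)).
  apply: (@integrable_bounded _ _ _ `|K|) => [//|x].
  by rewrite normrM /n indicE; case: (_ \in _); rewrite ?normr1 ?normr0 ?mulr1 ?mulr0.
have ic : mu.-integrable setT (EFin \o (fun=> d%:~R)).
  exact: (@integrable_bounded _ _ _ `|d%:~R|).
pose f1 x : R := \1_[set x | p1 x] x + \1_[set x | p2 x] x.
pose f2 x : R := \1_[set x | p3 x] x + \1_[set x | p4 x] x.
have i1 : mu.-integrable setT (EFin \o f1).
  by have := integrableD measurableT (ind _ m1) (ind _ m2); apply: eq_integrable.
have i2 : mu.-integrable setT (EFin \o f2).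
  by have := integrableD measurableT (ind _ m3) (ind _ m4); apply: eq_integrable.
have e1 : (\int[mu]_x (f1 x + d%:~R)%:E =
    (fine (mu [set x | p1 x]) + fine (mu [set x | p2 x]) + d%:~R)%:E)%E.
  rewrite (_ : (fun x => (f1 x + d%:~R)%:E) = (fun x => ((f1 x)%:E + (d%:~R)%:E))%E)//.
  rewrite integralD// integral_cst_prob (_ : (fun x => (f1 x)%:E) =
    (fun x => (\1_[set x | p1 x] x)%:E + (\1_[set x | p2 x] x)%:E)%E)//.
  by rewrite integralD ?ind// !eind.
have e2 : (\int[mu]_x (f2 x + K * n x)%:E =
    (fine (mu [set x | p3 x]) + fine (mu [set x | p4 x]))%:E)%E.
  rewrite (_ : (fun x => (f2 x + K * n x)%:E) = (fun x => ((f2 x)%:E + (K * n x)%:E))%E)//.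
  rewrite integralD// (_ : (\int[mu]_x (K * n x)%:E = 0)%E).
    rewrite adde0 (_ : (fun x => (f2 x)%:E) =
      (fun x => (\1_[set x | p3 x] x)%:E + (\1_[set x | p4 x] x)%:E)%E)//.
    by rewrite integralD ?ind// !eind.
  rewrite (_ : (fun x => (K * n x)%:E) = (fun x => K%:E * (n x)%:E)%E)//.
  by rewrite integralZl ?ind// eind// arc1 mule0.
rewrite -lee_fin -e1 -e2; apply: le_integral => //.
- by have := integrableD measurableT i1 ic; apply: eq_integrable.
- by have := integrableD measurableT i2 iKn; apply: eq_integrable.
- have eb (p : R -> bool) x : (x \in [set x | p x]) = p x.
    by apply/idP/idP; rewrite inE.
  move=> x _; rewrite lee_fin /f1 /f2 !indicE !eb.
  have [hx|hx] := pselect (arc q g x).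
    have := h x hx; rewrite -(ler_int R) !intrD => /le_trans; apply.
    by rewrite lerDl mulr_ge0// /K addr_ge0.
  rewrite /n indicE mem_set//= mulr1 /K.
  have := ler_norm (d%:~R : R).
  by case: (p1 x); case: (p2 x); case: (p3 x); case: (p4 x) => /=; lra.
Qed.

(** Monotonicity of the lift, integrated: if the lifted image of x precedes that of y, then x
    precedes y. The integer parts of the two lifts contribute [rotation] and [digit y]. *)
Lemma cdf_lt_step y : 0 <= y < 1 -> cdf_lt (arc_step y) + (digit y)%:~R <= cdf_lt y + rotation.
Proof.
move=> /andP[y0 y1]; case: inv => _ invA.
have -> : cdf_lt (arc_step y) = fine (mu [set x | pos (Tmap q x) < arc_step y]).
  by rewrite /cdf_lt -[in LHS]invA//; exact: measurable_pos_lt.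
set k0 := Num.floor ((Q - 1) * g).
have := @probability_le_count (fun x => pos (Tmap q x) < arc_step y) (fun=> false)
  (fun x => pos x < y) (fun x => digit (pos x) == k0 + 1) (digit y - k0).
rewrite (_ : [set _ | false] = set0); last by apply/seteqP; split.
rewrite measure0 addr0 -/k0 /rotation /cdf_lt -/carry intrB.
move=> H; suff : fine (mu [set x | pos (Tmap q x) < arc_step y]) + ((digit y)%:~R - k0%:~R) <=
   fine (mu [set x | pos x < y]) + fine (mu carry) by rewrite -/k0; lra.
apply: H => //; first exact: (measurable_TmapI (measurable_pos_lt _)).
move=> x hx; rewrite pos_Tmap// addr0; have [px0 px1] := andP (pos_itv x).
have h1 := lift_step_itv px0; have h2 := lift_step_itv y0.
have := @lift_step_le y (pos x); rewrite !lift_stepE in h1 h2 *.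
have [k1 k2] := andP (floor_itv ((Q - 1) * g)); rewrite -/k0 in k1 k2.
move=> mono; apply: carry_lt; [exact: digit_itv|exact: digit_itv|..].
(* All lifts lie in an interval of length one, so a carry of y without a carry of x puts the image
   of x at or after that of y. *)
- move=> pxy ss; rewrite leNgt; apply/negP => nn.
  have [/andP[d1 d2] /andP[d3 d4]] := (digit_itv px0, digit_itv y0); rewrite -/k0 in d1 d2 d3 d4.
  have [e1 e2] := carry_eq d1 d4 nn.
  by move: h1 h2 ss; rewrite e1 e2 intrD; lra.
- by rewrite -leNgt => /digit_le.
- rewrite -leNgt => /mono + ss; apply: contraTneq => ->; rewrite -ltNge; lra.
Qed.

Lemma cdf_le_step y : 0 <= y < 1 -> cdf_le y + rotation <= cdf_le (arc_step y) + (digit y)%:~R.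
Proof.
move=> /andP[y0 y1]; case: inv => _ invA.
have -> : cdf_le (arc_step y) = fine (mu [set x | pos (Tmap q x) <= arc_step y]).
  by rewrite /cdf_le -[in LHS]invA//; exact: measurable_pos_le.
set k0 := Num.floor ((Q - 1) * g).
have := @probability_le_count (fun x => pos x <= y) (fun x => digit (pos x) == k0 + 1)
  (fun x => pos (Tmap q x) <= arc_step y) (fun=> false) (k0 - digit y).
rewrite (_ : [set _ | false] = set0); last by apply/seteqP; split.
rewrite measure0 addr0 -/k0 /rotation /cdf_le -/carry intrB.
move=> H; suff : fine (mu [set x | pos x <= y]) + fine (mu carry) + (k0%:~R - (digit y)%:~R) <=
   fine (mu [set x | pos (Tmap q x) <= arc_step y]) by rewrite -/k0; lra.
apply: H => //; first exact: (measurable_TmapI (measurable_pos_le _)).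
move=> x hx; rewrite pos_Tmap// addr0; have [px0 px1] := andP (pos_itv x).
have h1 := lift_step_itv px0; have h2 := lift_step_itv y0.
have := @lift_step_le (pos x) y; rewrite !lift_stepE in h1 h2 *.
have [k1 k2] := andP (floor_itv ((Q - 1) * g)); rewrite -/k0 in k1 k2.
move=> mono; apply: carry_le; [exact: digit_itv|exact: digit_itv|..].
- exact: digit_le.
- move=> /mono + ss; apply: contraTneq => ->; rewrite -ltNge; move: ss; rewrite -ltNge; lra.
- rewrite -!ltNge => pxy ss; rewrite leNgt; apply/negP => nn.
  have [/andP[d1 d2] /andP[d3 d4]] := (digit_itv px0, digit_itv y0); rewrite -/k0 in d1 d2 d3 d4.
  have [e1 e2] := carry_eq d3 d2 nn.
  by move: h1 h2 ss; rewrite e1 e2 intrD; lra.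
Qed.

Lemma cdf_lt_iter y k : 0 <= y < 1 ->
  cdf_lt (iter k arc_step y) + (digit_sum y k)%:~R <= cdf_lt y + k%:R * rotation.
Proof.
move=> y01; elim: k => [|k IH]; first by rewrite /digit_sum big_ord0 mul0r.
have := cdf_lt_step (iter_arc_step_itv k y01).
by rewrite iterS digit_sumS intrD -natr1; lra.
Qed.

Lemma cdf_le_iter y k : 0 <= y < 1 ->
  cdf_le y + k%:R * rotation <= cdf_le (iter k arc_step y) + (digit_sum y k)%:~R.
Proof.
move=> y01; elim: k => [|k IH]; first by rewrite /digit_sum big_ord0 mul0r.
have := cdf_le_step (iter_arc_step_itv k y01).
by rewrite iterS digit_sumS intrD -natr1; lra.
Qed.

Lemma cdf_lt_ge0 t : 0 <= cdf_lt t. Proof. exact: fine_ge0. Qed.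

Lemma cdf_le_le1 t : cdf_le t <= 1.
Proof.
rewrite /cdf_le -lee_fin fineK ?fin_num_measure//; exact: probability_le1.
Qed.

Lemma cdf_lt_eq1 t : Q^-1 < t -> cdf_lt t = 1.
Proof.
move=> qt; have mA := measurable_arc q g; have mS := measurable_pos_lt t.
have h0 : mu (~` [set x | pos x < t]) = 0%E.
  apply: (subset_measure0 _ _ _ arc1); [exact: measurableC|exact: measurableC|].
  by move=> x /= ht hx; apply: ht; exact: le_lt_trans hx qt.
have := probability_setC mu (measurableC mS); rewrite setCK h0 sube0 /cdf_lt => h.
by transitivity (fine (1 : \bar R)); [congr fine|].
Qed.

Lemma cdf_lt_le1 t : cdf_lt t <= 1.
Proof. by rewrite /cdf_lt -lee_fin fineK ?fin_num_measure//; exact: probability_le1. Qed.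

Lemma cdf_lt_left t c : 0 < t -> (forall y, 0 <= y < t -> cdf_le y <= c) -> cdf_lt t <= c.
Proof.
move=> t0 h; pose y n : R := t - t / n.+1%:R.
pose F n := [set x | pos x <= y n].
have y01 n : 0 <= y n < t.
  rewrite /y subr_ge0 ltrBlDr ltrDl divr_gt0// andbT.
  by rewrite ler_pdivrMr// ler_peMr ?(ltW t0)// ler1n.
have ynd m n : (m <= n)%N -> y m <= y n.
  by move=> mn; rewrite /y lerD2l lerN2 ler_pM2l// lef_pV2 ?posrE// ler_nat.
have eF : \bigcup_n F n = [set x | pos x < t].
  apply/seteqP; split=> [x [n _ /= hx]|x /= hx].
    by apply: le_lt_trans hx _; have /andP[] := y01 n.
  have d0 : 0 < (t - pos x) / t by rewrite divr_gt0// subr_gt0.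
  exists (Num.bound ((t - pos x) / t)^-1) => //; rewrite /F /= /y.
  have := archi_boundP (ltW (_ : 0 < ((t - pos x) / t)^-1)).
  rewrite invr_gt0 => /(_ d0); move: (Num.bound _) => N hN.
  rewrite lerBrDl -lerBrDr ler_pdivrMr//.
  have hN' : ((t - pos x) / t)^-1 <= N.+1%:R by rewrite -natr1; lra.
  move: hN'; rewrite invf_div ler_pdivrMr ?subr_gt0// => hN'.
  by rewrite mulrC.
have := @nondecreasing_cvg_mu _ _ _ mu F (fun n => measurable_pos_le (y n)).
rewrite eF => /(_ (measurable_pos_lt t)) H.
have {H} H := H (ltac:(by move=> m n mn; apply/subsetPset => x /= hx; exact: le_trans hx (ynd _ _ mn))).
rewrite -lee_fin /cdf_lt fineK ?fin_num_measure//.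
have <- := cvg_lim _ H; last by [].
apply: lime_le; first by apply/cvg_ex; exists (mu [set x | pos x < t]).
apply: nearW => n /=; have := h _ (y01 n).
by rewrite -lee_fin /cdf_le fineK ?fin_num_measure.
Qed.

Lemma cdf_lt0 t : t <= 0 -> cdf_lt t = 0.
Proof.
move=> t0; rewrite /cdf_lt (_ : [set x | _] = set0) ?measure0//.
apply/seteqP; split=> x //= h; have := pos_itv x; lra.
Qed.

End one_measure.

(** The digit sums of one orbit, that of 0, approximate k times the rotation number of either
    measure up to a bounded error. *)
Lemma rotation_le mu mu' : Tinvariant q mu -> mu (~` arc q g) = 0%E ->
  Tinvariant q mu' -> mu' (~` arc q g) = 0%E -> rotation mu' <= rotation mu.
Proof.
move=> i a i' a'; have z01 : 0 <= (0 : R) < 1 by rewrite lexx ltr01.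
have key k : k%:R * rotation mu' <= 2 + k%:R * rotation mu.
  have := cdf_lt_iter i a k z01; have := cdf_le_iter i' a' k z01.
  have := cdf_lt_ge0 mu (iter k arc_step 0); have := cdf_le_le1 mu' (iter k arc_step 0).
  have : 0 <= cdf_le mu' 0 by exact: fine_ge0.
  by have := cdf_lt_le1 mu 0; lra.
rewrite leNgt; apply/negP => h.
have d0 : 0 < rotation mu' - rotation mu by rewrite subr_gt0.
have := archi_boundP (_ : 0 <= 2 / (rotation mu' - rotation mu)).
rewrite ltr_pdivrMr// => H; have {H} := H (ltac:(by rewrite divr_ge0// ltW)).
by have := key (Num.bound (2 / (rotation mu' - rotation mu))); lra.
Qed.

(** Otherwise the digit sums of t and y would agree forever and the orbit of t would never leave
    [0, 1/q], where the lift expands by Q: the distance between the two orbits would exceed 1. *)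
Lemma cdf_compare mu mu' y t : Tinvariant q mu -> mu (~` arc q g) = 0%E ->
  Tinvariant q mu' -> mu' (~` arc q g) = 0%E -> 0 <= y -> y < t -> t < 1 ->
  cdf_le mu y <= cdf_lt mu' t.
Proof.
move=> i a i' a' y0 yt t1; rewrite leNgt; apply/negP => h.
have y01 : 0 <= y < 1 by lra.
have t01 : 0 <= t < 1 by lra.
have er : rotation mu' = rotation mu by apply/eqP; rewrite eq_le !rotation_le.
have gap k : cdf_lt mu' (iter k arc_step t) + (digit_sum t k)%:~R < 1 + (digit_sum y k)%:~R.
  have := cdf_lt_iter i' a' k t01; have := cdf_le_iter i a k y01; rewrite er.
  by have := cdf_le_le1 mu (iter k arc_step y); lra.
have key k : digit_sum t k = digit_sum y k /\
    iter k arc_step t - iter k arc_step y = Q ^+ k * (t - y).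
  elim: k => [|k [em ed]]; first by rewrite /digit_sum !big_ord0 expr0 mul1r.
  set tk := iter k arc_step t in ed *; set yk := iter k arc_step y in ed *.
  have d0 : 0 < Q ^+ k * (t - y) by rewrite mulr_gt0 ?exprn_gt0 ?subr_gt0//; have := Q2; lra.
  have tq : tk <= Q^-1.
    rewrite leNgt; apply/negP => qt; have := gap k.
    by rewrite -/tk cdf_lt_eq1// em ltxx.
  have q2 := Q2; have q0 : 0 < Q by lra.
  have Qt : Q * tk <= 1 by rewrite mulrC -ler_pdivlMr ?div1r.
  have Qy : Q * yk <= 1 by apply: le_trans Qt; rewrite ler_pM2l//; lra.
  have et := lift_stepE tk; have ey := lift_stepE yk.
  rewrite /lift_step (min_idPl Qt) in et; rewrite /lift_step (min_idPl Qy) in ey.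
  have en : digit tk = digit yk.
    apply/eqP; rewrite eq_le; apply/andP; split; last by apply: digit_le; lra.
    have := gap k.+1; rewrite !digit_sumS -/tk -/yk em !intrD.
    have := cdf_lt_ge0 mu' (iter k.+1 arc_step t) => c0 c1.
    have : (digit tk)%:~R < (digit yk + 1)%:~R :> R by rewrite intrD; lra.
    by rewrite ltr_int ltzD1.
  split; first by rewrite !digit_sumS -/tk -/yk em en.
  rewrite !iterS -/tk -/yk exprS -mulrA -ed; rewrite en in et; lra.
have [n hn] := @geometric_small _ _ Q2 1 (t - y) (ltac:(by rewrite subr_gt0)).
have Qn : 0 < Q ^+ n by rewrite exprn_gt0//; have := Q2; lra.
have [_ e] := key n.
have := iter_arc_step_itv n y01; have := iter_arc_step_itv n t01.
have : 1 < Q ^+ n * (t - y) by rewrite mulrC -ltr_pdivrMr.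
by rewrite -e; lra.
Qed.

Lemma cdf_lt_le mu mu' t : Tinvariant q mu -> mu (~` arc q g) = 0%E ->
  Tinvariant q mu' -> mu' (~` arc q g) = 0%E -> t < 1 -> cdf_lt mu t <= cdf_lt mu' t.
Proof.
move=> i a i' a' t1; have [t0|t0] := leP t 0; first by rewrite !cdf_lt0.
by apply: cdf_lt_left => // y /andP[y0 yt]; exact: cdf_compare.
Qed.

Lemma cdf_lt_uniq mu mu' t : Tinvariant q mu -> mu (~` arc q g) = 0%E ->
  Tinvariant q mu' -> mu' (~` arc q g) = 0%E -> cdf_lt mu t = cdf_lt mu' t.
Proof.
move=> i a i' a'; have [t1|t1] := ltP t 1.
  by apply/eqP; rewrite eq_le !cdf_lt_le.
by have qi := Qi; rewrite !cdf_lt_eq1//; lra.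
Qed.

(** The rays ]-oo, x[ generate the Borel sets and are stable under intersection, so [cdf_lt]
    determines the image of the measure under [pos]; and [pos] is inverted on [0, 1[, which has full
    measure. *)
Lemma arc_invariant_unique mu mu' : Tinvariant q mu -> mu (~` arc q g) = 0%E ->
  Tinvariant q mu' -> mu' (~` arc q g) = 0%E -> forall A, measurable A -> mu A = mu' A.
Proof.
move=> i a i' a'.
have mpos := measurable_frac_shift g.
have eqp B : measurable B -> mu [set x | B (pos x)] = mu' [set x | B (pos x)].
  move=> mB.
  have fin (m : probability R R) : forall A, measurable A -> (pushforward m pos A < +oo)%E.
    move=> A mA; rewrite /pushforward ltey_eq fin_num_measure//.
    by rewrite -[X in measurable X]setTI; exact: mpos.
  have := @measure_unique _ R _ (@RGenInftyO.G R) (fun n => `]-oo, n%:R[%classic)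
    (RGenInftyO.measurableE R) _ _ _ (pushforward mu pos) (pushforward mu' pos) _ _ B mB.
  apply.
  - move=> _ _ [x ->] [y ->]; exists (Num.min x y); apply/seteqP; split=> z /=;
      by rewrite !in_itv/= lt_min => /andP.
  - by move=> n; exists n%:R.
  - apply/seteqP; split=> // x _; exists (Num.bound `|x|) => //=; rewrite in_itv/=.
    by apply: le_lt_trans (ler_norm x) _; exact: archi_boundP.
  - move=> _ [x ->]; have := cdf_lt_uniq x i a i' a'; rewrite /cdf_lt => h.
    have e (m : probability R R) : pushforward m pos `]-oo, x[ = m [set z | pos z < x].
      by rewrite /pushforward; congr (m _); apply/seteqP; split=> z /=; rewrite in_itv.
    have mx : measurable [set z | pos z < x].
      have := mpos measurableT _ (measurable_itv `]-oo, x[); rewrite setTI.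
      by congr measurable; apply/seteqP; split=> z /=; rewrite in_itv.
    apply: (etrans (e mu)); apply: (etrans _ (esym (e mu'))).
    by have := congr1 EFin h; rewrite !fineK ?fin_num_measure.
  - by move=> k; apply: fin; exact: measurable_itv.
move=> A mA.
pose I01 : set R := [set` `[0, 1[%R].
have full (m : probability R R) (S : set R) : Tinvariant q m -> measurable S -> m (S `&` I01) = m S.
  move=> [m1 _] mS; have mI := measurable_itv `[(0 : R), 1[.
  have m0 : m (~` I01) = 0%E.
    transitivity (1 - m I01)%E; first exact: probability_setC.
    by have -> : m I01 = 1%E := m1; rewrite subee.
  have e0 : m (S `\` I01) = 0%E; last first.
    by have := measureDI m mS mI; rewrite -/I01 => ->; rewrite [X in (X + _)%E]e0 add0e.
  apply: (subset_measure0 _ _ _ m0); [exact: measurableD|exact: measurableC|].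
  by move=> x [].
pose B := [set d | A (frac (d + g))].
have mB : measurable B.
  have := measurable_frac_shift (- g) measurableT mA; rewrite setTI.
  by congr measurable; apply/seteqP; split=> d /=; rewrite opprK.
have mpB : measurable [set x | B (pos x)].
  by have := mpos measurableT _ mB; rewrite setTI.
have eAB : A `&` I01 = [set x | B (pos x)] `&` I01.
  have fr x : 0 <= x < 1 -> frac (pos x + g) = x.
    move=> x01; rewrite /pos; have e := floor_frac (x - g).
    have [_ ->] := @fracP R (frac (x - g) + g) (- Num.floor (x - g)) x x01 (ltac:(rewrite intrN; lra)).
    by [].
  apply/seteqP; split=> x [h x01]; split=> //; have := x01; rewrite /I01/= in_itv/= => x01'.
    by rewrite /B/= fr.
  by move: h; rewrite /B/= fr.
by rewrite -(full mu A i mA) eAB (full mu _ i mpB) (eqp B mB) -(full mu' _ i' mpB) -eAB (full mu').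
Qed.

End arc_uniqueness.

(** * Existence of an invariant measure on an arc *)

Section sturmian_coding.
Context {R : realType} (q : nat).
Hypothesis hq : (2 <= q)%N.
Implicit Types (rho th g : R).

Local Notation Q := (q%:R : R).

Let Q2 : 2 <= Q. Proof. by rewrite ler_nat. Qed.

Let Qn0 n : 0 < Q ^+ n. Proof. by rewrite exprn_gt0//; have := Q2; lra. Qed.

Definition rot_digit rho th : R := (Num.floor (th + rho))%:~R - (Num.floor th)%:~R.

Definition coding_sum rho th n : R :=
  \sum_(k < n) rot_digit rho (th + k%:R * rho) / Q ^+ k.+1.

Lemma norm_rot_digit rho th : `|rot_digit rho th| <= `|rho| + 1.
Proof.
rewrite /rot_digit.
have := floor_frac th; have := frac_itv th; have := floor_frac (th + rho); have := frac_itv (th + rho).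
by have := ler_norm rho; have := ler_norm (- rho); rewrite normrN ler_norml; lra.
Qed.

Lemma exists_coding rho th : exists l, forall n,
  `|coding_sum rho th n - l| <= 2 * (`|rho| + 1) / Q ^+ n.
Proof.
apply: (geometric_limit Q2) => n; rewrite /coding_sum big_ord_recr/= addrAC subrr add0r.
rewrite normrM normfV (ger0_norm (ltW (Qn0 n.+1))).
apply: ler_pM => //; first exact: norm_rot_digit.
rewrite lef_pV2 ?posrE// exprS; have := Qn0 n; have := Q2; nra.
Qed.

(* The point whose orbit under x |-> q x mod 1 follows the rotation by rho started at th:
   its base q digits are the increments of the integer part along the rotation. *)
Definition coding rho th : R :=
  xget 0 [set l | forall n, `|coding_sum rho th n - l| <= 2 * (`|rho| + 1) / Q ^+ n].

Lemma codingP rho th n : `|coding_sum rho th n - coding rho th| <= 2 * (`|rho| + 1) / Q ^+ n.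
Proof.
rewrite /coding; case: xgetP => [l _ /(_ n)//|] no.
by have [l hl] := exists_coding rho th; have := no l.
Qed.

Lemma norm_coding rho th : `|coding rho th| <= 2 * (`|rho| + 1).
Proof.
by have := codingP rho th 0; rewrite /coding_sum big_ord0 sub0r normrN expr0 divr1.
Qed.

Lemma rot_digitD rho th (m : int) : rot_digit rho (th + m%:~R) = rot_digit rho th.
Proof.
have fl (x : R) : Num.floor (x + m%:~R) = Num.floor x + m.
  apply: (@intr_inj R); rewrite intrD.
  by have := floor_frac (x + m%:~R); have := floor_frac x; rewrite fracDz; lra.
by rewrite /rot_digit addrAC !fl !intrD; ring.
Qed.

Lemma codingD rho th (m : int) : coding rho (th + m%:~R) = coding rho th.
Proof.
rewrite /coding; congr xget; apply/funext => l.
have e n : coding_sum rho (th + m%:~R) n = coding_sum rho th n.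
  by apply: eq_bigr => k _; rewrite addrAC rot_digitD.
by apply/propext; split=> h n; have := h n; rewrite e.
Qed.

Lemma codingE rho th : Q * coding rho th = coding rho (th + rho) + rot_digit rho th.
Proof.
have q2 := Q2; have Q0 : Q != 0 by rewrite gt_eqF//; lra.
have e n : Q * coding_sum rho th n.+1 = rot_digit rho th + coding_sum rho (th + rho) n.
  rewrite /coding_sum big_ord_recl /= mul0r addr0 expr1 mulrDr mulrCA mulfV// mulr1.
  congr (_ + _); rewrite mulr_sumr; apply: eq_bigr => k _.
  rewrite /bump /= add1n (_ : th + k.+1%:R * rho = th + rho + k%:R * rho).
    by rewrite exprS; field; rewrite Q0 gt_eqF.
  by rewrite -[k.+1%:R]natr1; ring.
pose C := 4 * (`|rho| + 1).
have key n : `|Q * coding rho th - (coding rho (th + rho) + rot_digit rho th)| <= 0 + C / Q ^+ n.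
  have h1 := codingP rho th n.+1; have h2 := codingP rho (th + rho) n.
  have h3 : Q * `|coding_sum rho th n.+1 - coding rho th| <= 2 * (`|rho| + 1) / Q ^+ n.
    have -> : 2 * (`|rho| + 1) / Q ^+ n = Q * (2 * (`|rho| + 1) / Q ^+ n.+1).
      by rewrite exprS; field; rewrite Q0 gt_eqF.
    by rewrite ler_pM2l//; lra.
  have -> : Q * coding rho th - (coding rho (th + rho) + rot_digit rho th) =
     (coding_sum rho (th + rho) n - coding rho (th + rho)) - Q * (coding_sum rho th n.+1 - coding rho th).
    by rewrite mulrBr e; ring.
  rewrite add0r (le_trans (ler_normB _ _))// normrM ger0_norm ?ler0n//.
  have -> : C / Q ^+ n = 2 * (`|rho| + 1) / Q ^+ n + 2 * (`|rho| + 1) / Q ^+ n by rewrite /C; ring.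
  exact: lerD.
by have := le_geometric_limit Q2 key; rewrite normr_le0 subr_eq0 => /eqP.
Qed.

(* m and m' are the partial sums of the base q digits of y 0 and y' 0. *)
Lemma digit_sums_le (y y' m m' : nat -> R) k :
  (forall i, Q * y i = y i.+1 + (m i.+1 - m i)) ->
  (forall i, Q * y' i = y' i.+1 + (m' i.+1 - m' i)) ->
  (forall i, (i <= k)%N -> m i <= m' i) -> m 0%N = m' 0%N ->
  y 0%N - y' 0%N <= (y k - y' k) / Q ^+ k.
Proof.
move=> hy hy' hm m0; have q2 := Q2.
suff : (y k - y' k) - Q ^+ k * (y 0%N - y' 0%N) >= m' k - m k.
  by rewrite ler_pdivlMr ?Qn0// mulrC; have := hm k (leqnn k); lra.
elim: k hm => [|k IH] hm; first by rewrite m0 expr0; lra.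
have {}IH := IH (fun i ik => hm i (leqW ik)); have hk := hm k (leqnSn k).
have := hy k; have := hy' k; rewrite exprS -mulrA.
move: (Q ^+ k * _) IH => X IH e' e; nra.
Qed.

(** Summation by parts gives (1 - 1/q) times the sum over k ≥ 1 of floor (th + k rho) / q^k, which
    is monotone in th and in rho; adding floor th / q is what cancels the term k = 0. *)
Definition lift_coding rho th : R := coding rho th + (Num.floor th)%:~R / Q.

Lemma lift_codingE rho th :
  Q * lift_coding rho th = coding rho (th + rho) + (Num.floor (th + rho))%:~R.
Proof.
have q2 := Q2; rewrite /lift_coding mulrDr codingE mulrCA mulfV ?mulr1 ?gt_eqF//; last lra.
by rewrite /rot_digit; ring.
Qed.

(** Finitely many floors are compared, with slack e: a slack e in every floor is worth e / Q, and
    the digits beyond are bounded by the geometric tail. *)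
Lemma lift_coding_le_approx rho rho' th th' (e : R) k :
  (forall i, (i <= k)%N -> (Num.floor (th + i.+1%:R * rho))%:~R <=
     (Num.floor (th' + i.+1%:R * rho'))%:~R + e) ->
  lift_coding rho th <= lift_coding rho' th' + e / Q +
    (2 * (`|rho| + 1) + 2 * (`|rho'| + 1)) / Q ^+ k.
Proof.
move=> h; have q2 := Q2; have Q0 : Q != 0 by rewrite gt_eqF//; lra.
(* The slack enters all partial sums but the zeroth, as if the first digit were larger by e. *)
pose m (rho th e : R) i : R := if i is i'.+1 then (Num.floor (th + i'.+1%:R * rho))%:~R + e else 0.
pose y (rho th e : R) i : R := if i is i'.+1 then coding rho (th + i'.+1%:R * rho)
  else lift_coding rho th + e / Q.
have hy r t d i : Q * y r t d i = y r t d i.+1 + (m r t d i.+1 - m r t d i).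
  case: i => [|i] /=.
    by rewrite mulrDr mulrCA mulfV// mulr1 lift_codingE mul1r; ring.
  have -> : t + i.+2%:R * r = t + i.+1%:R * r + r by rewrite -[i.+2%:R]natr1; ring.
  by rewrite codingE /rot_digit; ring.
have := @digit_sums_le (y rho th 0) (y rho' th' e) (m rho th 0) (m rho' th' e) k.+1 (hy _ _ _) (hy _ _ _) _ erefl.
rewrite /= mul0r addr0 => H.
have {}H : lift_coding rho th - (lift_coding rho' th' + e / Q) <=
   (coding rho (th + k.+1%:R * rho) - coding rho' (th' + k.+1%:R * rho')) / Q ^+ k.+1.
  by apply: H => -[|i] //= ik; rewrite addr0; exact: h.
rewrite -lerBlDl; apply: le_trans H _.
set c := coding _ _; set c' := coding _ _.
have hc : c - c' <= 2 * (`|rho| + 1) + 2 * (`|rho'| + 1).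
  have := norm_coding rho (th + k.+1%:R * rho); rewrite -/c ler_norml => /andP[_ c1].
  have := norm_coding rho' (th' + k.+1%:R * rho'); rewrite -/c' ler_norml => /andP[c2 _].
  by move: c1 c2; move: (2 * _) (2 * _) => A B; lra.
apply: (@le_trans _ _ ((2 * (`|rho| + 1) + 2 * (`|rho'| + 1)) / Q ^+ k.+1)).
  by rewrite ler_pM2r ?invr_gt0.
rewrite ler_wpM2l//.
by rewrite lef_pV2 ?posrE// exprS ler_peMl ?(ltW (Qn0 _))//; lra.
Qed.

Lemma lift_coding_le rho rho' th th' :
  (forall i, th + i.+1%:R * rho <= th' + i.+1%:R * rho') ->
  lift_coding rho th <= lift_coding rho' th'.
Proof.
move=> h; apply: (le_geometric_limit Q2) => k.
have := @lift_coding_le_approx rho rho' th th' 0 k; rewrite mul0r addr0; apply.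
by move=> i _; rewrite addr0 ler_int le_floor.
Qed.

Lemma lift_coding_int (N : int) : lift_coding N%:~R 0 = N%:~R / (Q - 1).
Proof.
have q2 := Q2; have := lift_codingE N%:~R 0; rewrite codingD add0r intrKfloor /lift_coding floor0 mul0r addr0 => h.
by apply: (@mulIf _ (Q - 1)); [rewrite gt_eqF//; lra|rewrite divfK; [lra|rewrite gt_eqF//; lra]].
Qed.

(** rho is the threshold at which the point coded from 0 passes g. As far as the first k + 1 floors
    are concerned, a start at th > 0 dominates a start at 0 with rotation number up to rho + th / (k
    + 1). In the other direction it exceeds a start at 0 with number rho - (1 - th) / (k + 1) by at
    most one unit in each floor, and one unit in every floor is worth 1/q. *)
Lemma exists_rotation g : exists rho, forall th, 0 < th < 1 ->
  g <= lift_coding rho th <= g + Q^-1.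
Proof.
have q2 := Q2; have q1 : 0 < Q - 1 by lra.
pose S := [set rho | g <= lift_coding rho 0].
have S0 : S !=set0.
  exists (Num.floor (g * (Q - 1)) + 1)%:~R; rewrite /S /= lift_coding_int ler_pdivlMr//.
  by apply/ltW; exact: floorD1_gt.
have lbS : lbound S (Num.floor (g * (Q - 1)) - 1)%:~R.
  move=> rho Srho; rewrite leNgt; apply/negP => h.
  have : lift_coding rho 0 <= lift_coding (Num.floor (g * (Q - 1)) - 1)%:~R 0.
    by apply: lift_coding_le => i; rewrite lerD2l ler_wpM2l// ltW.
  rewrite lift_coding_int ler_pdivlMr// intrB => h1.
  have := floor_itv (g * (Q - 1)) => /andP[h2 _].
  have : g * (Q - 1) <= lift_coding rho 0 * (Q - 1) by rewrite ler_pM2r.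
  by lra.
have hS : has_inf S by split=> //; exists (Num.floor (g * (Q - 1)) - 1)%:~R.
have [rho [rho_lb rho_adh]] : exists rho, (forall rho', S rho' -> rho <= rho') /\
    (forall e, 0 < e -> exists2 rho', S rho' & rho' < rho + e).
  exists (inf S); split=> [rho' Srho'|e e0].
    by apply: inf_lbound => //; exists (Num.floor (g * (Q - 1)) - 1)%:~R.
  by have [rho' Srho' h] := inf_adherent e0 hS; exists rho'.
exists rho => th /andP[th0 th1].
(* C dominates the tail constants of all rho' within distance 1 of rho. *)
pose C := 4 * (`|rho| + 2).
have bound rho' : `|rho' - rho| <= 1 -> 2 * (`|rho| + 1) + 2 * (`|rho'| + 1) <= C.
  move=> h; have : `|rho'| <= `|rho| + 1.
    by rewrite -[rho'](subrK rho) addrC (le_trans (ler_normD _ _))// lerD2l.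
  by rewrite /C; lra.
have kle (i k : nat) (t : R) : (i <= k)%N -> 0 <= t -> i.+1%:R * (t / k.+1%:R) <= t.
  move=> ik t0; rewrite mulrCA ler_piMr// ler_pdivrMr// mul1r ler_nat//.
have div1 (t : R) (k : nat) : 0 < t -> t < 1 -> 0 < t / k.+1%:R <= 1.
  move=> t0 t1; rewrite divr_gt0//= ler_pdivrMr// mul1r.
  by apply: (@le_trans _ _ 1); [exact: ltW|rewrite ler1n].
apply/andP; split; apply: (@le_geometric_limit _ _ Q2 _ _ C) => k.
- have /andP[d0 d1] := div1 th k th0 th1.
  have [rho' Srho' hrho'] := rho_adh _ d0.
  have rr := rho_lb _ Srho'.
  apply: le_trans Srho' _.
  apply: le_trans (@lift_coding_le_approx rho' rho 0 th 0 k _) _ => [i ik|].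
    rewrite addr0 ler_int le_floor// add0r.
    have := kle i k th ik (ltW th0).
    have : i.+1%:R * (rho' - rho) <= i.+1%:R * (th / k.+1%:R).
      by rewrite ler_wpM2l// lerBlDl ltW.
    by move=> h1 h2; have := le_trans h1 h2; rewrite mulrBr lerBlDr.
  rewrite mul0r addr0 lerD2l ler_pM2r ?invr_gt0// [leLHS]addrC.
  by apply: bound; rewrite ger0_norm ?subr_ge0// lerBlDl (le_trans (ltW hrho'))// lerD2l.
- have /andP[d0 d1] := div1 (1 - th) k (ltac:(lra)) (ltac:(lra)).
  pose rho' := rho - (1 - th) / k.+1%:R.
  have nS : lift_coding rho' 0 < g.
    rewrite ltNge; apply/negP => Srho'.
    by have := rho_lb _ Srho'; rewrite leNgt /rho' ltrBlDr ltrDl d0.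
  apply: le_trans (@lift_coding_le_approx rho rho' th 0 1 k _) _ => [i ik|].
    rewrite add0r -[1%R in leRHS]/(1%:~R) -intrD ler_int -ltzD1 -(ltr_int R) !intrD.
    have := kle i k (1 - th) ik (ltac:(lra)).
    have := floor_frac (th + i.+1%:R * rho); have := frac_itv (th + i.+1%:R * rho).
    have := floor_frac (i.+1%:R * rho'); have := frac_itv (i.+1%:R * rho').
    have : i.+1%:R * rho' = i.+1%:R * rho - i.+1%:R * ((1 - th) / k.+1%:R) by rewrite mulrBr.
    move: (i.+1%:R * rho') (i.+1%:R * rho) (_ * (_ / _)) => a b e.
    lra.
  rewrite mul1r; apply: lerD; first by rewrite lerD2r ltW.
  rewrite ler_pM2r ?invr_gt0//; apply: bound.
  by rewrite /rho' addrAC subrr sub0r normrN ger0_norm// ltW.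
Qed.

(** This semiconjugacy carries Lebesgue measure, invariant under the rotation, to a T-invariant
    measure. *)
Lemma frac_lift_coding_step rho th :
  frac (Q * frac (lift_coding rho th)) = frac (lift_coding rho (frac (th + rho))).
Proof.
have -> : Q * frac (lift_coding rho th) = Q * lift_coding rho th + (- (q%:Z * Num.floor (lift_coding rho th)))%:~R.
  by rewrite intrN intrM /frac; ring.
rewrite fracDz lift_codingE fracDz /lift_coding.
have -> : Num.floor (frac (th + rho)) = 0.
  by apply: floor_def; rewrite add0r; exact: frac_itv.
rewrite mulr0z mul0r addr0; congr frac.
by rewrite [in LHS](floor_frac (th + rho)) addrC codingD.
Qed.

Lemma measurable_lift_coding rho : measurable_fun setT (fun th => frac (lift_coding rho th)).
Proof.
apply: (measurableT_comp (@measurable_frac R)); apply: nondecreasing_measurable => // x y xy.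
by apply: lift_coding_le => i; rewrite lerD2r.
Qed.

End sturmian_coding.

(** * Invariance of Lebesgue measure under rotations *)

Section rotation_invariance.
Context {R : realType}.
Local Notation mu := (@lebesgue_measure R).

Lemma lebesgue_measure_shift (a : R) (A : set R) : measurable A ->
  mu [set x | A (x + a)] = mu A.
Proof.
move=> mA; have ms : measurable_fun setT (fun x : R => x + a) by exact: measurable_funD.
have H := @lebesgue_measure_unique R
  (pushforward mu (fun x : measurableTypeR R => x + a : measurableTypeR R)).
apply/esym; apply: H => // _ [[x y] _ <-] /=.
have e : (fun z : R => z + a) @^-1` `]x, y]%classic = `]x - a, y - a]%classic.
  by apply/seteqP; split=> z /=; rewrite !in_itv/= ltrBlDr lerBrDr.
apply: (etrans _ (congr1 mu (esym e))).
rewrite !lebesgue_measure_itv/= !lte_fin ltrD2r -!EFinD.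
by case: ifP => // _; congr EFin; ring.
Qed.

(** On [0, 1[ the rotation exchanges two intervals, one translated by r and the other by r - 1. *)
Lemma lebesgue_measure_rotation (rho : R) (B : set R) : measurable B ->
  mu ([set x | B (frac (x + rho))] `&` `[0, 1[%classic) = mu (B `&` `[0, 1[%classic).
Proof.
move=> mB; have [r [m [r01 ex]]] : exists r (m : int), 0 <= r < 1 /\ rho = m%:~R + r.
  by exists (frac rho), (Num.floor rho); rewrite frac_itv -floor_frac.
have e1 : [set x | B (frac (x + rho))] `&` `[0, 1[%classic =
    [set x | (B `&` `[r, 1[%classic) (x + r)] `|` [set x | (B `&` `[0, r[%classic) (x + (r - 1))].
  apply/seteqP; split=> x /=; rewrite !in_itv/=.
    move=> [Bx x01].
    have [xr|xr] := ltP (x + r) 1; [left|right].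
      have [_ e] := @fracP R (x + rho) m (x + r) (ltac:(lra))
        (ltac:(lra)).
      by rewrite -e; split=> //; rewrite e; lra.
    have [_ e] := @fracP R (x + rho) (m + 1) (x + (r - 1))
      (ltac:(lra)) (ltac:(rewrite intrD; lra)).
    by rewrite -e; split=> //; lra.
  move=> [[Bx xr]|[Bx xr]].
    have [_ e] := @fracP R (x + rho) m (x + r) (ltac:(lra))
      (ltac:(lra)).
    by rewrite e; split=> //; lra.
  have [_ e] := @fracP R (x + rho) (m + 1) (x + (r - 1))
    (ltac:(lra)) (ltac:(rewrite intrD; lra)).
  by rewrite e; split=> //; lra.
have e2 : B `&` `[0, 1[%classic = (B `&` `[r, 1[%classic) `|` (B `&` `[0, r[%classic).
  rewrite -setIUr; congr (_ `&` _); apply/seteqP; split=> x /=; rewrite !in_itv/=.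
    by move=> x01; have [xr|xr] := ltP x r; [right|left]; lra.
  by case=> ?; lra.
have m1 : measurable (B `&` `[r, 1[%classic) by exact: measurableI.
have m2 : measurable (B `&` `[0, r[%classic) by exact: measurableI.
have ms (a : R) (S : set R) : measurable S -> measurable [set x | S (x + a)].
  move=> mS; rewrite -[X in measurable X]setTI.
  exact: (measurable_funD (@measurable_id _ _ _) (@measurable_cst _ _ _ _ _ _)) mS.
rewrite e1 e2 !measureU//; try exact: ms.
- by congr (_ + _)%E; exact: lebesgue_measure_shift.
- by apply/seteqP; split=> x //= [[_ +] [_ +]]; rewrite !in_itv/=; lra.
- by apply/seteqP; split=> x //= [[_ +] [_ +]]; rewrite !in_itv/=; lra.
Qed.

End rotation_invariance.

(** * The image of Lebesgue measure under the coding *)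

Section sturmian_measure.
Context {R : realType} (q : nat) (rho : R).
Hypothesis hq : (2 <= q)%N.

Local Notation Q := (q%:R : R).
Local Notation mu := (@lebesgue_measure R).

Let h th := frac (lift_coding q rho th).

Let mh : measurable_fun setT h. Proof. exact: measurable_lift_coding. Qed.

Let mI : measurable (`[0, 1[%classic : set (measurableTypeR R)).
Proof. exact: measurable_itv. Qed.

Let mhI (A : set R) : measurable A -> measurable (h @^-1` A `&` `[0, 1[%classic).
Proof. by move=> mA; apply: measurableI => //; rewrite -[X in measurable X]setTI; exact: mh. Qed.

Definition sturmian_measure (A : set R) : \bar R := mu (h @^-1` A `&` `[0, 1[%classic).

Let sturmian_measure0 : sturmian_measure set0 = 0%E.
Proof. by rewrite /sturmian_measure preimage_set0 set0I measure0. Qed.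

Let sturmian_measure_ge0 A : (0 <= sturmian_measure A)%E.
Proof. exact: measure_ge0. Qed.

Let sturmian_measure_sigma_additive : semi_sigma_additive sturmian_measure.
Proof.
move=> F mF tF mUF; rewrite /sturmian_measure preimage_bigcup setI_bigcupl.
apply: measure_semi_sigma_additive.
- by move=> n; exact: mhI.
- apply/trivIsetP => /= i j _ _ ij; rewrite setIACA setIid -preimage_setI.
  by move/trivIsetP : tF => /(_ _ _ _ _ ij) ->//; rewrite preimage_set0 set0I.
- by rewrite -setI_bigcupl -preimage_bigcup; exact: mhI.
Qed.

HB.instance Definition _ := isMeasure.Build _ R R sturmian_measure
  sturmian_measure0 sturmian_measure_ge0 sturmian_measure_sigma_additive.

Let sturmian_measureT : sturmian_measure setT = 1%E.
Proof.
rewrite /sturmian_measure preimage_setT setTI lebesgue_measure_itv/= lte_fin ltr01.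
by rewrite -EFinD subr0.
Qed.

HB.instance Definition _ := @Measure_isProbability.Build _ R R sturmian_measure sturmian_measureT.

Definition sturmian_probability : probability R R := sturmian_measure.

Lemma sturmian_probability_inv : Tinvariant q sturmian_probability.
Proof.
split=> [|A mA].
  have <- : sturmian_probability setT = 1%E by exact: probability_setT.
  congr (mu (_ `&` _)); apply/seteqP; split=> // th _ /=.
  by rewrite in_itv/=; exact: frac_itv.
rewrite /sturmian_probability /= /sturmian_measure.
have -> : h @^-1` (Tmap q @^-1` A) = [set th | (h @^-1` A) (frac (th + rho))].
  by apply/seteqP; split=> th /=; rewrite /Tmap /h frac_lift_coding_step.
apply: lebesgue_measure_rotation.
by rewrite -[X in measurable X]setTI; exact: mh.
Qed.

Lemma sturmian_probability_arc g :
  (forall th, 0 < th < 1 -> g <= lift_coding q rho th <= g + Q^-1) ->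
  sturmian_probability (~` arc q g) = 0%E.
Proof.
move=> hg; have q2 : 2 <= Q by rewrite ler_nat.
have qi : 0 < Q^-1 <= 2^-1 by rewrite invr_gt0 lef_pV2 ?posrE//; lra.
(* The hypothesis is silent about th = 0, a null set. *)
apply: (@subset_measure0 _ _ _ mu _ [set 0]).
- by apply: mhI; apply: measurableC; exact: measurable_arc.
- exact: measurable_set1.
- move=> th [/= narc]; rewrite in_itv/= => th01; apply: contrapT => /eqP th0.
  have {}th0 : 0 < th < 1 by rewrite lt_neqAle eq_sym th0; lra.
  apply: narc; have := hg th th0 => hth; rewrite /arc /=.
  have e := floor_frac (lift_coding q rho th).
  have [_ ->] := @fracP R (h th - g) (- Num.floor (lift_coding q rho th)) (lift_coding q rho th - g)
    (ltac:(lra)) (ltac:(rewrite intrN /h; lra)).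
  by case/andP: hth => _; rewrite lerBlDl.
- exact: lebesgue_measure_set1.
Qed.

End sturmian_measure.

Theorem theorem4p1 (R : realType) (q : nat) (hq : (2 <= q)%N) :
  (forall c : R, exists nu : probability R R,
      maximizing q c nu /\ sturmian q nu /\
      (forall nu' : probability R R, maximizing q c nu' ->
         forall A : set R, measurable A -> nu' A = nu A)) /\
  (exists C : R, 0 < C /\
     forall (c x : R) (n : nat), (1 <= n)%N ->
       ((\sum_(0 <= i < n) fc q c (q%:R ^+ i * x)) - n%:R%:E * beta q c
          <= C%:E)%E).
Proof.
(* A single invariant measure carried by the arc identifies beta with the constant b of the
   sub-action. *)
have key (c : R) : exists psi b a (nu : probability R R), [/\ calibrated q c psi b a,
    Tinvariant q nu, nu (~` arc q a) = 0%E & beta q c = b%:E].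
  have [psi [b [a cal]]] := exists_calibrated hq c.
  have [rho hrho] := exists_rotation hq a.
  pose nu := sturmian_probability rho hq.
  have inv : Tinvariant q nu := sturmian_probability_inv rho hq.
  have nu0 : nu (~` arc q a) = 0%E := sturmian_probability_arc hq hrho.
  exists psi, b, a, nu; split=> //; apply/eqP; rewrite eq_le; apply/andP; split.
    by apply: ge_ereal_sup => _ [mu [mu_inv <-]]; exact: integral_fc_le cal.
  by apply: ereal_sup_ubound; exists nu; split=> //; exact: integral_fc_eq cal nu0.
split=> [c|].
  have [psi [b [a [nu [cal inv nu0 eb]]]]] := key c.
  exists nu; split; [split=> //|split; [split=> //; by exists a|]].
    by rewrite eb; exact: integral_fc_eq cal nu0.
  move=> nu' [inv' enu'] A mA.
  have nu'0 : nu' (~` arc q a) = 0%E by apply: (integral_fc_arc hq inv' cal); rewrite enu'.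
  exact: (@arc_invariant_unique R q a hq nu' nu).
(* The added 1 makes C positive, [sub_lip_ge0] being a weak inequality. *)
exists (sub_lip q + 1); split; first by have := @sub_lip_ge0 R q hq; lra.
move=> c x n _; have [psi [b [a [nu [cal _ _ ->]]]]] := key c.
rewrite leeBlDr//; apply: le_trans (cal_sum_le hq x n cal) _.
by rewrite -EFinM -EFinD lee_fin; lra.
Qed.
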